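(* Let $q\in\mathbb{C}^*$, let $r=q^3$, and let $m\ge 0$ be an integer. \begin{enumerate} \item If $q$ is not a root of unity, then $\overline{\mathcal{C}}_m(r,q)\cong \mathcal{S}^2T_m$ as $\mathbb{C}$-algebras. \item If $q^2$ is a primitive $\ell$th root of unity with $6\le\ell<\infty$, then $\overline{\mathcal{C}}_m(r,q)\cong \mathcal{S}^2\overline{T}_m$ as $\mathbb{C}$-algebras. \end{enumerate}
   Context: Temperley-Lieb algebras: $T_m=T_m(q)$ is the $\mathbb{C}$-algebra generated by $e_1,\dots,e_{m-1}$ with relations $e_ie_{i\pm1}e_i=\frac{1}{(q+q^{-1})^2}e_i$, $e_ie_j=e_je_i$ for $|i-j|\ge2$, and $e_i^2=e_i$; $T_0=T_1=\mathbb{C}$. The inductive limit of the $T_m$ carries a unique trace $\mathrm{tr}$ with $\mathrm{tr}(1)=1$, $\mathrm{tr}(ab)=\mathrm{tr}(ba)$ and $\mathrm{tr}(ae_{m-1})=\frac{1}{(q+q^{-1})^2}\mathrm{tr}(a)$ for $a\in T_{m-1}$. Put $J_m=\{a\in T_m:\mathrm{tr}(ab)=0\text{ for all }b\in T_m\}$ and $\overline{T}_m=T_m/J_m$. BMW algebras: $\mathcal{C}_m(r,q)$ is the $\mathbb{C}$-algebra with invertible generators $G_1,\dots,G_{m-1}$ satisfying the braid relations $G_iG_{i+1}G_i=G_{i+1}G_iG_{i+1}$ and $G_iG_j=G_jG_i$ for $|i-j|\ge2$, together with $(G_i-r^{-1})(G_i-q)(G_i+q^{-1})=0$ and $E_iG_{i-1}^{\pm1}E_i=r^{\pm1}E_i$,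 where $E_i$ is defined by $(q-q^{-1})(1-E_i)=G_i-G_i^{-1}$; $\mathcal{C}_0=\mathcal{C}_1=\mathbb{C}$. Let $x=\frac{r-r^{-1}}{q-q^{-1}}+1$. The inductive limit of the $\mathcal{C}_m(r,q)$ carries a unique functional $\mathrm{Tr}$ with $\mathrm{Tr}(1)=1$, $\mathrm{Tr}(ab)=\mathrm{Tr}(ba)$, $\mathrm{Tr}(E_i)=1/x$, $\mathrm{Tr}(G_i^{\pm1})=r^{\pm1}/x$, and $\mathrm{Tr}(a\chi b)=\mathrm{Tr}(\chi)\mathrm{Tr}(ab)$ for $a,b\in\mathcal{C}_{m-1}(r,q)$, $\chi\in\{G_{m-1},E_{m-1}\}$. Put $A_m(r,q)=\{a\in\mathcal{C}_m(r,q):\mathrm{Tr}(ab)=0\text{ for all }b\in\mathcal{C}_m(r,q)\}$ and $\overline{\mathcal{C}}_m(r,q)=\mathcal{C}_m(r,q)/A_m(r,q)$. Symmetric square: for an associative $\mathbb{C}$-algebra $A$, $\mathcal{S}^2A$ is the subalgebra of $A\otimes_{\mathbb{C}}A$ generated by $\{a\otimes a: a\in A\}$. *)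

(* Defs.v *)
From HB Require Import structures.
From mathcomp Require Import all_boot all_order all_algebra.
From mathcomp Require Import finmap monalg.
From mathcomp Require Import boolp reals.
From mathcomp.real_closed Require Export complex.
From mathcomp Require Export boolp reals all_boot all_order all_algebra.

Set Implicit Arguments.
Unset Strict Implicit.
Unset Printing Implicit Defensive.

Import GRing.Theory.
Local Open Scope ring_scope.
Local Open Scope quotient_scope.

(** MathComp's [algType] requires [1 != 0].  A quotient by an arbitrary
    two-sided ideal may be zero, so algebras here are unital associative
    algebras in which [1 = 0] is not excluded.  Hierarchy-Builder does not
    accept a new join of [lmodType] and [pzRingType] on top of the existing
    hierarchy, so the product is a field of the structure and the
    [pzRingType] instance is derived from it. *)
HB.mixin Record isPzAlgebra (K : fieldType) A of GRing.Lmodule K A := {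
  pzone : A;
  pzmul : A -> A -> A;
  pzmulA : associative pzmul;
  pzmul1r : left_id pzone pzmul;
  pzmulr1 : right_id pzone pzmul;
  pzmulDl : left_distributive pzmul +%R;
  pzmulDr : right_distributive pzmul +%R;
  pzmulZl : forall (k : K) (a b : A), k *: pzmul a b = pzmul (k *: a) b;
  pzmulZr : forall (k : K) (a b : A), k *: pzmul a b = pzmul a (k *: b)
}.

#[short(type="pzAlgType")]
HB.structure Definition PzAlgebra (K : fieldType) :=
  {A of GRing.Lmodule K A & isPzAlgebra K A}.

HB.instance Definition _ (K : fieldType) (A : pzAlgType K) :=
  GRing.Zmodule_isPzRing.Build A pzmulA pzmul1r pzmulr1 pzmulDl pzmulDr.

HB.factory Record PzRing_isPzAlgebra (K : fieldType) A
    of GRing.PzRing A & GRing.Lmodule K A := {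
  ring_scalerAl : forall (k : K) (a b : A), k *: (a * b) = (k *: a) * b;
  ring_scalerAr : forall (k : K) (a b : A), k *: (a * b) = a * (k *: b)
}.
HB.builders Context K A of PzRing_isPzAlgebra K A.
HB.instance Definition _ := isPzAlgebra.Build K A
  (@mulrA A) (@mul1r A) (@mulr1 A) (@mulrDl A) (@mulrDr A)
  ring_scalerAl ring_scalerAr.
HB.end.

Lemma pz_scalerAl (K : fieldType) (A : pzAlgType K) (k : K) (a b : A) :
  k *: (a * b) = (k *: a) * b.
Proof. exact: pzmulZl. Qed.
Lemma pz_scalerAr (K : fieldType) (A : pzAlgType K) (k : K) (a b : A) :
  k *: (a * b) = a * (k *: b).
Proof. exact: pzmulZr. Qed.

Definition alg_morphism (K : fieldType) (A B : pzAlgType K) (f : A -> B) : Prop :=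
  linear f /\ monoid_morphism f.

Definition alg_iso (K : fieldType) (A B : pzAlgType K) : Prop :=
  exists f : A -> B, alg_morphism f /\ bijective f.

(** Seals the constructions below, so that unification does not compute inside
    free modules; [locked_withE] unseals. *)
Fact alg_key : unit. Proof. exact: tt. Qed.

Record submodule (K : fieldType) (V : lmodType K) := Submodule {
  submod_pred :> V -> bool;
  submod_closedP : GRing.submod_closed submod_pred
}.

HB.instance Definition _ (K : fieldType) (V : lmodType K) (I : submodule V) :=
  GRing.isSubmodClosed.Build K V (submod_pred I) (submod_closedP I).

Section QuotLmodule.
Variables (K : fieldType) (V : lmodType K) (I : submodule V).

Definition lquot : Type :=
  Quotient.quot (GRing.ZmodClosed.clone V (submod_pred I) _).
HB.instance Definition _ := GRing.Zmodule.on lquot.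

Definition lpi : V -> lquot :=
  locked_with alg_key (fun v => \pi_(Quotient.quot _) v).
Definition lrepr : lquot -> V := locked_with alg_key (fun x => repr x).

Lemma lreprK : cancel lrepr lpi.
Proof. by rewrite /lpi /lrepr !locked_withE; exact: reprK. Qed.
Lemma lpi_eq (x y : V) : lpi x = lpi y <-> I (x - y).
Proof.
rewrite /lpi locked_withE; split=> [/eqP|h]; first by rewrite -Quotient.idealrBE.
by apply/eqP; rewrite -Quotient.idealrBE.
Qed.
Lemma lpiD : {morph lpi : x y / x + y}.
Proof. by move=> x y; rewrite /lpi locked_withE raddfD. Qed.

Definition quot_scale (k : K) (x : lquot) : lquot := lpi (k *: lrepr x).

Lemma lpi_scale k x : quot_scale k (lpi x) = lpi (k *: x).
Proof.
by apply/lpi_eq; rewrite -scalerBr; apply: rpredZ; apply/lpi_eq; rewrite lreprK.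
Qed.

Lemma quot_scalerA a b v : quot_scale a (quot_scale b v) = quot_scale (a * b) v.
Proof. by rewrite -[v]lreprK !lpi_scale scalerA. Qed.
Lemma quot_scale1r : left_id 1 quot_scale.
Proof. by move=> v; rewrite -[v]lreprK !lpi_scale scale1r. Qed.
Lemma quot_scalerDr : right_distributive quot_scale +%R.
Proof.
by move=> a u v; rewrite -[u]lreprK -[v]lreprK -lpiD !lpi_scale -lpiD scalerDr.
Qed.
Lemma quot_scalerDl v : {morph quot_scale^~ v : a b / a + b}.
Proof. by move=> a b; rewrite -[v]lreprK !lpi_scale -lpiD scalerDl. Qed.

HB.instance Definition _ := GRing.Zmodule_isLmodule.Build K lquot
  quot_scalerA quot_scale1r quot_scalerDr quot_scalerDl.

Lemma lpiZ k x : lpi (k *: x) = k *: lpi x.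
Proof. by rewrite -lpi_scale. Qed.

End QuotLmodule.

Record ideal2 (K : fieldType) (A : pzAlgType K) := Ideal2 {
  ideal2_sub :> submodule A;
  ideal2Ml : forall a x : A, ideal2_sub x -> ideal2_sub (a * x);
  ideal2Mr : forall a x : A, ideal2_sub x -> ideal2_sub (x * a)
}.

Section QuotAlgebra.
Variables (K : fieldType) (A : pzAlgType K) (I : ideal2 A).

Definition aquot : Type := lquot I.
HB.instance Definition _ := GRing.Lmodule.on aquot.

Definition api : A -> aquot := @lpi K A I.
Definition arepr : aquot -> A := @lrepr K A I.

Lemma areprK : cancel arepr api.
Proof. exact: lreprK. Qed.
Lemma api_eq (x y : A) : api x = api y <-> I (x - y).
Proof. exact: lpi_eq. Qed.
Lemma apiD : {morph api : x y / x + y}.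
Proof. exact: lpiD. Qed.
Lemma apiZ k x : api (k *: x) = k *: api x.
Proof. exact: lpiZ. Qed.

Definition quot_one : aquot := api 1.
Definition quot_mul (x y : aquot) : aquot := api (arepr x * arepr y).

Lemma api_quot_mul x y : quot_mul (api x) (api y) = api (x * y).
Proof.
have h z : I (arepr (api z) - z) by apply/api_eq; rewrite areprK.
apply/api_eq; set x' := arepr _; set y' := arepr _.
have -> : x' * y' - x * y = (x' - x) * y' + x * (y' - y).
  by rewrite mulrBl mulrBr addrA subrK.
exact: (rpredD (ideal2Mr _ (h x)) (ideal2Ml _ (h y))).
Qed.

Lemma quot_mulA : associative quot_mul.
Proof.
by move=> x y z; rewrite -[x]areprK -[y]areprK -[z]areprK !api_quot_mul mulrA.
Qed.
Lemma quot_mul1r : left_id quot_one quot_mul.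
Proof. by move=> x; rewrite -[x]areprK api_quot_mul mul1r. Qed.
Lemma quot_mulr1 : right_id quot_one quot_mul.
Proof. by move=> x; rewrite -[x]areprK api_quot_mul mulr1. Qed.
Lemma quot_mulDl : left_distributive quot_mul +%R.
Proof.
move=> x y z; rewrite -[x]areprK -[y]areprK -[z]areprK -apiD !api_quot_mul.
by rewrite -apiD mulrDl.
Qed.
Lemma quot_mulDr : right_distributive quot_mul +%R.
Proof.
move=> x y z; rewrite -[x]areprK -[y]areprK -[z]areprK -apiD !api_quot_mul.
by rewrite -apiD mulrDr.
Qed.

HB.instance Definition _ := GRing.Zmodule_isPzRing.Build aquot
  quot_mulA quot_mul1r quot_mulr1 quot_mulDl quot_mulDr.

Lemma apiM x y : api (x * y) = api x * api y.
Proof. by rewrite -api_quot_mul. Qed.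
Lemma api1 : api 1 = 1. Proof. by []. Qed.

Lemma quot_scalerAl (k : K) (x y : aquot) : k *: (x * y) = (k *: x) * y.
Proof.
by rewrite -[x]areprK -[y]areprK -apiM -!apiZ -apiM pz_scalerAl.
Qed.
Lemma quot_scalerAr (k : K) (x y : aquot) : k *: (x * y) = x * (k *: y).
Proof.
by rewrite -[x]areprK -[y]areprK -apiM -!apiZ -apiM pz_scalerAr.
Qed.
HB.instance Definition _ := PzRing_isPzAlgebra.Build K aquot quot_scalerAl quot_scalerAr.

Lemma api0 : api 0 = 0.
Proof. by rewrite -(scale0r (0 : A)) apiZ scale0r. Qed.
Lemma apiN x : api (- x) = - api x.
Proof. by rewrite -scaleN1r apiZ scaleN1r. Qed.

Lemma api_morphism : alg_morphism (api).
Proof.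
split; first by move=> k x y; rewrite apiD /= apiZ.
by split=> // x y; rewrite apiM.
Qed.

End QuotAlgebra.

Section Generated.
Variables (K : fieldType).

Definition span_gen (V : lmodType K) (S : V -> Prop) : pred V := fun v =>
  `[< forall I : submodule V, (forall u, S u -> I u) -> I v >].

Definition ideal_gen (A : pzAlgType K) (S : A -> Prop) : pred A := fun x =>
  `[< forall I : ideal2 A, (forall u, S u -> I u) -> I x >].

Definition subalg_gen (A : pzAlgType K) (S : A -> Prop) : pred A := fun x =>
  `[< forall P : {pred A},
        [/\ 1 \in P, GRing.linear_closed P & GRing.mulr_2closed P] ->
        (forall u, S u -> u \in P) -> x \in P >].

Lemma span_gen_closed V S : GRing.submod_closed (@span_gen V S).
Proof.
split; first by apply/asboolP=> I _; apply: rpred0.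
move=> k u v /asboolP hu /asboolP hv; apply/asboolP=> I hI.
by apply: rpredD; [apply: rpredZ; apply: hu | apply: hv].
Qed.

Lemma ideal_gen_closed A S : GRing.submod_closed (@ideal_gen A S).
Proof.
split; first by apply/asboolP=> I _; apply: rpred0.
move=> k u v /asboolP hu /asboolP hv; apply/asboolP=> I hI.
by apply: rpredD; [apply: rpredZ; apply: hu | apply: hv].
Qed.

Definition span V S : submodule V := Submodule (@span_gen_closed V S).

Lemma ideal_gen_Ml A S a x : @ideal_gen A S x -> @ideal_gen A S (a * x).
Proof. by move=> /asboolP h; apply/asboolP=> I hI; apply/ideal2Ml/h. Qed.
Lemma ideal_gen_Mr A S a x : @ideal_gen A S x -> @ideal_gen A S (x * a).
Proof. by move=> /asboolP h; apply/asboolP=> I hI; apply/ideal2Mr/h. Qed.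

Definition ideal A S : ideal2 A :=
  @Ideal2 K A (Submodule (@ideal_gen_closed A S))
    (@ideal_gen_Ml A S) (@ideal_gen_Mr A S).

Lemma span_genW (V : lmodType K) (S : V -> Prop) u : S u -> span S u.
Proof. by move=> Su; apply/asboolP=> I; apply. Qed.
Lemma ideal_genW (A : pzAlgType K) (S : A -> Prop) u : S u -> ideal S u.
Proof. by move=> Su; apply/asboolP=> I; apply. Qed.
Lemma subalg_genW (A : pzAlgType K) (S : A -> Prop) u : S u -> u \in subalg_gen S.
Proof. by move=> Su; apply/asboolP=> P _; apply. Qed.

Lemma subalg_gen_linear A S : GRing.linear_closed (@subalg_gen A S).
Proof.
move=> k u v /asboolP hu /asboolP hv; apply/asboolP=> P cP hP.
by case: (cP) => _ lP _; apply: lP; [apply: hu | apply: hv].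
Qed.
Lemma subalg_gen_subring A S : subring_closed (@subalg_gen A S).
Proof.
split; first by apply/asboolP=> P [].
  by move=> u v hu hv; rewrite addrC -scaleN1r; apply: subalg_gen_linear.
move=> u v /asboolP hu /asboolP hv; apply/asboolP=> P cP hP.
by case: (cP) => _ _ mP; apply: mP; [apply: hu | apply: hv].
Qed.
HB.instance Definition _ (A : pzAlgType K) (S : A -> Prop) :=
  GRing.isSubringClosed.Build A (@subalg_gen A S) (@subalg_gen_subring A S).
Lemma subalg_gen_scaler A S : GRing.scaler_closed (@subalg_gen A S).
Proof.
move=> k u hu; rewrite -[k *: u]addr0; apply: subalg_gen_linear => //.
exact: rpred0.
Qed.
HB.instance Definition _ (A : pzAlgType K) (S : A -> Prop) :=
  GRing.isScaleClosed.Build K A (@subalg_gen A S) (@subalg_gen_scaler A S).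

End Generated.

Section Subalgebra.
Variables (K : fieldType) (A : pzAlgType K) (S : A -> Prop).

Record subalg : Type :=
  SubAlg { subalg_val :> A; subalg_valP : subalg_val \in subalg_gen S }.

HB.instance Definition _ := [isSub for subalg_val].
HB.instance Definition _ := [Choice of subalg by <:].
HB.instance Definition _ := [SubChoice_isSubZmodule of subalg by <:].
HB.instance Definition _ :=
  GRing.SubZmodule_isSubPzRing.Build _ _ subalg (subringClosedP _).
HB.instance Definition _ := [SubZmodule_isSubLmodule of subalg by <:].

Lemma subalg_scalerAl (k : K) (x y : subalg) : k *: (x * y) = (k *: x) * y.
Proof. by apply: val_inj; rewrite /= pz_scalerAl. Qed.
Lemma subalg_scalerAr (k : K) (x y : subalg) : k *: (x * y) = x * (k *: y).
Proof. by apply: val_inj; rewrite /= pz_scalerAr. Qed.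
HB.instance Definition _ :=
  PzRing_isPzAlgebra.Build K subalg subalg_scalerAl subalg_scalerAr.

End Subalgebra.

Section FreeModule.
Variables (K : fieldType) (X : choiceType) (W : lmodType K) (h : X -> W).
Implicit Types g : {malg K[X]}.

Definition malg_lin g : W := \sum_(x <- msupp g) g@_x *: h x.

Lemma malg_linEw (d : {fset X}) g :
  fsubset (msupp g) d -> malg_lin g = \sum_(x <- d) g@_x *: h x.
Proof.
move=> le; rewrite [LHS](big_fset_incl _ le) //= => x _ /mcoeff_outdom ->.
by rewrite scale0r.
Qed.

Lemma malg_linU x : malg_lin << x >> = h x.
Proof.
by rewrite (malg_linEw (msuppU_le (x := 1))) big_seq_fset1 mcoeffUU scale1r.
Qed.

Lemma malg_lin_linear : linear malg_lin.
Proof.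
move=> k g1 g2; pose d := fsetU (msupp (k *: g1 + g2)) (fsetU (msupp g1) (msupp g2)).
have d0 : fsubset (msupp (k *: g1 + g2)) d by rewrite fsubsetUl.
have d1 : fsubset (msupp g1) d by rewrite /d fsetUCA fsubsetUl.
have d2 : fsubset (msupp g2) d by rewrite /d fsetUA fsubsetUr.
rewrite (malg_linEw d0) (malg_linEw d1) (malg_linEw d2).
rewrite scaler_sumr -big_split /=; apply: eq_bigr => x _.
by rewrite mcoeffD mcoeffZ scalerDl scalerA.
Qed.

Lemma linear_sum (V : lmodType K) (f : V -> W) (I : Type) (r : seq I)
    (c : I -> K) (v : I -> V) : linear f ->
  f (\sum_(i <- r) c i *: v i) = \sum_(i <- r) c i *: f (v i).
Proof.
move=> lf; have f0 : f 0 = 0 by have := lf (-1) 0 0; rewrite !scaleN1r !addNr.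
by elim: r => [|i r IH]; rewrite ?big_nil // !big_cons lf IH.
Qed.

Lemma malg_sumE g : g = \sum_(x <- msupp g) g@_x *: << x >>.
Proof.
rewrite {1}[g]monalgE; apply: eq_bigr => x _; apply/malgP => y.
by rewrite mcoeffZ !mcoeffU mulr_natr.
Qed.

Lemma malg_ext (f1 f2 : {malg K[X]} -> W) : linear f1 -> linear f2 ->
  (forall x, f1 << x >> = f2 << x >>) -> f1 =1 f2.
Proof.
move=> l1 l2 e g; rewrite [g]malg_sumE !linear_sum //.
by apply: eq_bigr => x _; rewrite e.
Qed.

End FreeModule.

Section MonoidAlgebra.
Variables (K : fieldType) (M : monomType).
Implicit Types g : {malg K[M]}.

Lemma malg_scalerAr (k : K) g1 g2 : k *: (g1 * g2) = g1 * (k *: g2).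
Proof.
have cC g : g * k%:MP = k *: g.
  rewrite malgM_def fgmulgU [in RHS](malg_sumE g) scaler_sumr; apply: eq_bigr => x _.
  by rewrite mulm1 scalerA mulrC; apply/malgP => y;
     rewrite mcoeffZ !mcoeffU mulr_natr.
by rewrite -[k *: g2]mul_malgC [RHS]mulrA cC scalerAl.
Qed.

End MonoidAlgebra.

Section FreeAlgebra.
Variables (K : fieldType) (X : choiceType).

Definition free_type : Type := {malg K[{fmonom X}]}.
HB.instance Definition _ := Choice.on free_type.

(** The operations are those of [{malg K[{fmonom X}]}], sealed. *)
Definition free_zero : free_type := locked_with alg_key (0 : {malg K[{fmonom X}]}).
Definition free_opp : free_type -> free_type :=
  locked_with alg_key (-%R : {malg K[{fmonom X}]} -> _).
Definition free_add : free_type -> free_type -> free_type :=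
  locked_with alg_key (+%R : {malg K[{fmonom X}]} -> _).
Definition free_scale : K -> free_type -> free_type :=
  locked_with alg_key (fun k (g : {malg K[{fmonom X}]}) => k *: g).
Definition free_one : free_type := locked_with alg_key (1 : {malg K[{fmonom X}]}).
Definition free_mul : free_type -> free_type -> free_type :=
  locked_with alg_key ( *%R : {malg K[{fmonom X}]} -> _).

Local Ltac unseal := rewrite /free_zero /free_opp /free_add /free_scale
  /free_one /free_mul ?locked_withE.

Lemma free_addA : associative free_add.
Proof. by unseal; exact: addrA. Qed.
Lemma free_addC : commutative free_add.
Proof. by unseal; exact: addrC. Qed.
Lemma free_add0r : left_id free_zero free_add.
Proof. by unseal; exact: add0r. Qed.
Lemma free_addNr : left_inverse free_zero free_opp free_add.
Proof. by unseal; exact: addNr. Qed.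
HB.instance Definition _ := GRing.isZmodule.Build free_type
  free_addA free_addC free_add0r free_addNr.

Lemma free_scalerA a b v : free_scale a (free_scale b v) = free_scale (a * b) v.
Proof. by unseal; exact: scalerA. Qed.
Lemma free_scale1r : left_id 1 free_scale.
Proof. by unseal; exact: scale1r. Qed.
Lemma free_scalerDr : right_distributive free_scale +%R.
Proof.
by move=> k u v; rewrite /Algebra.add /=; unseal; exact: scalerDr.
Qed.
Lemma free_scalerDl v : {morph free_scale^~ v : a b / a + b}.
Proof.
by move=> a b /=; rewrite [RHS]/Algebra.add /=; unseal; exact: scalerDl.
Qed.
HB.instance Definition _ := GRing.Zmodule_isLmodule.Build K free_type
  free_scalerA free_scale1r free_scalerDr free_scalerDl.

Lemma free_addE (u v : free_type) : u + v = ((u : {malg K[{fmonom X}]}) + v).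
Proof. by rewrite [LHS]/Algebra.add /=; unseal. Qed.
Lemma free_scaleE k (u : free_type) : k *: u = (k *: (u : {malg K[{fmonom X}]})).
Proof. by rewrite [LHS]/GRing.scale /=; unseal. Qed.

Lemma free_mulA : associative free_mul.
Proof. by unseal; exact: mulrA. Qed.
Lemma free_mul1r : left_id free_one free_mul.
Proof. by unseal; exact: mul1r. Qed.
Lemma free_mulr1 : right_id free_one free_mul.
Proof. by unseal; exact: mulr1. Qed.
Lemma free_mulDl : left_distributive free_mul +%R.
Proof. by move=> x y z; rewrite !free_addE; unseal; exact: mulrDl. Qed.
Lemma free_mulDr : right_distributive free_mul +%R.
Proof. by move=> x y z; rewrite !free_addE; unseal; exact: mulrDr. Qed.
Lemma free_mulZl (k : K) g1 g2 : k *: free_mul g1 g2 = free_mul (k *: g1) g2.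
Proof. by rewrite !free_scaleE; unseal; exact: scalerAl. Qed.
Lemma free_mulZr (k : K) g1 g2 : k *: free_mul g1 g2 = free_mul g1 (k *: g2).
Proof. by rewrite !free_scaleE; unseal; exact: malg_scalerAr. Qed.

HB.instance Definition _ := isPzAlgebra.Build K free_type
  free_mulA free_mul1r free_mulr1 free_mulDl free_mulDr free_mulZl free_mulZr.
HB.instance Definition _ := GRing.Zmodule_isPzRing.Build free_type
  free_mulA free_mul1r free_mulr1 free_mulDl free_mulDr.

Definition free_alg : pzAlgType K := free_type.

Definition free_monom : {fmonom X} -> free_alg :=
  locked_with alg_key (fun w => << w >>).
Definition free_gen (x : X) : free_alg := free_monom (fmu x).

Lemma free_monom1 : free_monom mone = 1.
Proof. by rewrite /free_monom [RHS]/GRing.one /=; unseal. Qed.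
Lemma free_monomM u v : free_monom (mmul u v) = free_monom u * free_monom v.
Proof.
rewrite /free_monom [RHS]/GRing.mul /=; unseal.
by rewrite [RHS]malgM_def fgmulUU mulr1.
Qed.

Lemma free_ext (W : lmodType K) (f1 f2 : free_alg -> W) : linear f1 -> linear f2 ->
  (forall w, f1 (free_monom w) = f2 (free_monom w)) -> f1 =1 f2.
Proof.
move=> l1 l2 e; apply: (@malg_ext K {fmonom X} W f1 f2).
- by move=> k u v; rewrite -free_scaleE -free_addE l1.
- by move=> k u v; rewrite -free_scaleE -free_addE l2.
- by move=> w; have := e w; rewrite /free_monom locked_withE.
Qed.

Variables (A : pzAlgType K) (f : X -> A).

Definition free_lift : free_alg -> A := locked_with alg_key
  (malg_lin (fun w : {fmonom X} => \prod_(x <- (w : seq X)) f x)).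

Lemma free_lift_monom (w : {fmonom X}) :
  free_lift (free_monom w) = \prod_(x <- (w : seq X)) f x.
Proof. by rewrite /free_lift /free_monom !locked_withE malg_linU. Qed.

Lemma free_liftE x : free_lift (free_gen x) = f x.
Proof. by rewrite free_lift_monom fmU big_seq1. Qed.

Lemma free_lift_lin : linear free_lift.
Proof.
move=> k u v; rewrite free_scaleE free_addE /free_lift locked_withE.
exact: malg_lin_linear.
Qed.
Lemma free_lift1 : free_lift 1 = 1.
Proof. by rewrite -free_monom1 free_lift_monom fm1 big_nil. Qed.
Lemma free_liftM : {morph free_lift : a b / a * b}.
Proof.
have lmul (a : free_alg) : linear (fun g : free_alg => free_lift (g * a)).
  by move=> k u v; rewrite mulrDl -pz_scalerAl free_lift_lin.
have lmur (a : free_alg) : linear (fun g : free_alg => free_lift (a * g)).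
  by move=> k u v; rewrite mulrDr -pz_scalerAr free_lift_lin.
have llmu b : linear (fun g : free_alg => free_lift g * b).
  by move=> k u v; rewrite free_lift_lin mulrDl -pz_scalerAl.
have llmr b : linear (fun g : free_alg => b * free_lift g).
  by move=> k u v; rewrite free_lift_lin mulrDr -pz_scalerAr.
move=> g1 g2; apply: (free_ext (lmul g2) (llmu (free_lift g2))) => x.
apply: (free_ext (lmur _) (llmr _)) => y.
by rewrite -free_monomM !free_lift_monom fmM big_cat.
Qed.
Lemma free_lift0 : free_lift 0 = 0.
Proof. by have := free_lift_lin (-1) 0 0; rewrite !scaleN1r !addNr. Qed.
Lemma free_liftZ k w : free_lift (k *: w) = k *: free_lift w.
Proof. by rewrite -[k *: w]addr0 free_lift_lin free_lift0 addr0. Qed.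
Lemma free_liftN w : free_lift (- w) = - free_lift w.
Proof. by rewrite -scaleN1r free_liftZ scaleN1r. Qed.
Lemma free_liftD : {morph free_lift : a b / a + b}.
Proof. by move=> a b; have := free_lift_lin 1 a b; rewrite !scale1r. Qed.

Lemma free_lift_morphism : alg_morphism free_lift.
Proof.
split; first exact: free_lift_lin.
by split; [exact: free_lift1 | exact: free_liftM].
Qed.
End FreeAlgebra.

Section Presented.
Variables (K : fieldType) (X : choiceType).
Variable R : free_alg K X -> free_alg K X -> Prop.

Definition relators (w : free_alg K X) : Prop :=
  exists u v, R u v /\ w = u - v.

Definition presented : Type := aquot (ideal relators).
HB.instance Definition _ := PzAlgebra.on presented.
HB.instance Definition _ := GRing.PzRing.on presented.

Definition pres_gen (x : X) : presented := api _ (free_gen K x).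

Lemma api_rel u v : R u v -> api (ideal relators) u = api _ v.
Proof. by move=> Ruv; apply/api_eq/ideal_genW; exists u, v. Qed.

Variables (A : pzAlgType K) (f : X -> A).

Definition pres_lift (a : presented) : A := free_lift f (arepr a).

Hypothesis fR : forall u v, R u v -> free_lift f u = free_lift f v.

Definition lift_ker : pred (free_alg K X) := fun w => free_lift f w == 0.

Lemma lift_ker_closed : GRing.submod_closed lift_ker.
Proof.
split; first by rewrite unfold_in free_lift0.
move=> k u v; rewrite !unfold_in => /eqP hu /eqP hv.
by rewrite free_lift_lin hu hv scaler0 addr0.
Qed.
Lemma lift_kerMl a w : lift_ker w -> lift_ker (a * w).
Proof. by rewrite /lift_ker free_liftM => /eqP ->; rewrite mulr0. Qed.
Lemma lift_kerMr a w : lift_ker w -> lift_ker (w * a).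
Proof. by rewrite /lift_ker free_liftM => /eqP ->; rewrite mul0r. Qed.

Lemma pres_liftE u : pres_lift (api _ u) = free_lift f u.
Proof.
have /api_eq/asboolP h : api (ideal relators) (arepr (api (ideal relators) u))
  = api _ u by rewrite areprK.
have hk w : relators w -> lift_ker w.
  case=> [a [b [Rab ->]]]; apply/eqP.
  by rewrite addrC -scaleN1r free_lift_lin (fR Rab) scaleN1r addNr.
have := h (@Ideal2 K _ (Submodule lift_ker_closed) lift_kerMl lift_kerMr) hk.
move/eqP; rewrite addrC -scaleN1r free_lift_lin scaleN1r addrC => /eqP.
by rewrite subr_eq0 => /eqP.
Qed.

Lemma pres_lift_gen x : pres_lift (pres_gen x) = f x.
Proof. by rewrite pres_liftE free_liftE. Qed.

Lemma pres_lift_morphism : alg_morphism pres_lift.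
Proof.
split; last split.
- move=> k a b; rewrite -[a]areprK -[b]areprK -apiZ -apiD !pres_liftE.
  exact: free_lift_lin.
- by rewrite -api1 pres_liftE free_lift1.
- move=> a b; rewrite -[a]areprK -[b]areprK -apiM !pres_liftE.
  exact: free_liftM.
Qed.

End Presented.

Section Tensor.
Variables (K : fieldType) (A B : pzAlgType K).
Local Notation F := {malg K[(A * B)%type]}.

Inductive tensor_relator : F -> Prop :=
| TensDl a a' b :
    tensor_relator (<< (a + a', b) >> - (<< (a, b) >> + << (a', b) >>))
| TensDr a b b' :
    tensor_relator (<< (a, b + b') >> - (<< (a, b) >> + << (a, b') >>))
| TensZl k a b : tensor_relator (<< (k *: a, b) >> - k *: << (a, b) >>)
| TensZr k a b : tensor_relator (<< (a, k *: b) >> - k *: << (a, b) >>).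

Definition tensor : Type := lquot (span tensor_relator).
HB.instance Definition _ := GRing.Lmodule.on tensor.

Definition tens : A -> B -> tensor :=
  locked_with alg_key (fun a b => lpi _ << (a, b) >>).

Lemma tensE a b : tens a b = lpi _ << (a, b) >>.
Proof. by rewrite /tens locked_withE. Qed.

Lemma tensDl a a' b : tens (a + a') b = tens a b + tens a' b.
Proof. by rewrite !tensE -lpiD; apply/lpi_eq/span_genW; exact: TensDl. Qed.
Lemma tensDr a b b' : tens a (b + b') = tens a b + tens a b'.
Proof. by rewrite !tensE -lpiD; apply/lpi_eq/span_genW; exact: TensDr. Qed.
Lemma tensZl k a b : tens (k *: a) b = k *: tens a b.
Proof. by rewrite !tensE -lpiZ; apply/lpi_eq/span_genW; exact: TensZl. Qed.
Lemma tensZr k a b : tens a (k *: b) = k *: tens a b.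
Proof. by rewrite !tensE -lpiZ; apply/lpi_eq/span_genW; exact: TensZr. Qed.

Lemma tens_sumE (x : tensor) :
  x = \sum_(p <- msupp (lrepr x)) (lrepr x)@_p *: tens p.1 p.2.
Proof.
have lin : linear (@lpi K F (span tensor_relator)).
  by move=> k u v; rewrite lpiD lpiZ.
rewrite -{1}[x]lreprK; move: (lrepr x) => g.
rewrite [in LHS](malg_sumE g) (linear_sum _ _ _ lin).
by apply: eq_bigr => -[a b] _; rewrite tensE.
Qed.

Lemma tens_ext (W : lmodType K) (f g : tensor -> W) : linear f -> linear g ->
  (forall a b, f (tens a b) = g (tens a b)) -> f =1 g.
Proof.
move=> lf lg e x; rewrite [x]tens_sumE !linear_sum //.
by apply: eq_bigr => p _; rewrite e.
Qed.

Section Lift.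
Variables (W : lmodType K) (h : A -> B -> W).

Definition tens_lift : tensor -> W := locked_with alg_key
  (fun x => malg_lin (fun p : A * B => h p.1 p.2) (lrepr x)).

Hypothesis hl : forall b, linear (h^~ b).
Hypothesis hr : forall a, linear (h a).

Local Notation L := (malg_lin (fun p : (A * B)%type => h p.1 p.2)).

Lemma tens_liftE_aux u : tens_lift (lpi _ u) = L u.
Proof.
rewrite /tens_lift locked_withE.
have Ll := malg_lin_linear (fun p : A * B => h p.1 p.2).
have LD u1 u2 : L (u1 + u2) = L u1 + L u2.
  by have := Ll 1 u1 u2; rewrite !scale1r.
have L0 : L 0 = 0 by have := Ll (-1) 0 0; rewrite !scaleN1r !addNr.
have LZ k u1 : L (k *: u1) = k *: L u1 by rewrite -[k *: u1]addr0 Ll L0 addr0.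
have LB u1 u2 : L (u1 - u2) = L u1 - L u2 by rewrite LD -[- u2]scaleN1r LZ scaleN1r.
have kc : GRing.submod_closed (fun u1 : F => L u1 == 0).
  split; first by rewrite unfold_in L0.
  move=> k u1 u2; rewrite !unfold_in => /eqP h1 /eqP h2.
  by rewrite Ll h1 h2 scaler0 addr0.
have h0l b : h 0 b = 0 by have := hl b (-1) 0 0; rewrite !scaleN1r !addNr.
have h0r a : h a 0 = 0 by have := hr a (-1) 0 0; rewrite !scaleN1r !addNr.
have /lpi_eq/asboolP hh : lpi (span tensor_relator)
    (lrepr (lpi (span tensor_relator) u)) = lpi _ u by rewrite lreprK.
have hk w : tensor_relator w -> Submodule kc w.
  case=> [a a' b|a b b'|k a b|k a b]; apply/eqP;
    rewrite LB ?LD ?LZ !malg_linU /=.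
  - by have := hl b 1 a a'; rewrite !scale1r => ->; rewrite subrr.
  - by have := hr a 1 b b'; rewrite !scale1r => ->; rewrite subrr.
  - by have := hl b k a 0; rewrite !addr0 h0l addr0 => ->; rewrite subrr.
  - by have := hr a k b 0; rewrite !addr0 h0r addr0 => ->; rewrite subrr.
have := hh (Submodule kc) hk.
by move/eqP; rewrite LB => /eqP; rewrite subr_eq0 => /eqP.
Qed.

Lemma tens_liftE a b : tens_lift (tens a b) = h a b.
Proof. by rewrite tensE tens_liftE_aux malg_linU. Qed.

Lemma tens_lift_linear : linear tens_lift.
Proof.
move=> k x y; rewrite -[x]lreprK -[y]lreprK -lpiZ -lpiD !tens_liftE_aux.
exact: malg_lin_linear.
Qed.
End Lift.

Lemma tens_linl b : linear (tens^~ b).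
Proof. by move=> k x y; rewrite tensDl tensZl. Qed.
Lemma tens_linr a : linear (tens a).
Proof. by move=> k x y; rewrite tensDr tensZr. Qed.

Definition tens_mull (a : A) (b : B) : tensor -> tensor :=
  tens_lift (fun c d => tens (a * c) (b * d)).

Definition tens_mul : tensor -> tensor -> tensor :=
  fun x y => tens_lift (fun a b => tens_mull a b y) x.

Lemma tens_mull_linear a b : linear (tens_mull a b).
Proof.
apply: tens_lift_linear => [d|c] k u v.
  by rewrite mulrDr -pz_scalerAr tens_linl.
by rewrite mulrDr -pz_scalerAr tens_linr.
Qed.
Lemma tens_mullE a b c d : tens_mull a b (tens c d) = tens (a * c) (b * d).
Proof.
apply: tens_liftE => [d'|c'] k u v.
  by rewrite mulrDr -pz_scalerAr tens_linl.
by rewrite mulrDr -pz_scalerAr tens_linr.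
Qed.

Lemma linear_comb (V W : lmodType K) k (f g : V -> W) :
  linear f -> linear g -> linear (fun x => k *: f x + g x).
Proof.
move=> lf lg l u v; rewrite lf lg !scalerDr !scalerA [k * l]mulrC.
by rewrite addrACA.
Qed.

Lemma tens_mull_bil y : (forall b, linear (fun a => tens_mull a b y)) /\
  (forall a, linear (fun b => tens_mull a b y)).
Proof.
split=> [b k a a'|a k b b'].
  apply: (tens_ext (tens_mull_linear _ _)
    (linear_comb k (tens_mull_linear a b) (tens_mull_linear a' b))) => c d.
  by rewrite !tens_mullE mulrDl -pz_scalerAl tens_linl.
apply: (tens_ext (tens_mull_linear _ _)
  (linear_comb k (tens_mull_linear a b) (tens_mull_linear a b'))) => c d.
by rewrite !tens_mullE mulrDl -pz_scalerAl tens_linr.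
Qed.

Lemma tens_mul_linl y : linear (tens_mul^~ y).
Proof. by case: (tens_mull_bil y) => h1 h2; apply: tens_lift_linear. Qed.
Lemma tens_mulEl a b y : tens_mul (tens a b) y = tens_mull a b y.
Proof.
case: (tens_mull_bil y) => h1 h2.
exact: (@tens_liftE _ (fun a b => tens_mull a b y)).
Qed.
Lemma tens_mulE a b c d :
  tens_mul (tens a b) (tens c d) = tens (a * c) (b * d).
Proof. by rewrite tens_mulEl tens_mullE. Qed.
Lemma tens_mul_linr x : linear (tens_mul x).
Proof.
move=> k y z; apply: (tens_ext (tens_mul_linl _)
  (linear_comb k (tens_mul_linl y) (tens_mul_linl z))) => a b.
by rewrite !tens_mulEl tens_mull_linear.
Qed.

Lemma comp_linear (U V W : lmodType K) (g : V -> W) (f : U -> V) :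
  linear g -> linear f -> linear (fun x => g (f x)).
Proof. by move=> lg lf k u v; rewrite lf lg. Qed.

Lemma tens_mulA : associative tens_mul.
Proof.
move=> x y z; apply: (tens_ext (tens_mul_linl _)
  (comp_linear (tens_mul_linl z) (tens_mul_linl y))) => a b.
apply: (tens_ext (comp_linear (tens_mul_linr _) (tens_mul_linl z))
  (comp_linear (tens_mul_linl z) (tens_mul_linr _))) => c d.
apply: (tens_ext (comp_linear (tens_mul_linr _) (tens_mul_linr _))
  (tens_mul_linr _)) => e f.
by rewrite !tens_mulE !mulrA.
Qed.
Lemma id_linear (V : lmodType K) : linear (fun x : V => x).
Proof. by []. Qed.
Lemma tens_mul1r : left_id (tens 1 1) tens_mul.
Proof.
apply: (tens_ext (tens_mul_linr _) (@id_linear _)) => a b.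
by rewrite tens_mulE !mul1r.
Qed.
Lemma tens_mulr1 : right_id (tens 1 1) tens_mul.
Proof.
apply: (tens_ext (tens_mul_linl _) (@id_linear _)) => a b.
by rewrite tens_mulE !mulr1.
Qed.
Lemma tens_mulDl : left_distributive tens_mul +%R.
Proof. by move=> x y z; have := tens_mul_linl z 1 x y; rewrite !scale1r. Qed.
Lemma tens_mulDr : right_distributive tens_mul +%R.
Proof. by move=> x y z; have := tens_mul_linr x 1 y z; rewrite !scale1r. Qed.
Lemma tens_mulZl k x y : k *: tens_mul x y = tens_mul (k *: x) y.
Proof.
have t0 : tens_mul 0 y = 0.
  by have := tens_mul_linl y (-1) 0 0; rewrite !scaleN1r !addNr.
by have := tens_mul_linl y k x 0; rewrite !addr0 t0 addr0.
Qed.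
Lemma tens_mulZr k x y : k *: tens_mul x y = tens_mul x (k *: y).
Proof.
have t0 : tens_mul x 0 = 0.
  by have := tens_mul_linr x (-1) 0 0; rewrite !scaleN1r !addNr.
by have := tens_mul_linr x k y 0; rewrite !addr0 t0 addr0.
Qed.

HB.instance Definition _ := GRing.Zmodule_isPzRing.Build tensor
  tens_mulA tens_mul1r tens_mulr1 tens_mulDl tens_mulDr.
HB.instance Definition _ := PzRing_isPzAlgebra.Build K tensor
  tens_mulZl tens_mulZr.

End Tensor.

Definition sym_square (K : fieldType) (A : pzAlgType K) : pzAlgType K :=
  subalg (fun w : tensor A A => exists a : A, w = tens a a).

Record trace_form (K : fieldType) (A : pzAlgType K) := TraceForm {
  trace_fun :> A -> K;
  trace_linear : scalar trace_fun;
  trace_cyclic : forall a b, trace_fun (a * b) = trace_fun (b * a)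
}.

Section TraceForm.
Variables (K : fieldType) (A : pzAlgType K).

Lemma zero_trace_linear : scalar (fun _ : A => 0 : K).
Proof. by move=> k u v /=; rewrite mulr0 addr0. Qed.

Definition zero_trace : trace_form A :=
  TraceForm zero_trace_linear (fun _ _ => erefl).

Variable tr : trace_form A.

Definition radical_pred : pred A := fun a => `[< forall b, tr (a * b) = 0 >].

Lemma radical_closed : GRing.submod_closed radical_pred.
Proof.
have t0 : tr 0 = 0.
  by have := trace_linear tr (-1) 0 0; rewrite scaleN1r mulN1r !addNr.
split; first by apply/asboolP => b; rewrite mul0r t0.
move=> k u v /asboolP hu /asboolP hv; apply/asboolP => b.
by rewrite mulrDl -pz_scalerAl trace_linear hu hv mulr0 addr0.
Qed.
Lemma radicalMl a x : radical_pred x -> radical_pred (a * x).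
Proof.
by move=> /asboolP h; apply/asboolP => b; rewrite -mulrA trace_cyclic -mulrA h.
Qed.
Lemma radicalMr a x : radical_pred x -> radical_pred (x * a).
Proof. by move=> /asboolP h; apply/asboolP => b; rewrite -mulrA h. Qed.

Definition radical : ideal2 A :=
  @Ideal2 K A (Submodule radical_closed) radicalMl radicalMr.

End TraceForm.

(** Used for "the unique trace such that P"; [x0] is a junk value returned only
    when no element satisfies [P]. *)
Definition the_or (T : Type) (x0 : T) (P : T -> Prop) : T :=
  if pselect (exists x, P x) is left ex then projT1 (cid ex) else x0.

(** The generators of [TL q m] are indexed from [0]: [TL_e i] is
    the usual [e_(i+1)], for [i < m - 1]. *)

Section TemperleyLieb.
Variables (K : fieldType) (q : K).

Inductive TL_rel (A : pzAlgType K) (n : nat) (e : 'I_n -> A) : A -> A -> Prop :=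
| TL_rel_eee (i j : 'I_n) of j = i.+1 :> nat \/ i = j.+1 :> nat :
    TL_rel e (e i * e j * e i) (((q + q^-1) ^+ 2)^-1 *: e i)
| TL_rel_comm (i j : 'I_n) of (i.+1 < j)%N \/ (j.+1 < i)%N :
    TL_rel e (e i * e j) (e j * e i)
| TL_rel_idem (i : 'I_n) : TL_rel e (e i ^+ 2) (e i).

Definition TL (m : nat) : pzAlgType K :=
  presented (TL_rel (@free_gen K 'I_m.-1)).

Definition TL_e (m : nat) (i : 'I_m.-1) : TL m := pres_gen _ i.

Definition TL_incl (m : nat) : TL m -> TL m.+1 :=
  pres_lift (fun i : 'I_m.-1 => @TL_e m.+1 (widen_ord (leq_pred m) i)).

Lemma TL_relP (m : nat) (u v : TL m) : TL_rel (@TL_e m) u v -> u = v.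
Proof.
case=> [i j h|i j h|i].
- by have := api_rel (TL_rel_eee (@free_gen K _) h); rewrite apiZ !apiM.
- by have := api_rel (TL_rel_comm (@free_gen K _) h); rewrite !apiM.
- by have := api_rel (TL_rel_idem (@free_gen K _) i); rewrite !expr2 apiM.
Qed.

Lemma TL_incl_rel (m : nat) (u v : free_alg K 'I_m.-1) :
  TL_rel (@free_gen K _) u v ->
  let f := fun i : 'I_m.-1 => @TL_e m.+1 (widen_ord (leq_pred m) i) in
  free_lift f u = free_lift f v.
Proof.
move=> uv f; case: uv => [i j h|i j h|i];
  rewrite ?expr2 ?free_liftZ !free_liftM !free_liftE /f; apply: TL_relP.
- exact: TL_rel_eee.
- exact: TL_rel_comm.
- by rewrite -expr2; exact: TL_rel_idem.
Qed.

Lemma TL_incl_morphism (m : nat) : alg_morphism (@TL_incl m).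
Proof. by apply: pres_lift_morphism; exact: TL_incl_rel. Qed.

Lemma TL_incl_e (m : nat) (i : 'I_m.-1) :
  TL_incl (TL_e i) = @TL_e m.+1 (widen_ord (leq_pred m) i).
Proof. by apply: pres_lift_gen; exact: TL_incl_rel. Qed.

(** A functional on the inductive limit of the [TL m] is a family of functionals
    compatible with the natural maps [TL_incl], which need not be assumed
    injective. *)
Record TL_markov (tr : forall m, trace_form (TL m)) : Prop := {
  TL_tr_incl : forall m (a : TL m), tr m.+1 (TL_incl a) = tr m a;
  TL_tr1 : forall m, tr m 1 = 1;
  TL_tr_markov : forall m (a : TL m.+1),
    tr m.+2 (TL_incl a * @TL_e m.+2 ord_max)
      = ((q + q^-1) ^+ 2)^-1 * tr m.+1 a
}.

Definition TL_trace : forall m, trace_form (TL m) :=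
  the_or (fun m => zero_trace (TL m)) TL_markov.

Definition TL_bar (m : nat) : pzAlgType K := aquot (radical (TL_trace m)).

End TemperleyLieb.

(** Again [BMW_G i] is the usual [G_(i+1)]; its inverse [BMW_Gi i] is a second
    generator. *)

Section BMW.
Variables (K : fieldType) (r q : K).

(** The [E] with [(q - q^-1)(1 - E) = g - g^-1], where [gi] is [g^-1]. *)
Definition BMW_Eof (A : pzAlgType K) (g gi : A) : A :=
  1 - (q - q^-1)^-1 *: (g - gi).

Inductive BMW_rel (A : pzAlgType K) (n : nat) (G Gi : 'I_n -> A) :
    A -> A -> Prop :=
| BMW_rel_GGi (i : 'I_n) : BMW_rel G Gi (G i * Gi i) 1
| BMW_rel_GiG (i : 'I_n) : BMW_rel G Gi (Gi i * G i) 1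
| BMW_rel_braid (i j : 'I_n) of j = i.+1 :> nat :
    BMW_rel G Gi (G i * G j * G i) (G j * G i * G j)
| BMW_rel_comm (i j : 'I_n) of (i.+1 < j)%N \/ (j.+1 < i)%N :
    BMW_rel G Gi (G i * G j) (G j * G i)
| BMW_rel_cubic (i : 'I_n) :
    BMW_rel G Gi ((G i - r^-1 *: (1 : A)) * (G i - q *: (1 : A))
                     * (G i + q^-1 *: (1 : A))) 0
| BMW_rel_EGE (i j : 'I_n) of i = j.+1 :> nat :
    BMW_rel G Gi (BMW_Eof (G i) (Gi i) * G j * BMW_Eof (G i) (Gi i))
      (r *: BMW_Eof (G i) (Gi i))
| BMW_rel_EGiE (i j : 'I_n) of i = j.+1 :> nat :
    BMW_rel G Gi (BMW_Eof (G i) (Gi i) * Gi j * BMW_Eof (G i) (Gi i))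
      (r^-1 *: BMW_Eof (G i) (Gi i)).

Definition BMW (m : nat) : pzAlgType K :=
  presented (BMW_rel
    (fun i => @free_gen K ('I_m.-1 + 'I_m.-1)%type (inl i))
    (fun i => @free_gen K ('I_m.-1 + 'I_m.-1)%type (inr i))).

Definition BMW_G (m : nat) (i : 'I_m.-1) : BMW m := pres_gen _ (inl i).
Definition BMW_Gi (m : nat) (i : 'I_m.-1) : BMW m := pres_gen _ (inr i).
Definition BMW_E (m : nat) (i : 'I_m.-1) : BMW m :=
  BMW_Eof (BMW_G i) (BMW_Gi i).

Definition BMW_incl_gen (m : nat) (s : ('I_m.-1 + 'I_m.-1)%type) : BMW m.+1 :=
  match s with
  | inl i => @BMW_G m.+1 (widen_ord (leq_pred m) i)
  | inr i => @BMW_Gi m.+1 (widen_ord (leq_pred m) i)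
  end.

Definition BMW_incl (m : nat) : BMW m -> BMW m.+1 :=
  pres_lift (@BMW_incl_gen m).

Lemma BMW_relP (m : nat) (u v : BMW m) :
  BMW_rel (@BMW_G m) (@BMW_Gi m) u v -> u = v.
Proof.
pose G (i : 'I_m.-1) := @free_gen K ('I_m.-1 + 'I_m.-1)%type (inl i).
pose Gi (i : 'I_m.-1) := @free_gen K ('I_m.-1 + 'I_m.-1)%type (inr i).
have apiE I i :
    api I (BMW_Eof (G i) (Gi i)) = BMW_Eof (api I (G i)) (api I (Gi i)).
  by rewrite /BMW_Eof !(apiD, apiN, apiZ, api1).
case=> [i|i|i j h|i j h|i|i j h|i j h].
- by have := api_rel (BMW_rel_GGi G Gi i); rewrite apiM.
- by have := api_rel (BMW_rel_GiG G Gi i); rewrite apiM.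
- by have := api_rel (BMW_rel_braid G Gi h); rewrite !apiM.
- by have := api_rel (BMW_rel_comm G Gi h); rewrite !apiM.
- have := api_rel (BMW_rel_cubic G Gi i).
  by rewrite !(apiM, apiD, apiN, apiZ, api1, api0).
- by have := api_rel (BMW_rel_EGE G Gi h); rewrite apiZ !apiM !apiE.
- by have := api_rel (BMW_rel_EGiE G Gi h); rewrite apiZ !apiM !apiE.
Qed.

Lemma BMW_incl_rel (m : nat) (u v : free_alg K ('I_m.-1 + 'I_m.-1)%type) :
  BMW_rel (fun i => @free_gen K ('I_m.-1 + 'I_m.-1)%type (inl i))
    (fun i => @free_gen K ('I_m.-1 + 'I_m.-1)%type (inr i)) u v ->
  free_lift (@BMW_incl_gen m) u = free_lift (@BMW_incl_gen m) v.
Proof.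
set f := @BMW_incl_gen m.
have fE x y :
    free_lift f (BMW_Eof x y) = BMW_Eof (free_lift f x) (free_lift f y).
  by rewrite /BMW_Eof !(free_liftD, free_liftN, free_liftZ, free_lift1).
case=> [i|i|i j h|i j h|i|i j h|i j h];
  rewrite ?free_liftZ !free_liftM ?fE ?free_lift1 ?free_lift0;
  rewrite ?(free_liftD, free_liftN, free_liftZ, free_lift1) !free_liftE;
  apply: BMW_relP.
- exact: BMW_rel_GGi.
- exact: BMW_rel_GiG.
- exact: BMW_rel_braid.
- exact: BMW_rel_comm.
- exact: BMW_rel_cubic.
- exact: BMW_rel_EGE.
- exact: BMW_rel_EGiE.
Qed.

Lemma BMW_incl_morphism (m : nat) : alg_morphism (@BMW_incl m).
Proof. by apply: pres_lift_morphism; exact: BMW_incl_rel. Qed.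

Lemma BMW_incl_G (m : nat) (i : 'I_m.-1) :
  BMW_incl (BMW_G i) = @BMW_G m.+1 (widen_ord (leq_pred m) i).
Proof.
by apply: (pres_lift_gen (f := @BMW_incl_gen m)); exact: BMW_incl_rel.
Qed.
Lemma BMW_incl_Gi (m : nat) (i : 'I_m.-1) :
  BMW_incl (BMW_Gi i) = @BMW_Gi m.+1 (widen_ord (leq_pred m) i).
Proof.
by apply: (pres_lift_gen (f := @BMW_incl_gen m)); exact: BMW_incl_rel.
Qed.

Definition BMW_x : K := (r - r^-1) / (q - q^-1) + 1.

Record BMW_markov (Tr : forall m, trace_form (BMW m)) : Prop := {
  BMW_Tr_incl : forall m (a : BMW m), Tr m.+1 (BMW_incl a) = Tr m a;
  BMW_Tr1 : forall m, Tr m 1 = 1;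
  BMW_TrE : forall m (i : 'I_m.-1), Tr m (BMW_E i) = BMW_x^-1;
  BMW_TrG : forall m (i : 'I_m.-1), Tr m (BMW_G i) = r / BMW_x;
  BMW_TrGi : forall m (i : 'I_m.-1), Tr m (BMW_Gi i) = r^-1 / BMW_x;
  BMW_Tr_markovG : forall m (a b : BMW m.+1),
    let chi := @BMW_G m.+2 ord_max in
    Tr m.+2 (BMW_incl a * chi * BMW_incl b) = Tr m.+2 chi * Tr m.+1 (a * b);
  BMW_Tr_markovE : forall m (a b : BMW m.+1),
    let chi := @BMW_E m.+2 ord_max in
    Tr m.+2 (BMW_incl a * chi * BMW_incl b) = Tr m.+2 chi * Tr m.+1 (a * b)
}.

Definition BMW_trace : forall m, trace_form (BMW m) :=
  the_or (fun m => zero_trace (BMW m)) BMW_markov.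

Definition BMW_bar (m : nat) : pzAlgType K := aquot (radical (BMW_trace m)).

End BMW.

(* Main.v *)
From HB Require Import structures.
Require Import Defs.
From mathcomp Require Import finmap monalg ring.
Import GRing.Theory.
Local Open Scope ring_scope.
Local Open Scope complex_scope.

Set Implicit Arguments.
Unset Strict Implicit.
Unset Printing Implicit Defensive.

(** Put [c := (q + q^-1) ^- 2] and write [[x|y]] for [x (x) y + y (x) x] in a tensor square. The
    proof compares the two sides by a homomorphism, computes its kernel with traces, and finds
    its image by induction on the number of strands.

    The homomorphism. The element [g := 1 - (1 + q ^- 2) e] of the Temperley-Lieb algebra
    satisfies the braid relations and has the eigenvalues [1] and [- q ^- 2]. Hence
    [G := q (g (x) g)] satisfies the braid relations and has the eigenvalues [q], [- q^-1] and
    [q ^- 3], the last of which is [r^-1] because [r = q ^+ 3]; the corresponding [E] is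
    [c^-1 (e (x) e)]. All relations of the BMW algebra follow ([tensG_rel]), which gives
    [bmw_rep] from the BMW algebra to the tensor square of the Temperley-Lieb algebra.

    The kernel. The product of two Markov traces of Temperley-Lieb algebras, pulled back along
    [bmw_rep], is a Markov trace of the BMW algebras ([bmw_rep_markov]). Such a trace is unique,
    because every level of the tower is spanned by the sandwiches [a * y * b] of [1], of the last
    [G] and of the last [E] by elements [a], [b] of the level below ([BMW_sandwich]). Suppose
    now that [bmw_rep] reaches all symmetric tensors. Then a symmetric tensor which is orthogonal
    to the image is orthogonal to everything, and so it dies in the tensor square of the quotient
    by the radical of the Markov trace ([tens_nondegenerate], [quot_rep_radical]). This proves the
    isomorphism for the quotient of the Temperley-Lieb algebra by that radical. For generic [q]
    the radical is zero ([TL_tr_nondegenerate]): a multiple of the Jones-Wenzl projection has a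
    non-zero trace unless it vanishes, and the complement of that projection lies in the ideal of
    the last generator, where the trace is that of the level below.

    The image. All brackets [[x|y]] have to be reached ([bmw_rep_image_bracket]). Since the ideal
    of the last generator [d] and the scalars span everything, it suffices to reach
    [[x d z|y d w]] with [x], [y], [z], [w] in the level below ([bracket_of_ideal]). Assume that
    the brackets of that level are reached, and work modulo the image. Products of reached
    brackets show that [[x d z|y d w]] is alternating in [(x, y)] and in [(z, w)]. Elements of the
    next lower level commute with [d], so they move between the left and the right slots; with
    the alternation this makes them act through a commutative quotient. Two neighbouring
    idempotents [s], [t] of a commutative algebra with [s t s = c s], [t s t = c t] and [c != 1]
    vanish, so that level acts by scalars once each of its generators has a neighbour. Then
    everything is a multiple of [[a|d]], where [a] is the generator before [d]
    ([wedge_vanish], [bracket_step]), and [[a|d]] is found in the product of [[a|1]], [[d|1]] and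
    [[a|1]] ([sy_pair]). On four strands the commuting level has a single generator [p], which has
    no neighbour; there [[a|p d]] remains, and [[p|a] [d|1] [p|a]] contains it with the
    coefficient [1 - 2 c] ([bracket_step2]). The conditions [c != 1] and [2 c != 1] hold as
    soon as [q ^+ 2] has no power with exponent between [1] and [4] equal to [1]
    ([quantum_nonvanishing]).

    The Markov trace on the Temperley-Lieb algebras is defined by choice among all families with
    the Markov properties, so it has to be shown that one exists: the quantum trace of the
    representation on tensor powers of a plane is one ([spin_markov]). *)

(** * Linear combinations and presented algebras *)

(** Predicates in [Prop], so that inductions over spans and words may prove existential
    statements. *)
Definition lin_closed (K : fieldType) (V : lmodType K) (P : V -> Prop) : Prop :=
  forall k u v, P u -> P v -> P (k *: u + v).

Section LinClosed.
Variables (K : fieldType) (V : lmodType K) (P : V -> Prop).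
Hypothesis lP : lin_closed P.

Lemma lin_closed0 u : P u -> P 0.
Proof. by move=> Pu; rewrite -(addNr u) -scaleN1r; apply: lP. Qed.
Lemma lin_closedZ k u : P u -> P (k *: u).
Proof. by move=> Pu; rewrite -[k *: u]addr0; apply: lP => //; apply: lin_closed0 Pu. Qed.
Lemma lin_closedD u v : P u -> P v -> P (u + v).
Proof. by move=> Pu Pv; rewrite -[u]scale1r; apply: lP. Qed.

Lemma lin_submod u : P u -> GRing.submod_closed (fun v => `[< P v >]).
Proof.
move=> Pu; split; first by apply/asboolP/(lin_closed0 Pu).
by move=> k v w /asboolP Pv /asboolP Pw; apply/asboolP/lP.
Qed.

Lemma span_ind (S : V -> Prop) : P 0 ->
  (forall u, S u -> P u) -> forall u, span S u -> P u.
Proof.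
move=> P0 SP u /asboolP /(_ (Submodule (lin_submod P0))) h; apply/asboolP; apply: h.
by move=> v /SP Pv; apply/asboolP.
Qed.
End LinClosed.

Section Submod.
Variables (K : fieldType) (V : lmodType K) (I : submodule V).
Lemma submod_lin : lin_closed (fun v => I v).
Proof. by move=> k u v Iu Iv /=; apply: rpredD => //; apply: rpredZ. Qed.
Lemma submodZ k v : I v -> I (k *: v).
Proof. exact: rpredZ. Qed.
Lemma submodD u v : I u -> I v -> I (u + v).
Proof. exact: rpredD. Qed.
Lemma submod0 : I 0.
Proof. by apply: rpred0. Qed.
Lemma lpi0 : lpi I 0 = 0.
Proof. by rewrite -(scale0r (0 : V)) lpiZ scale0r. Qed.
Lemma lpi_eq0 v : lpi I v = 0 <-> I v.
Proof. by rewrite -lpi0 lpi_eq subr0. Qed.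
End Submod.

Section Presented.
Variables (K : fieldType) (X : choiceType).

Lemma free_monom_cons x (s : seq X) :
  free_monom K (FMonom (x :: s)) = free_gen K x * free_monom K (FMonom s).
Proof.
rewrite /free_gen -free_monomM; congr (free_monom _ _).
by apply/eqP; rewrite -val_eqE /= fmM fmU.
Qed.

Variable R : free_alg K X -> free_alg K X -> Prop.

(** The elements of the free algebra whose class satisfies [P] form a submodule; the quotient map
    by this submodule kills all words, hence everything. *)
Lemma pres_ind (P : presented R -> Prop) : lin_closed P -> P 1 ->
  (forall x u, P u -> P (pres_gen R x * u)) -> forall u, P u.
Proof.
move=> lP P1 PM u; rewrite -[u]areprK; move: (arepr u) => w.
pose Q (w : free_alg K X) : Prop := P (api (ideal (relators R)) w).
have lQ : lin_closed Q by move=> k v v'; rewrite /Q apiD apiZ; apply: lP.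
have Q1 : Q 1 by [].
have Qm : forall v : {fmonom X}, Q (free_monom K v).
  case; elim=> [|x s IH]; last by rewrite free_monom_cons /Q apiM; apply: PM.
  suff -> : FMonom [::] = mone :> {fmonom X} by rewrite free_monom1.
  by apply/eqP; rewrite -val_eqE /= fm1.
pose I := Submodule (lin_submod lQ Q1).
have l1 : linear (@lpi K _ I) by move=> k v v'; rewrite lpiD lpiZ.
have l2 : linear (fun _ : free_alg K X => 0 : lquot I).
  by move=> k v v' /=; rewrite scaler0 addr0.
have /lpi_eq0 /asboolP // : lpi I w = 0.
by apply: (free_ext l1 l2) => v; apply/lpi_eq0/asboolP.
Qed.
End Presented.

Section Trace.
Variables (K : fieldType) (A : pzAlgType K) (tr : trace_form A).
Lemma trD a b : tr (a + b) = tr a + tr b.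
Proof. by have := trace_linear tr 1 a b; rewrite scale1r mul1r. Qed.
Lemma trZ k a : tr (k *: a) = k * tr a.
Proof.
have t0 : tr 0 = 0.
  by have := trace_linear tr (-1) 0 0; rewrite scaleN1r mulN1r !addNr.
by have := trace_linear tr k a 0; rewrite t0 !addr0.
Qed.
Lemma tr0 : tr 0 = 0.
Proof. by rewrite -(scale0r 0) trZ mul0r. Qed.
Lemma trN a : tr (- a) = - tr a.
Proof. by rewrite -scaleN1r trZ mulN1r. Qed.
Lemma trB a b : tr (a - b) = tr a - tr b.
Proof. by rewrite trD trN. Qed.
End Trace.

Section Morphism.
Variables (K : fieldType) (A B : pzAlgType K) (f : A -> B).
Hypothesis mf : alg_morphism f.
Lemma amD a b : f (a + b) = f a + f b.
Proof. by have := mf.1 1 a b; rewrite !scale1r. Qed.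
Lemma am0 : f 0 = 0.
Proof. by have := mf.1 (-1) 0 0; rewrite !scaleN1r !addNr. Qed.
Lemma amZ k a : f (k *: a) = k *: f a.
Proof. by have := mf.1 k a 0; rewrite am0 !addr0. Qed.
Lemma amN a : f (- a) = - f a.
Proof. by rewrite -scaleN1r amZ scaleN1r. Qed.
Lemma amB a b : f (a - b) = f a - f b.
Proof. by rewrite amD amN. Qed.
Lemma am1 : f 1 = 1. Proof. by case: mf => _ []. Qed.
Lemma amM a b : f (a * b) = f a * f b. Proof. by case: mf => _ []. Qed.
End Morphism.

(** One step of a tower of algebras generated at each level by new letters, [X1] and [X2]. A letter
    [y] of the upper level commutes with the lowest level, so
    [y * (p * x * r) * y' = p * (y * x * y') * r] for [p], [r] of the lowest level: it is enough to
    know how letters of the upper level absorb one letter [x] of the middle level. *)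
Section Tower.
Variables (K : fieldType) (A0 A1 A2 : pzAlgType K) (i : A0 -> A1) (j : A1 -> A2).
Hypotheses (mj : alg_morphism j).
Variables (X1 : A1 -> Prop) (X2 : A2 -> Prop).

Definition sandwich (B A : pzAlgType K) (f : B -> A) (X : A -> Prop) : A -> Prop :=
  fun w => exists a x b, X x /\ w = f a * x * f b.

Notation S1 := (span (sandwich i X1)).
Notation S2 := (span (sandwich j X2)).

Lemma sandwichM a b w : S2 w -> S2 (j a * w * j b).
Proof.
move=> Sw; apply: (span_ind (P := fun w => S2 (j a * w * j b)) _ _ _ Sw).
- by move=> k u v hu hv; rewrite mulrDr mulrDl -pz_scalerAr -pz_scalerAl; apply: submod_lin.
- by rewrite mulr0 mul0r; apply: submod0.
- move=> _ [a' [x [b' [Xx ->]]]]; apply: span_genW; exists (a * a'), x, (b' * b).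
  by rewrite !(amM mj) !mulrA.
Qed.

Hypothesis S1_full : forall u, S1 u.
Hypothesis X2_comm : forall y a, X2 y -> y * j (i a) = j (i a) * y.
Hypothesis X2_step : forall y x y', X2 y -> X1 x -> X2 y' -> S2 (y * j x * y').

Lemma tower_absorb y w : X2 y -> S2 w -> S2 (y * w).
Proof.
move=> Xy Sw; apply: (span_ind (P := fun w => S2 (y * w)) _ _ _ Sw).
- by move=> k u v hu hv; rewrite mulrDr -pz_scalerAr; apply: submod_lin.
- by rewrite mulr0; apply: submod0.
move=> _ [a [y' [b [Xy' ->]]]].
apply: (span_ind (P := fun a => S2 (y * (j a * y' * j b))) _ _ _ (S1_full a)).
- move=> k u v hu hv.
  rewrite (amD mj) (amZ mj) !mulrDl mulrDr -!pz_scalerAl -pz_scalerAr.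
  exact: submod_lin.
- by rewrite (am0 mj) !mul0r mulr0; apply: submod0.
move=> _ [p [x [r [Xx ->]]]].
have -> : y * (j (i p * x * i r) * y' * j b)
        = j (i p) * (y * j x * y') * j (i r * b).
  by rewrite !(amM mj) !mulrA -[_ * y' * j (i r)]mulrA (X2_comm r Xy') (X2_comm p Xy) !mulrA.
by apply: sandwichM; apply: X2_step.
Qed.
End Tower.

(** Equality of linear combinations of given vectors, reduced to equality of coefficients. *)
Section LinearCombination.
Variables (K : fieldType) (V : lmodType K).

Inductive lexp :=
  | Lat of nat
  | Ladd of lexp & lexp
  | Lopp of lexp
  | Lscale of K & lexp
  | Lzero.

Fixpoint lval (xs : seq V) (e : lexp) : V :=
  match e with
  | Lat i => nth 0 xs i
  | Ladd a b => lval xs a + lval xs b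
  | Lopp a => - lval xs a
  | Lscale k a => k *: lval xs a
  | Lzero => 0
  end.

Fixpoint lcoef (e : lexp) (i : nat) : K :=
  match e with
  | Lat j => if eqn i j then 1 else 0
  | Ladd a b => lcoef a i + lcoef b i
  | Lopp a => - lcoef a i
  | Lscale k a => k * lcoef a i
  | Lzero => 0
  end.

Fixpoint coef_eqs (n : nat) (e1 e2 : lexp) : Prop :=
  if n is n'.+1 then lcoef e1 n' = lcoef e2 n' /\ coef_eqs n' e1 e2 else True.

Lemma lval_coef xs e : lval xs e = \sum_(i < size xs) lcoef e i *: nth 0 xs i.
Proof.
elim: e => /= [j|a -> b ->|a ->|k a ->|].
- transitivity (\sum_(i < size xs) (if nat_of_ord i == j then 1 else 0 : K) *: nth 0 xs i) => //.
  have [lt|ge] := ltnP j (size xs).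
    rewrite (bigD1 (Ordinal lt)) //= eqxx scale1r big1 ?addr0 // => i.
    by rewrite -val_eqE /= => /negPf ->; rewrite scale0r.
  rewrite nth_default // big1 // => i _; rewrite (ltn_eqF (leq_trans (ltn_ord i) ge)).
  by rewrite scale0r.
- by rewrite -big_split; apply: eq_bigr => i _; rewrite scalerDl.
- by rewrite -sumrN; apply: eq_bigr => i _; rewrite scaleNr.
- by rewrite scaler_sumr; apply: eq_bigr => i _; rewrite scalerA.
- by rewrite big1 // => i _; rewrite scale0r.
Qed.

Lemma lexp_eq xs e1 e2 : coef_eqs (size xs) e1 e2 -> lval xs e1 = lval xs e2.
Proof.
move=> h; rewrite !lval_coef; apply: eq_bigr => -[i lt] _ /=; congr (_ *: _).
move: lt h; elim: (size xs) => //= n IH; rewrite ltnS leq_eqVlt.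
by move=> /orP[/eqP -> []|lt []] // _ /(IH lt).
Qed.
End LinearCombination.

(* The same element may be written with different paths of instances. *)
Ltac same_atom x y :=
  first
  [ constr_eq x y
  | lazymatch x with
    | GRing.one _ => lazymatch y with GRing.one _ => idtac end
    | ?a * ?b => lazymatch y with ?a' * ?b' => same_atom a a'; same_atom b b' end
    | tens ?a ?b => lazymatch y with tens ?a' ?b' => same_atom a a'; same_atom b b' end
    end ].
Ltac atom_index x xs :=
  lazymatch xs with
  | ?y :: ?tl =>
      match goal with
      | _ => let found := match goal with _ => same_atom x y end in constr:(O)
      | _ => let n := atom_index x tl in constr:(S n)
      end
  end.
Ltac reify_lexp K xs t :=
  lazymatch t with
  | ?a + ?b => let u := reify_lexp K xs a in let v := reify_lexp K xs b in
      constr:(@Ladd K u v)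
  | - ?a => let u := reify_lexp K xs a in constr:(@Lopp K u)
  | ?k *: ?a => let u := reify_lexp K xs a in constr:(@Lscale K k u)
  | @GRing.zero _ => constr:(@Lzero K)
  | _ => let n := atom_index t xs in constr:(@Lat K n)
  end.
(** [coefficients K xs] turns an equality of combinations of the vectors [xs] with
    coefficients in [K] into the equalities of the coefficients. *)
Ltac coefficients K xs :=
  lazymatch goal with |- ?l = ?m =>
    let u := reify_lexp K xs l in let v := reify_lexp K xs m in
    apply: (@lexp_eq K _ xs u v); rewrite [size _]/=; cbn [coef_eqs lcoef eqn]; repeat split
  end.

Section Expansion.
Variables (K : fieldType) (A : pzAlgType K).
Implicit Types (k : K) (a b : A).
Lemma scale_mull k a b : (k *: a) * b = k *: (a * b).
Proof. by rewrite pz_scalerAl. Qed.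
Lemma scale_mulr k a b : a * (k *: b) = k *: (a * b).
Proof. by rewrite pz_scalerAr. Qed.
Definition expandE := (@mulrDl A, @mulrDr A, @mulNr A, @mulrN A, @mul1r A, @mulr1 A,
  scale_mull, scale_mulr, @mulrA A).
End Expansion.

(** * The tower of Temperley-Lieb algebras *)

Section TLTower.
Variables (K : fieldType) (q : K).

Local Notation c := (((q + q^-1) ^+ 2)^-1).
Local Notation inc := (@TL_incl K q _).
Local Notation minc := (TL_incl_morphism q _).

Definition TL_last m : TL q m.+2 := @TL_e K q m.+2 ord_max.

Lemma TL_gen_case m (i : 'I_(m.+2).-1) :
  TL_e q i = TL_last m \/ exists j : 'I_(m.+1).-1, TL_e q i = inc (TL_e q j).
Proof.
have [im|im] := eqVneq i ord_max; first by left; rewrite im.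
have lt : (i < m)%N.
  by have := ltn_ord i; rewrite ltnS leq_eqVlt => /orP[/eqP e|//];
     case/eqP: im; apply/val_inj.
right; exists (Ordinal lt); rewrite TL_incl_e; congr (TL_e q _).
exact/val_inj.
Qed.

Lemma TL_ind m (P : TL q m -> Prop) : lin_closed P -> P 1 ->
  (forall i u, P u -> P (TL_e q i * u)) -> forall u, P u.
Proof. exact: pres_ind. Qed.

Lemma TL_last_ind m (P : TL q m.+2 -> Prop) : lin_closed P -> P 1 ->
  (forall j u, P u -> P (inc (TL_e q j) * u)) ->
  (forall u, P u -> P (TL_last m * u)) -> forall u, P u.
Proof.
move=> lP P1 Pj Pl; apply: TL_ind => // i u Pu.
by have [->|[j ->]] := TL_gen_case i; auto.
Qed.

Lemma TL_small m (x : TL q m) : (m <= 1)%N -> exists k : K, x = k *: (1 : TL q m).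
Proof.
move=> m1; apply: (TL_ind (P := fun x => exists k : K, x = k *: (1 : TL q m))).
- by move=> k u v [a ->] [b ->]; exists (k * a + b); rewrite scalerDl scalerA.
- by exists 1; rewrite scale1r.
- by case: m m1 x => [|[|]] // _ _ [].
Qed.

Lemma TL_idem m (i : 'I_m.-1) : TL_e q i * TL_e q i = TL_e q i.
Proof. by rewrite -expr2; apply: TL_relP; apply: TL_rel_idem. Qed.

Lemma TL_last_idem m : TL_last m * TL_last m = TL_last m.
Proof. exact: TL_idem. Qed.

Lemma TL_last_comm m (a : TL q m) :
  TL_last m * inc (inc a) = inc (inc a) * TL_last m.
Proof.
apply: (TL_ind (P := fun a => TL_last m * inc (inc a) = inc (inc a) * TL_last m)).
- move=> k u v hu hv; rewrite !(amD minc, amZ minc) mulrDl mulrDr.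
  by rewrite -pz_scalerAl -pz_scalerAr hu hv.
- by rewrite !(am1 minc) mul1r mulr1.
move=> i u hu; rewrite !(amM minc) -mulrA -hu !mulrA; congr (_ * _).
rewrite !TL_incl_e; apply: TL_relP; apply: TL_rel_comm; right => /=.
by case: i => i /=; case: m {a u hu} => //= m; rewrite ltnS.
Qed.

Lemma TL_last_eee m : TL_last m.+1 * inc (TL_last m) * TL_last m.+1 = c *: TL_last m.+1.
Proof. by rewrite TL_incl_e; apply: TL_relP; apply: TL_rel_eee; right. Qed.

Lemma TL_last_eee' m : inc (TL_last m) * TL_last m.+1 * inc (TL_last m) = c *: inc (TL_last m).
Proof. by rewrite TL_incl_e; apply: TL_relP; apply: TL_rel_eee; left. Qed.

(** The only word of [tower_absorb] with a relation between two generators is [e e' e = c e]. *)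
Lemma TL_sandwich m (x : TL q m.+2) :
  span (sandwich (@TL_incl K q m.+1) (fun y => y = 1 \/ y = TL_last m)) x.
Proof.
elim: m x => [|m IH] x; set X := fun y => _; set S := span _.
  have S1 : S 1.
    by apply: span_genW; exists 1, 1, 1; rewrite (am1 minc) !mulr1; split=> //; left.
  apply: (TL_last_ind (P := fun v => S v)); [exact: submod_lin|exact: S1|by case|].
  move=> u Su; apply: (tower_absorb (i := @TL_incl K q 0) (X1 := fun y => y = 1)
    (X2 := X) minc _ _ _ _ Su); last by right.
  - move=> v; have [k ->] := TL_small v isT; apply: (rpredZ k).
    by apply: span_genW; exists 1, 1, 1; rewrite (am1 minc) !mulr1.
  - by move=> y a [->|->]; [rewrite mul1r mulr1|exact: TL_last_comm].
  - move=> y z y' Xy -> Xy'; rewrite (am1 minc) mulr1.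
    suff Xyy : X (y * y').
      by apply: span_genW; exists 1, (y * y'), 1; rewrite (am1 minc) mul1r mulr1.
    case: Xy Xy' => [->|->] [->|->]; rewrite ?mul1r ?mulr1; first by left.
    + by right.
    + by right.
    + by right; rewrite TL_last_idem.
have SX a y b : X y -> S (inc a * y * inc b).
  by move=> Xy; apply: span_genW; exists a, y, b.
have X1 : X 1 by left.
have Xd : X (TL_last m.+1) by right.
apply: (TL_last_ind (P := fun v => S v)); first exact: submod_lin.
- by have := SX 1 1 1 X1; rewrite (am1 minc) !mulr1.
- move=> j u Su; have := sandwichM minc (TL_e q j) 1 Su.
  by rewrite (am1 minc) mulr1.
move=> u Su; apply: (tower_absorb minc (X2 := X) IH _ _ _ Su) => //.
- by move=> y a [->|->]; [rewrite mul1r mulr1|exact: TL_last_comm].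
move=> y z y' [->|->] [->|->] [->|->]; rewrite ?(am1 minc) ?mul1r ?mulr1.
- by have := SX 1 _ 1 X1; rewrite (am1 minc) mul1r mulr1.
- by have := SX 1 _ 1 Xd; rewrite (am1 minc) mul1r mulr1.
- by have := SX (TL_last m) _ 1 X1; rewrite (am1 minc) !mulr1.
- by have := SX (TL_last m) _ 1 Xd; rewrite (am1 minc) !mulr1.
- by have := SX 1 _ 1 Xd; rewrite (am1 minc) mul1r mulr1.
- by rewrite TL_last_idem; have := SX 1 _ 1 Xd; rewrite (am1 minc) mul1r mulr1.
- by have := SX 1 _ (TL_last m) Xd; rewrite (am1 minc) !mul1r.
- rewrite TL_last_eee; apply: (rpredZ c).
  by have := SX 1 _ 1 Xd; rewrite (am1 minc) mul1r mulr1.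
Qed.

Lemma TL_split m (P : TL q m.+2 -> Prop) : lin_closed P ->
  (forall a, P (inc a)) -> (forall a b, P (inc a * TL_last m * inc b)) ->
  forall x, P x.
Proof.
move=> lP Pa Pab x; apply: (span_ind lP (lin_closed0 lP (Pa 1)) _ (TL_sandwich x)) => //.
move=> _ [a [y [b [[->|->] ->]]]]; last exact: Pab.
by rewrite mulr1 -(amM minc).
Qed.

(** The [y] found here is the conditional expectation of [x]. *)
Lemma TL_compress m (x : TL q m.+1) : exists y : TL q m,
  TL_last m * inc x * TL_last m = inc (inc y) * TL_last m.
Proof.
case: m x => [|m] x.
  have [k ->] := TL_small x isT; exists (k *: (1 : TL q 0)).
  by rewrite !(amZ minc, am1 minc) -pz_scalerAr -!pz_scalerAl mulr1 mul1r TL_last_idem.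
apply: (TL_split (P := fun x => exists y, _ * inc x * _ = inc (inc y) * _)).
- move=> k u v [y hy] [y' hy']; exists (k *: y + y').
  rewrite !(amD minc, amZ minc) mulrDr -pz_scalerAr !mulrDl -!pz_scalerAl.
  by rewrite hy hy'.
- by move=> a; exists a; rewrite TL_last_comm -mulrA TL_last_idem.
- move=> a b; exists (c *: (a * b)).
  rewrite !(amM minc, amZ minc) !mulrA (TL_last_comm a).
  rewrite -[_ * inc (inc b) * _]mulrA -(TL_last_comm b) mulrA.
  rewrite -[_ * TL_last m.+1 * inc (TL_last m)]mulrA.
  rewrite -[_ * (_ * inc (TL_last m)) * TL_last m.+1]mulrA TL_last_eee.
  by rewrite -pz_scalerAr -!pz_scalerAl -!mulrA (TL_last_comm b).
Qed.

(** The right half of a sandwich is absorbed by the last generator through [TL_compress]. *)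
Lemma TL_left_ideal m (x : TL q m.+2) : exists y : TL q m.+1,
  x * TL_last m = inc y * TL_last m.
Proof.
apply: (TL_split (P := fun x => exists y, x * TL_last m = inc y * TL_last m)).
- move=> k u v [y hy] [y' hy']; exists (k *: y + y').
  by rewrite !(amD minc, amZ minc) !mulrDl -!pz_scalerAl hy hy'.
- by move=> a; exists a.
- move=> a b; have [y hy] := TL_compress b; exists (a * inc y).
  by rewrite -!mulrA [TL_last m * _]mulrA hy (amM minc) mulrA.
Qed.

(** This span is the two-sided ideal generated by the last generator, by [TL_left_ideal]. *)
Definition TL_ideal m : submodule (TL q m.+2) :=
  span (sandwich (@TL_incl K q m.+1) (fun y => y = TL_last m)).

Lemma TL_idealM m x u : TL_ideal m u -> TL_ideal m (x * u).
Proof.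
move=> Iu; apply: (span_ind (P := fun u => TL_ideal m (x * u)) _ _ _ Iu).
- by move=> k v w hv hw; rewrite mulrDr -pz_scalerAr; apply: submod_lin.
- by rewrite mulr0; apply: submod0.
move=> _ [a [_ [b [-> ->]]]]; have [w hw] := TL_left_ideal (x * inc a).
by rewrite !mulrA hw; apply: span_genW; exists w, (TL_last m), b.
Qed.

Lemma TL_ideal_incl m u : c != 0 -> TL_ideal m u -> TL_ideal m.+1 (inc u).
Proof.
move=> c0 Iu; apply: (span_ind (P := fun u => TL_ideal m.+1 (inc u)) _ _ _ Iu).
- by move=> k v w hv hw; rewrite minc.1; apply: submod_lin.
- by rewrite (am0 minc); apply: submod0.
move=> _ [a [_ [b [-> ->]]]].
have -> : TL_last m = c^-1 *: (c *: TL_last m) by rewrite scalerA mulVf ?scale1r.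
rewrite !(amM minc) (amZ minc c^-1) (amZ minc c) -TL_last_eee'.
rewrite -pz_scalerAr -pz_scalerAl; apply: submodZ.
apply: span_genW; exists (inc a * TL_last m), (TL_last m.+1), (TL_last m * inc b).
by rewrite !(amM minc) !mulrA.
Qed.

(** Each generator is a multiple of its product with its two copies around the next one. *)
Lemma TL_ideal_e m i : c != 0 -> TL_ideal m (TL_e q i).
Proof.
move=> c0; have Il n : TL_ideal n (TL_last n).
  by apply: span_genW; exists 1, (TL_last n), 1; rewrite !(am1 minc) mulr1 mul1r.
elim: m i => [|m IH] i; have [->|[j ->]] := TL_gen_case i; try exact: Il.
- by case: j.
- by apply: TL_ideal_incl.
Qed.

End TLTower.

(** * Existence of the Markov trace: the spin chain *)

Section TLLift.
Variables (K : fieldType) (q : K) (A : pzAlgType K) (n : nat) (f : 'I_n -> A).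
Hypothesis fP : forall u v, TL_rel q f u v -> u = v.
Lemma TL_lift_rel u v : TL_rel q (@free_gen K 'I_n) u v -> free_lift f u = free_lift f v.
Proof.
case=> [i j h|i j h|i]; rewrite ?expr2 ?free_liftZ !free_liftM !free_liftE; apply: fP.
- exact: TL_rel_eee.
- exact: TL_rel_comm.
- by rewrite -expr2; exact: TL_rel_idem.
Qed.
End TLLift.

HB.instance Definition _ (K : fieldType) n := PzRing_isPzAlgebra.Build K 'M[K]_n
  (fun k a b => @scalemxAl K n n n k a b) (fun k a b => @scalemxAr K n n n k a b).

Section Spin.
Variables (K : fieldType) (q : K).
Hypotheses (q0 : q != 0) (d0 : q + q^-1 != 0).

Let d0' : q * q + 1 != 0.
Proof.
by have := mulf_neq0 q0 d0; rewrite mulrDr mulfV.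
Qed.


Local Notation d := (q + q^-1).

(** The operator [a] acting on a tensor product with an extra plane. The new plane is the outermost
    factor, which makes the inclusion of the algebras of the tower block diagonal. *)
Definition dbl n (a : 'M[K]_n) : 'M[K]_(n + n) := block_mx a 0 0 a.

(** The projection onto the quantum singlet of the two outermost planes. On the two middle vectors
    of the basis of pure tensors its matrix has the rows [(q^-1, 1)] and [(1, q)], divided by [d],
    which has rank one and trace one. *)
Definition singlet n : 'M[K]_((n + n) + (n + n)) :=
  block_mx (block_mx 0 0 0 (q^-1 / d)%:M) (block_mx 0 0 (d^-1)%:M 0)
           (block_mx 0 (d^-1)%:M 0 0) (block_mx (q / d)%:M 0 0 0).

Lemma dblM n (a b : 'M_n) : dbl (a *m b) = dbl a *m dbl b.
Proof. by rewrite mulmx_block !(mulmx0, mul0mx, addr0, add0r). Qed.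

Lemma dbl_lin n k (a b : 'M_n) : dbl (k *: a + b) = k *: dbl a + dbl b.
Proof. by rewrite /dbl scale_block_mx add_block_mx !scaler0 !addr0. Qed.

Lemma dbl1 n : dbl (1%:M : 'M_n) = 1%:M.
Proof. by rewrite scalar_mx_block. Qed.

Let eq_block m1 m2 n1 n2 (A A' : 'M[K]_(m1, n1)) (B B' : 'M_(m1, n2)) (C C' : 'M_(m2, n1))
    (D D' : 'M_(m2, n2)) :
  A = A' -> B = B' -> C = C' -> D = D' -> block_mx A B C D = block_mx A' B' C' D'.
Proof. by move=> -> -> -> ->. Qed.

(* [congr] would compare the scalars up to conversion, which is slow *)
Local Ltac block_field := repeat match goal with
  | |- 0 = 0 => exact: erefl
  | |- block_mx _ _ _ _ = _ => apply: eq_block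
  | |- scalar_mx _ = _ => apply: (congr1 scalar_mx)
  | |- _ *: _ = _ => apply: (congr1 (fun z => z *: _))
  end; field; rewrite q0 d0'.

Lemma singlet_idem n : singlet n *m singlet n = singlet n.
Proof.
rewrite /singlet !(mulmx_block, mulmx0, mul0mx, addr0, add0r, add_block_mx).
rewrite -!scalar_mxM -!raddfD /= .
by block_field.
Qed.

Lemma singlet_dblC n (x : 'M_n) : singlet n *m dbl (dbl x) = dbl (dbl x) *m singlet n.
Proof.
rewrite /singlet /dbl !(mulmx_block, mulmx0, mul0mx, addr0, add0r).
by rewrite !mul_scalar_mx !mul_mx_scalar.
Qed.

Lemma singlet_sandwich n (A B C D : 'M[K]_n)
    (al := q^-1 / d) (be := d^-1) (ep := q / d) :
  singlet n *m dbl (block_mx A B C D) *m singlet n =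
  block_mx (block_mx 0 0 0 (al ^+ 2 *: D + be ^+ 2 *: A))
           (block_mx 0 0 ((al * be) *: D + (be * ep) *: A) 0)
           (block_mx 0 ((be * al) *: D + (ep * be) *: A) 0 0)
           (block_mx (be ^+ 2 *: D + ep ^+ 2 *: A) 0 0 0).
Proof.
rewrite /singlet /dbl -/al -/be -/ep; move: al be ep => al be ep.
rewrite !(mulmx_block, mulmx0, mul0mx, addr0, add0r, block_mx0, add_block_mx).
rewrite !(mul_scalar_mx, mul_mx_scalar, scalerA) !expr2.
by congr block_mx; congr block_mx; congr (_ + _); congr (_ *: _); rewrite mulrC.
Qed.

Lemma dbl_sandwich n (A B C D : 'M[K]_n) (al := q^-1 / d) (be := d^-1) (ep := q / d)
    (x := dbl (block_mx A B C D)) :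
  x *m singlet n *m x =
  block_mx (al *: block_mx (B *m C) (B *m D) (D *m C) (D *m D))
           (be *: block_mx (B *m A) (B *m B) (D *m A) (D *m B))
           (be *: block_mx (A *m C) (A *m D) (C *m C) (C *m D))
           (ep *: block_mx (A *m A) (A *m B) (C *m A) (C *m B)).
Proof.
rewrite /x /singlet /dbl -/al -/be -/ep; move: al be ep => al be ep.
rewrite !(mulmx_block, mulmx0, mul0mx, addr0, add0r) !(mul_mx_scalar, scale_block_mx).
by rewrite -!scalemxAl.
Qed.

Lemma singlet_eee n :
  singlet (n + n) *m dbl (singlet n) *m singlet (n + n) = (d ^+ 2)^-1 *: singlet (n + n).
Proof.
rewrite [singlet n]/singlet singlet_sandwich /singlet.
rewrite !(scale_block_mx, scaler0, scale_scalar_mx, add_block_mx, addr0, add0r).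
rewrite !scalar_mx_block.
by block_field.
Qed.

Lemma singlet_eee' n :
  dbl (singlet n) *m singlet (n + n) *m dbl (singlet n) = (d ^+ 2)^-1 *: dbl (singlet n).
Proof.
rewrite [singlet n]/singlet dbl_sandwich /dbl.
rewrite !(mulmx_block, mulmx0, mul0mx, addr0, add0r) -!scalar_mxM !block_mx0.
rewrite !(scale_block_mx, scaler0, scale_scalar_mx).
by block_field.
Qed.

(** The partial quantum trace over the outermost plane sends the singlet projection to the scalar
    [d^-1]. *)
Lemma singlet_trace n (x : 'M_(n + n)) (k : 'M_n)
    (w := block_mx (q *: k) 0 0 (q^-1 *: k)) :
  \tr (dbl x *m singlet n *m block_mx (q *: w) 0 0 (q^-1 *: w)) = d^-1 * \tr (x *m w).
Proof.
rewrite /w /dbl -[x]submxK; move: (ulsubmx x) (ursubmx x) (dlsubmx x) (drsubmx x) => A B C D.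
rewrite /singlet !(scale_block_mx, mulmx_block, mulmx0, mul0mx, addr0, add0r, scaler0).
rewrite !mxtrace_block !(mul_mx_scalar, mulmx0, addr0, add0r, linear0, mxtraceZ) -!scalemxAr -!scalemxAl !mxtraceZ.
by field; rewrite q0 d0'.
Qed.

Fixpoint spin_dim m : nat := if m is m'.+1 then spin_dim m' + spin_dim m' else 1.
Notation M m := 'M[K]_(spin_dim m).

(** Only the values at [i < m.-1] matter; there the last generator is the singlet projection and
    the others come from the level below. *)
Fixpoint spin_e m (i : nat) : M m :=
  match m return M m with
  | 0 => 0
  | m'.+1 =>
    match m' return M m' -> M m'.+1 with
    | 0 => fun _ => 0
    | m''.+1 => fun x => if i == m'' then singlet (spin_dim m'') else dbl x
    end (spin_e m' i)
  end.

(** The tensor power of the diagonal matrix with the entries [q] and [q^-1]. *)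
Fixpoint spin_weight m : M m :=
  if m is m'.+1 then block_mx (q *: spin_weight m') 0 0 (q^-1 *: spin_weight m') else 1%:M.

Lemma spin_eS m i :
  spin_e m.+2 i = if i == m then singlet (spin_dim m) else dbl (spin_e m.+1 i).
Proof. by []. Qed.

Lemma spin_e_idem m i : spin_e m i *m spin_e m i = spin_e m i.
Proof.
elim: m => [|[|m] IH]; rewrite ?mulmx0 //.
by rewrite spin_eS; case: eqP => _; rewrite ?singlet_idem // -dblM IH.
Qed.

Lemma spin_e_comm m i j : (i.+1 < j)%N -> (j < m.-1)%N ->
  spin_e m i *m spin_e m j = spin_e m j *m spin_e m i.
Proof.
move=> ij; elim: m => [|[|m] IH] // jm; rewrite !spin_eS.
rewrite /= ltnS in jm; rewrite (ltn_eqF (leq_trans (ltnW ij) jm)).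
case: eqVneq => [e|jm']; last first.
  by rewrite -!dblM IH //= ltn_neqAle jm' jm.
case: m jm e {IH} => [|m] jm e; first by rewrite e in ij.
rewrite spin_eS (_ : i == m = false) ?singlet_dblC //.
by apply/eqP => im; rewrite im e ltnn in ij.
Qed.

Lemma spin_e_eee m i : (i.+1 < m.-1)%N ->
  spin_e m i.+1 *m spin_e m i *m spin_e m i.+1 = (d ^+ 2)^-1 *: spin_e m i.+1 /\
  spin_e m i *m spin_e m i.+1 *m spin_e m i = (d ^+ 2)^-1 *: spin_e m i.
Proof.
elim: m => [|[|m] IH] // im; rewrite !spin_eS.
rewrite /= ltnS in im; rewrite (ltn_eqF im).
case: eqVneq => [e|im'].
  case: m e im {IH} => [|m] // [->] _; rewrite spin_eS eqxx.
  by split; [exact: singlet_eee|exact: singlet_eee'].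
have [|h1 h2] := IH _; first by rewrite /= ltn_neqAle im' im.
have Z a : dbl ((d ^+ 2)^-1 *: a) = (d ^+ 2)^-1 *: dbl a :> M m.+2.
  by rewrite -[_ *: a]addr0 dbl_lin /dbl block_mx0 addr0.
by rewrite -!dblM h1 h2 !Z.
Qed.

Lemma spin_weightC m i : spin_weight m *m spin_e m i = spin_e m i *m spin_weight m.
Proof.
elim: m => [|[|m] IH]; rewrite ?mulmx0 ?mul0mx //.
rewrite spin_eS; case: eqP => _.
  rewrite /= /singlet; move: (spin_weight m) => w.
  rewrite !(scale_block_mx, mulmx_block, mulmx0, mul0mx, addr0, add0r, scaler0).
  rewrite !(mul_mx_scalar, mul_scalar_mx, scalerA).
  by block_field.
rewrite [spin_weight _]/= /dbl.
rewrite !(mulmx_block, mulmx0, mul0mx, addr0, add0r).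
by rewrite -!scalemxAl -!scalemxAr -IH.
Qed.

Definition spin m : TL q m -> M m := pres_lift (fun i : 'I_m.-1 => spin_e m i).

Lemma spin_rel m u v : TL_rel q (@free_gen K 'I_m.-1) u v ->
  free_lift (fun i : 'I_m.-1 => spin_e m i) u = free_lift (fun i : 'I_m.-1 => spin_e m i) v.
Proof.
apply: TL_lift_rel => {u v} _ _ [i j h|i j h|i].
- case: h => [e|e].
  + have lt : (i.+1 < m.-1)%N by rewrite -e.
    by have [_] := spin_e_eee lt; rewrite -e.
  + have lt : (j.+1 < m.-1)%N by rewrite -e.
    by have [] := spin_e_eee lt; rewrite -e.
- case: h => h; first by apply: spin_e_comm.
  by symmetry; apply: spin_e_comm.
- exact: spin_e_idem.
Qed.

Lemma spin_morphism m : alg_morphism (@spin m).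
Proof. by apply: pres_lift_morphism; exact: spin_rel. Qed.

Lemma spinE m (i : 'I_m.-1) : spin (TL_e q i) = spin_e m i.
Proof. by apply: pres_lift_gen; exact: spin_rel. Qed.

Lemma spinM m (a b : TL q m) : spin (a * b) = spin a *m spin b.
Proof. exact: (amM (spin_morphism m)). Qed.

Lemma spin_incl m (a : TL q m) : spin (TL_incl a) = dbl (spin a).
Proof.
apply: (TL_ind (P := fun a => spin (TL_incl a) = dbl (spin a))).
- move=> k u v hu hv; rewrite (TL_incl_morphism q m).1 !(spin_morphism _).1 dbl_lin.
  by rewrite hu hv.
- by rewrite (am1 (TL_incl_morphism q m)) !(am1 (spin_morphism _)); symmetry; exact: dbl1.
- move=> i u hu; rewrite (amM (TL_incl_morphism q m)) !spinM hu.
  rewrite TL_incl_e !spinE [RHS]dblM; congr (_ *m _).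
  by case: m i {a u hu} => [|[|m]] [i im] //; rewrite spin_eS (ltn_eqF im).
Qed.

Lemma spin_weight_comm m (a : TL q m) : spin_weight m *m spin a = spin a *m spin_weight m.
Proof.
apply: (TL_ind (P := fun a => spin_weight m *m spin a = spin a *m spin_weight m)).
- move=> k u v hu hv; rewrite (spin_morphism _).1 mulmxDr mulmxDl.
  by rewrite -scalemxAl -scalemxAr hu hv.
- by rewrite (am1 (spin_morphism _)) mulmx1 mul1mx.
- move=> i u hu; rewrite spinM spinE.
  by rewrite mulmxA spin_weightC -!mulmxA hu.
Qed.

Definition spin_tr m (a : TL q m) : K := \tr (spin a *m spin_weight m) / d ^+ m.

Lemma spin_tr_linear m : scalar (@spin_tr m).
Proof.
move=> k u v; rewrite /spin_tr (spin_morphism _).1 mulmxDl mxtraceD -scalemxAl mxtraceZ.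
by rewrite mulrDl mulrA.
Qed.

Lemma spin_tr_cyclic m (a b : TL q m) : spin_tr (a * b) = spin_tr (b * a).
Proof.
rewrite /spin_tr !spinM.
by rewrite -mulmxA -spin_weight_comm mulmxA mxtrace_mulC mulmxA.
Qed.

Definition spin_trace m := TraceForm (@spin_tr_linear m) (@spin_tr_cyclic m).

(** Adding a plane multiplies the trace of the weight by [d], which the normalization removes; in
    the Markov property the normalization and [singlet_trace] contribute one [d^-1] each. *)
Lemma spin_markov : TL_markov spin_trace.
Proof.
have dm0 m : d ^+ m != 0 by rewrite expf_neq0.
split=> [m a|m|m a] /=; rewrite /spin_tr.
- rewrite spin_incl /= /dbl mulmx_block !(mulmx0, mul0mx, addr0, add0r) mxtrace_block.
  rewrite -!scalemxAr !mxtraceZ exprS; move: (dm0 m) (\tr _); move: (d ^+ m) => e e0 t.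
  by field; rewrite e0 q0 d0'.
- rewrite (am1 (spin_morphism _)) -[1]/(1%:M) mul1mx.
  suff -> : \tr (spin_weight m) = d ^+ m by rewrite mulfV.
  elim: m => [|m IH]; first by rewrite mxtrace1.
  by rewrite /= mxtrace_block !mxtraceZ IH exprS mulrDl.
- rewrite spinM spin_incl spinE spin_eS eqxx.
  rewrite /= singlet_trace exprS.
  by rewrite invfM expr2 invfM; ring.
Qed.

End Spin.

(** * Nondegeneracy of the Markov trace for generic parameter *)

Section Markov.
Variables (K : fieldType) (q : K).
Local Notation d := (q + q^-1).
Local Notation c := ((d ^+ 2)^-1).
Local Notation inc := (@TL_incl K q _).
Local Notation minc := (TL_incl_morphism q _).
Variable tr : forall m, trace_form (TL q m).
Hypothesis tr_markov : TL_markov tr.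

Lemma TL_tr_last m (a b : TL q m.+1) :
  tr m.+2 (inc a * TL_last q m * inc b) = c * tr m.+1 (a * b).
Proof.
rewrite trace_cyclic mulrA -(amM minc) (TL_tr_markov tr_markov).
by rewrite trace_cyclic.
Qed.

Lemma TL_tr_e m (i : 'I_m.-1) : tr m (TL_e q i) = c.
Proof.
elim: m i => [|[|m] IH] i; [by case: i|by case: i|].
have [->|[j ->]] := TL_gen_case q i; last by rewrite (TL_tr_incl tr_markov).
have := TL_tr_last (1 : TL q m.+1) 1.
by rewrite !(am1 minc) !mulr1 mul1r (TL_tr1 tr_markov) mulr1.
Qed.

Section Generic.
Hypotheses (q0 : q != 0) (q_generic : forall n, (0 < n)%N -> q ^+ n != 1).

(** The quantum integer [n] times [q - q^-1]. *)
Definition qdiff n : K := q ^+ n - q ^- n.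

Lemma qdiff_neq0 n : (0 < n)%N -> qdiff n != 0.
Proof.
move=> n0; have qn0 : q ^+ n != 0 by rewrite expf_neq0.
rewrite /qdiff subr_eq0; apply/eqP => e.
have nn : (0 < n + n)%N by rewrite addn_gt0 n0.
by have := q_generic nn; rewrite exprD {2}e mulfV // eqxx.
Qed.

Lemma qdiffS n : qdiff n.+2 = d * qdiff n.+1 - qdiff n.
Proof.
have qn0 : q ^+ n != 0 by rewrite expf_neq0.
by rewrite /qdiff !exprS; move: (q ^+ n) qn0 => x x0; field; rewrite x0 q0.
Qed.

Let d0 : d != 0.
Proof.
have := qdiff_neq0 (isT : 0 < 2)%N; rewrite qdiffS /qdiff !expr0 invr1 subrr subr0.
by rewrite mulf_eq0 negb_or => /andP[].
Qed.

Let c0 : c != 0.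
Proof. by rewrite invr_eq0 expf_neq0. Qed.

(** The ratio of quantum integers in the recursion of Wenzl for idempotent generators. *)
Definition jw_coef m : K := d * qdiff m.+1 / qdiff m.+2.

Lemma jw_coef_neq0 m : jw_coef m != 0.
Proof. by rewrite !mulf_neq0 ?invr_eq0 ?qdiff_neq0. Qed.

Lemma jw_coefS m : 1 - jw_coef m * c = (jw_coef m.+1)^-1.
Proof.
rewrite /jw_coef (qdiffS m.+1).
have := qdiff_neq0 (isT : 0 < m.+3)%N; rewrite (qdiffS m.+1).
have := qdiff_neq0 (isT : 0 < m.+2)%N.
move: (qdiff m.+1) (qdiff m.+2) => x y y0 z0.
have -> : (d * y / (d * y - x))^-1 = (d * y - x) / (d * y).
  by rewrite invfM invrK mulrC.
rewrite mulrBl mulfV ?mulf_neq0 //; congr (_ - _).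
by rewrite expr2 !invfM; move: d0 y0; move: d => z w y0; field; rewrite w y0.
Qed.

(** The Jones-Wenzl projection on [m.+1] strands. *)
Fixpoint jw m : TL q m.+1 :=
  if m is m'.+1 return TL q m.+1 then
    inc (jw m') - jw_coef m' *: (inc (jw m') * TL_last q m' * inc (jw m'))
  else 1.

(** All properties are proved in one induction. The compression of the projection by the next
    generator has the partner [x], which is the projection one level lower; it is quantified
    because there is no such level when [m] is zero. *)
Lemma jwP m : [/\ jw m * jw m = jw m,
    forall i, TL_e q i * jw m = 0,
    forall i, jw m * TL_e q i = 0 &
    exists x : TL q m, [/\ inc x * jw m = jw m, jw m * inc x = jw m &
      TL_last q m * inc (jw m) * TL_last q m
        = (jw_coef m)^-1 *: (inc (inc x) * TL_last q m)]].
Proof.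
elim: m => [|m [ff ef fe [x [xf fx efe]]]].
  split; [by rewrite /= mulr1|by case|by case|exists 1].
  rewrite /= !(am1 minc) !mulr1 mul1r TL_last_idem; split => //.
  suff -> : jw_coef 0 = 1 by rewrite invr1 scale1r.
  rewrite /jw_coef; have := qdiff_neq0 (isT : 0 < 2)%N; rewrite (qdiffS 0).
  have -> : qdiff 0 = 0 by rewrite /qdiff !expr0 invr1 subrr.
  by rewrite subr0; apply: mulfV.
set k := jw_coef m; set e := TL_last q m; set f := inc (jw m).
have k0 : k != 0 by apply: jw_coef_neq0.
have -> : jw m.+1 = f - k *: (f * e * f) by [].
set f' := f - _.
have {}ff : f * f = f by rewrite -(amM minc) ff.
have Xf : inc (inc x) * f = f by rewrite -(amM minc) xf.
have fX : f * inc (inc x) = f by rewrite -(amM minc) fx.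
have ff' : f * f' = f' by rewrite {1}/f' mulrBr -pz_scalerAr !mulrA ff.
have f'f : f' * f = f' by rewrite {1}/f' mulrBl -pz_scalerAl -[f * e * f * f]mulrA ff.
have ef' : e * f' = 0.
  rewrite /f' mulrBr -pz_scalerAr !mulrA efe -pz_scalerAl scalerA mulfV // scale1r.
  by rewrite -TL_last_comm -mulrA Xf subrr.
have f'e : f' * e = 0.
  rewrite /f' mulrBl -pz_scalerAl -!mulrA [e * (f * e)]mulrA efe -pz_scalerAr scalerA mulfV //.
  by rewrite scale1r mulrA fX subrr.
have f'f' : f' * f' = f'.
  by rewrite {1}/f' mulrBl ff' -pz_scalerAl -!mulrA ff' ef' mulr0 scaler0 subr0.
split => //.
- move=> i; have [->//|[j ->]] := TL_gen_case q i.
  rewrite /f' mulrBr -pz_scalerAr !mulrA -(amM minc) ef (am0 minc) !mul0r scaler0 subr0 //.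
- move=> i; have [->//|[j ->]] := TL_gen_case q i.
  rewrite /f' mulrBl -pz_scalerAl -!mulrA -(amM minc) fe (am0 minc) !mulr0 scaler0 subr0 //.
exists (jw m); split=> //; rewrite -/f.
rewrite -jw_coefS -/k (amB minc) (amZ minc) !(amM minc) -/e.
have hF : TL_last q m.+1 * inc f = inc f * TL_last q m.+1 by exact: TL_last_comm.
have FF : inc f * inc f = inc f by rewrite -(amM minc) ff.
move: (inc f) hF FF => F hF FF.
have FeF : TL_last q m.+1 * (F * inc e * F) * TL_last q m.+1
    = F * (TL_last q m.+1 * inc e * TL_last q m.+1) * F.
  by rewrite !mulrA -hF -!mulrA hF.
rewrite mulrBr mulrBl -pz_scalerAr -pz_scalerAl FeF TL_last_eee.
rewrite -pz_scalerAr -pz_scalerAl -[F * _ * F]mulrA hF [F * (F * _)]mulrA FF.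
rewrite -[F * _ * TL_last q m.+1]mulrA TL_last_idem.
by rewrite scalerA scalerBl scale1r.
Qed.

Lemma jw_absorb m (x : TL q m.+1) : exists k : K, x * jw m = k *: jw m.
Proof.
have [_ ef _ _] := jwP m.
apply: (TL_ind (P := fun x => exists k : K, x * jw m = k *: jw m)).
- move=> k u v [a hu] [b hv]; exists (k * a + b).
  by rewrite mulrDl -pz_scalerAl hu hv scalerDl scalerA.
- by exists 1; rewrite mul1r scale1r.
- by move=> i u [k hu]; exists 0; rewrite -mulrA hu -pz_scalerAr ef scaler0 scale0r.
Qed.

(** The recursion subtracts from [1] only elements of the ideal of the last generator. *)
Lemma jw_compl m :
  TL_ideal q m (1 - jw m.+1).
Proof.
elim: m => [|m IH].
  have -> : 1 - jw 1 = jw_coef 0 *: TL_last q 0.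
    by rewrite /= (am1 minc) mulr1 mul1r opprB addrC subrK.
  by apply: submodZ; apply: TL_ideal_e.
have -> : 1 - jw m.+2 = inc (1 - jw m.+1)
    + jw_coef m.+1 *: (inc (jw m.+1) * TL_last q m.+1 * inc (jw m.+1)).
  have -> : jw m.+2 = inc (jw m.+1)
    - jw_coef m.+1 *: (inc (jw m.+1) * TL_last q m.+1 * inc (jw m.+1)) by [].
  by rewrite (amB minc 1) (am1 minc) opprB addrCA addrC.
apply: submodD; first exact: TL_ideal_incl.
apply: submodZ; apply: span_genW.
by exists (jw m.+1), (TL_last q m.+1), (jw m.+1).
Qed.

(** Each step of the recursion multiplies the trace by a ratio of quantum integers. *)
Lemma jw_tr_neq0 m : tr m.+1 (jw m) != 0.
Proof.
elim: m => [|m IH]; first by rewrite (TL_tr1 tr_markov) oner_eq0.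
have [ff _ _ _] := jwP m.
rewrite /= trB trZ TL_tr_last (TL_tr_incl tr_markov) ff mulrA -[X in X - _]mul1r -mulrBl.
by rewrite jw_coefS mulf_neq0 // invr_eq0 jw_coef_neq0.
Qed.

(** An element [z] of the radical has [z * jw = k *: jw], and the trace of this is zero only if
    [k] is. Hence [z] is in [z] times the ideal of the last generator [e]; there
    [z * a * e = w * e] with [w] one level lower, and the Markov property puts [w] in the radical
    of that level. *)
Lemma TL_tr_nondegenerate m (z : TL q m) : (forall b, tr m (z * b) = 0) -> z = 0.
Proof.
have small n (y : TL q n) : (n <= 1)%N -> (forall b, tr n (y * b) = 0) -> y = 0.
  move=> n1; have [k -> h] := TL_small y n1.
  by move: (h 1); rewrite mulr1 trZ (TL_tr1 tr_markov) mulr1 => ->; rewrite scale0r.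
case: m z => [|m] z; first exact: small.
elim: m z => [|m IH] z hz; first exact: small.
have zf : z * jw m.+1 = 0.
  have [k e] := jw_absorb z; have := hz (jw m.+1); rewrite e trZ.
  by move/eqP; rewrite mulf_eq0 (negPf (jw_tr_neq0 _)) orbF => /eqP ->; rewrite scale0r.
suff zg : z * (1 - jw m.+1) = 0 by move: zg; rewrite mulrBr mulr1 zf subr0.
apply: (span_ind (P := fun y => z * y = 0) _ _ _ (jw_compl m)).
- by move=> k u v hu hv; rewrite mulrDr -pz_scalerAr hu hv scaler0 addr0.
- by rewrite mulr0.
move=> _ [a [_ [b [-> ->]]]].
have [w hw] := TL_left_ideal (z * inc a).
suff w0 : w = 0 by rewrite !mulrA hw w0 (am0 minc) !mul0r.
apply: IH => b'; have := hz (inc a * TL_last q m * inc b').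
rewrite !mulrA hw TL_tr_last => /eqP; rewrite mulf_eq0 (negPf c0) => /eqP //.
Qed.

End Generic.
End Markov.

(** * The tower of BMW algebras and uniqueness of its Markov trace *)

Section BMWRelations.
Variables (K : fieldType) (r q : K) (A : pzAlgType K).
Hypotheses (r0 : r != 0) (z0 : q - q^-1 != 0) (q0 : q != 0).
Local Notation z := (q - q^-1).
Local Notation E := (BMW_Eof q).

Section OneGenerator.
Variables (g gi : A).
Hypotheses (gK : g * gi = 1) (giK : gi * g = 1).

Lemma BMW_Eof_intertwine w h hi : w * g = h * w -> w * gi = hi * w ->
  w * E g gi = E h hi * w.
Proof.
move=> wg wgi; rewrite /BMW_Eof mulrBr mulrBl mulr1 mul1r -pz_scalerAr -pz_scalerAl.
by rewrite mulrBr mulrBl wg wgi.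
Qed.

(** Up to a scalar, [g * E] is the product of the two factors of the cubic relation that do not belong
    to the eigenvalue [r^-1]; so the cubic relation says that [g] acts on [g * E], and hence on
    [E], by [r^-1]. *)
Lemma BMW_quadratic :
  z *: (g * E g gi) = - ((g - q *: (1 : A)) * (g + q^-1 *: (1 : A))).
Proof.
rewrite /BMW_Eof mulrBr mulr1 -pz_scalerAr mulrBr gK scalerBr scalerA mulfV // scale1r.
rewrite mulrDr !mulrBl -!pz_scalerAr -!pz_scalerAl !mulr1 !mul1r scalerA mulVf // scale1r.
rewrite scalerBl !opprB !opprD.
by rewrite !opprK [- (g * g) + _]addrC [in RHS]addrACA; congr (_ + _); apply: addrC.
Qed.

Lemma BMW_cubic_of_GE : g * E g gi = r^-1 *: E g gi ->
  (g - r^-1 *: (1 : A)) * (g - q *: (1 : A)) * (g + q^-1 *: (1 : A)) = 0.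
Proof.
move=> GE; have h : (g - r^-1 *: (1 : A)) * E g gi = 0.
  by rewrite mulrBl -pz_scalerAl mul1r GE subrr.
rewrite -mulrA -[X in _ * X]opprK -BMW_quadratic GE mulrN -!pz_scalerAr h.
by rewrite !scaler0 oppr0.
Qed.

Hypothesis cubic : (g - r^-1 *: (1 : A)) * (g - q *: (1 : A)) * (g + q^-1 *: (1 : A)) = 0.

Lemma BMW_GEC : g * E g gi = E g gi * g.
Proof. by apply: BMW_Eof_intertwine; rewrite // gK giK. Qed.

Lemma BMW_GE : g * E g gi = r^-1 *: E g gi.
Proof.
have : (g - r^-1 *: (1 : A)) * (g * E g gi) = 0.
  have -> : g * E g gi = z^-1 *: (z *: (g * E g gi)) by rewrite scalerA mulVf ?scale1r.
  by rewrite BMW_quadratic -pz_scalerAr mulrN mulrA cubic oppr0 scaler0.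
rewrite mulrBl -pz_scalerAl mul1r => /eqP; rewrite subr_eq0 => /eqP h.
by rewrite -[LHS]mul1r -giK -mulrA h -pz_scalerAr mulrA giK mul1r.
Qed.

Lemma BMW_EG : E g gi * g = r^-1 *: E g gi.
Proof. by rewrite -BMW_GEC BMW_GE. Qed.

Lemma BMW_GiE : gi * E g gi = r *: E g gi.
Proof.
have e : E g gi = r *: (g * E g gi) by rewrite BMW_GE scalerA mulfV ?scale1r.
by rewrite {1}e -pz_scalerAr mulrA giK mul1r.
Qed.

Lemma BMW_Gi_def : gi = g - z *: (1 : A) + z *: E g gi.
Proof.
by rewrite /BMW_Eof scalerBr scalerA mulfV // scale1r addrA subrK opprB addrC subrK.
Qed.

Lemma BMW_GG : g * g = 1 + z *: g - (z * r^-1) *: E g gi.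
Proof.
rewrite -scalerA -BMW_GE /BMW_Eof mulrBr mulr1 -pz_scalerAr mulrBr gK.
rewrite scalerBr scalerA mulfV // scale1r.
by rewrite opprB addrC [1 + _]addrC addrA !subrK.
Qed.

Lemma BMW_EE : E g gi * E g gi = (1 - z^-1 * (r^-1 - r)) *: E g gi.
Proof.
rewrite {1}/BMW_Eof mulrBl mul1r -pz_scalerAl mulrBl BMW_GE BMW_GiE.
by rewrite -scalerBl scalerA scalerBl scale1r.
Qed.
End OneGenerator.

Variables (a ai b bi : A).
Hypotheses (aK : a * ai = 1) (aiK : ai * a = 1) (bK : b * bi = 1) (biK : bi * b = 1).
Hypothesis cubic_a : (a - r^-1 *: (1 : A)) * (a - q *: (1 : A)) * (a + q^-1 *: (1 : A)) = 0.
Hypothesis cubic_b : (b - r^-1 *: (1 : A)) * (b - q *: (1 : A)) * (b + q^-1 *: (1 : A)) = 0.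
Hypothesis braid : a * b * a = b * a * b.
Local Notation EA := (E a ai).
Local Notation EB := (E b bi).
Hypothesis BaB : EB * a * EB = r *: EB.
Hypothesis BaiB : EB * ai * EB = r^-1 *: EB.

Let intertwine (w g gi h hi : A) : g * gi = 1 -> hi * h = 1 -> w * g = h * w ->
  w * E g gi = E h hi * w.
Proof.
move=> gK hK wg; apply: BMW_Eof_intertwine => //.
by rewrite -[LHS]mul1r -hK -mulrA [h * _]mulrA -wg -[w * g * gi]mulrA gK mulr1.
Qed.

(** [EA] is a combination of [1], [a] and [ai], each of which [EB] compresses to a scalar. *)
Lemma BMW_BAB : EB * EA * EB = EB.
Proof.
have e X : X * EA * X = X * X - z^-1 *: (X * a * X - X * ai * X).
  by rewrite /BMW_Eof mulrBr mulr1 -pz_scalerAr mulrBl -pz_scalerAl mulrBr mulrBl.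
rewrite e BaB BaiB (BMW_EE bK biK cubic_b) -scalerBl scalerA -scalerBl.
by rewrite -addrA -opprD -mulrDr addrA subrK subrr mulr0 subr0 scale1r.
Qed.

(* Conjugation by the half twist exchanges the two generators. *)
Let half_twist : exists w, [/\ w * EA = EB * w, w * EB = EA * w, w * a = b * w &
  forall x y, x * w = y * w -> x = y].
Proof.
exists (a * b * a); have wa : a * b * a * a = b * (a * b * a) by rewrite {1}braid !mulrA.
have wb : a * b * a * b = a * (a * b * a) by rewrite {2}braid !mulrA.
split=> //; [exact: intertwine|exact: intertwine|].
have ww : a * b * a * (ai * bi * ai) = 1.
  by rewrite !mulrA -[_ * a * ai]mulrA aK mulr1 -[_ * b * bi]mulrA bK mulr1.
by move=> x y; move: (a * b * a) ww => w ww e; rewrite -[x]mulr1 -[y]mulr1 -ww !mulrA e.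
Qed.

Lemma BMW_ABA : EA * EB * EA = EA.
Proof.
have [w [wA wB wa wK]] := half_twist.
apply: wK; rewrite -mulrA -wB mulrA -[EA * EB * w]mulrA -wA mulrA -wB.
by rewrite -!mulrA [EB * (EA * EB)]mulrA BMW_BAB.
Qed.

Let AbA : EA * b * EA = r *: EA.
Proof.
have [w [wA wB wa wK]] := half_twist.
apply: wK; rewrite -mulrA -wB mulrA -[EA * b * w]mulrA -wa mulrA -wB.
by rewrite -!mulrA [EB * (a * EB)]mulrA BaB -pz_scalerAr -pz_scalerAl wB.
Qed.

Let abA : a * b * EA = EB * (a * b).
Proof. by apply: intertwine; rewrite // braid mulrA. Qed.

Let baB : b * a * EB = EA * (b * a).
Proof. by apply: intertwine; rewrite // -braid mulrA. Qed.

(** As [a * b] carries [EA] to [EB] and [EA = EA * EB * EA], the product is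
    [EB * (a * b) * EB * EA], whose first three factors reduce to [EB]. *)
Lemma BMW_abA : a * b * EA = EB * EA.
Proof.
have BabB : EB * (a * b) * EB = EB.
  rewrite mulrA -[_ * b * _]mulrA (BMW_GE bK biK cubic_b) -pz_scalerAr BaB.
  by rewrite scalerA mulVf ?scale1r.
by rewrite -{1}BMW_ABA !mulrA abA BabB.
Qed.

Lemma BMW_baB : b * a * EB = EA * EB.
Proof.
have AbaA : EA * (b * a) * EA = EA.
  rewrite mulrA -[_ * a * _]mulrA (BMW_GE aK aiK cubic_a) -pz_scalerAr AbA.
  by rewrite scalerA mulVf ?scale1r.
by rewrite -{1}BMW_BAB !mulrA baB AbaA.
Qed.

Lemma BMW_Bab : EB * a * b = EB * EA.
Proof. by rewrite -mulrA -abA BMW_abA. Qed.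

Lemma BMW_Aba : EA * b * a = EA * EB.
Proof. by rewrite -mulrA -baB BMW_baB. Qed.

Let bA : b * EA = ai * EB * EA.
Proof. by rewrite -mulrA -BMW_abA !mulrA aiK mul1r. Qed.

Let Ab : EA * b = EA * EB * ai.
Proof. by rewrite -BMW_Aba -mulrA aK mulr1. Qed.

Lemma BMW_bAB : b * EA * EB = ai * EB.
Proof. by rewrite bA -!mulrA [EB * (EA * EB)]mulrA BMW_BAB. Qed.

Lemma BMW_BAb : EB * EA * b = EB * ai.
Proof. by rewrite -mulrA Ab !mulrA BMW_BAB. Qed.

Lemma BMW_bAb : b * EA * b = ai * EB * ai.
Proof. by rewrite bA -!mulrA [EB * (EA * b)]mulrA BMW_BAb. Qed.

End BMWRelations.

Section BMWTower.
Variables (K : fieldType) (r q : K).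
Hypotheses (r0 : r != 0) (z0 : q - q^-1 != 0) (q0 : q != 0).
Local Notation z := (q - q^-1).
Local Notation inc := (@BMW_incl K r q _).
Local Notation minc := (BMW_incl_morphism r q _).

Definition BMW_lastG m : BMW r q m.+2 := @BMW_G K r q m.+2 ord_max.
Definition BMW_lastGi m : BMW r q m.+2 := @BMW_Gi K r q m.+2 ord_max.
Definition BMW_lastE m : BMW r q m.+2 := BMW_Eof q (BMW_lastG m) (BMW_lastGi m).

Lemma BMW_ind m (P : BMW r q m -> Prop) : lin_closed P -> P 1 ->
  (forall i u, P u -> P (BMW_G r q i * u)) ->
  (forall i u, P u -> P (BMW_Gi r q i * u)) -> forall u, P u.
Proof. by move=> lP P1 PG PGi; apply: pres_ind => // -[i|i] u; [apply: PG|apply: PGi]. Qed.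

Lemma BMW_incl_Eof m (g gi : BMW r q m) : inc (BMW_Eof q g gi) = BMW_Eof q (inc g) (inc gi).
Proof. by rewrite /BMW_Eof (amB minc) (amZ minc) (amB minc) (am1 minc). Qed.

Lemma BMW_gen_case m (i : 'I_(m.+2).-1) : i = ord_max \/ exists j : 'I_(m.+1).-1,
  BMW_G r q i = inc (BMW_G r q j) /\ BMW_Gi r q i = inc (BMW_Gi r q j).
Proof.
have [im|im] := eqVneq i ord_max; first by left; rewrite im.
have lt : (i < m)%N.
  by have := ltn_ord i; rewrite ltnS leq_eqVlt => /orP[/eqP e|//];
     case/eqP: im; apply/val_inj.
right; exists (Ordinal lt); rewrite BMW_incl_G BMW_incl_Gi.
by split; [congr (BMW_G r q _)|congr (BMW_Gi r q _)]; apply/val_inj.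
Qed.

Lemma BMW_small m (x : BMW r q m) : (m <= 1)%N -> exists k : K, x = k *: (1 : BMW r q m).
Proof.
move=> m1; apply: (BMW_ind (P := fun x => exists k : K, x = k *: (1 : BMW r q m))).
- by move=> k u v [a ->] [b ->]; exists (k * a + b); rewrite scalerDl scalerA.
- by exists 1; rewrite scale1r.
- by case: m m1 x => [|[|]] // _ _ [].
- by case: m m1 x => [|[|]] // _ _ [].
Qed.

Section Relations.
Variable m : nat.
Implicit Type i : 'I_m.-1.
Lemma BMW_GK i : BMW_G r q i * BMW_Gi r q i = 1.
Proof. by apply: BMW_relP; apply: BMW_rel_GGi. Qed.
Lemma BMW_GiK i : BMW_Gi r q i * BMW_G r q i = 1.
Proof. by apply: BMW_relP; apply: BMW_rel_GiG. Qed.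
Lemma BMW_cubic i : (BMW_G r q i - r^-1 *: (1 : BMW r q m)) *
  (BMW_G r q i - q *: (1 : BMW r q m)) * (BMW_G r q i + q^-1 *: (1 : BMW r q m)) = 0.
Proof. by apply: BMW_relP; apply: BMW_rel_cubic. Qed.
End Relations.

Definition BMW_letter m (y : BMW r q m.+2) : Prop :=
  [\/ y = 1, y = BMW_lastG m | y = BMW_lastE m].

Lemma BMW_last_comm m (y : BMW r q m.+2) (a : BMW r q m) : BMW_letter y ->
  y * inc (inc a) = inc (inc a) * y.
Proof.
pose C (y : BMW r q m.+2) := forall a : BMW r q m, y * inc (inc a) = inc (inc a) * y.
have CG : C (BMW_lastG m).
  have cG (i : 'I_m.-1) : BMW_lastG m * inc (inc (BMW_G r q i))
      = inc (inc (BMW_G r q i)) * BMW_lastG m.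
    rewrite !BMW_incl_G; apply: BMW_relP; apply: BMW_rel_comm; right => /=.
    by case: i => i /=; case: m {y a C} => //= m; rewrite ltnS.
  apply: BMW_ind.
  - move=> k u v hu hv; rewrite !(amD minc, amZ minc) mulrDl mulrDr.
    by rewrite -pz_scalerAl -pz_scalerAr hu hv.
  - by rewrite !(am1 minc) mul1r mulr1.
  - by move=> i u hu; rewrite !(amM minc) -mulrA -hu !mulrA cG.
  - move=> i u hu; rewrite !(amM minc) -mulrA -hu !mulrA; congr (_ * _).
    set g := inc (inc (BMW_G r q i)); set gi := inc (inc (BMW_Gi r q i)).
    have gK : g * gi = 1 by rewrite -!(amM minc) BMW_GK !(am1 minc).
    have giK : gi * g = 1 by rewrite -!(amM minc) BMW_GiK !(am1 minc).
    by rewrite -[LHS]mul1r -giK -mulrA [g * _]mulrA -cG -/g -mulrA gK mulr1.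
have CGi : C (BMW_lastGi m).
  move=> b; have := CG b; set x := inc (inc b) => e.
  have giK : BMW_lastGi m * BMW_lastG m = 1 by exact: (@BMW_GiK m.+2 ord_max).
  have gK : BMW_lastG m * BMW_lastGi m = 1 by exact: (@BMW_GK m.+2 ord_max).
  by rewrite -[RHS]mul1r -giK -mulrA [BMW_lastG m * _]mulrA e -mulrA gK mulr1.
case=> ->; [by rewrite mul1r mulr1|exact: CG|].
rewrite /BMW_lastE /BMW_Eof mulrBl mulrBr mul1r mulr1 -pz_scalerAl -pz_scalerAr.
by rewrite mulrBl mulrBr CG CGi.
Qed.

Lemma BMW_last_letters m (y y' : BMW r q m.+2) : BMW_letter y -> BMW_letter y' ->
  span (@BMW_letter m) (y * y').
Proof.
set S := span _.
have gK : BMW_lastG m * BMW_lastGi m = 1 by exact: (@BMW_GK m.+2 ord_max).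
have giK : BMW_lastGi m * BMW_lastG m = 1 by exact: (@BMW_GiK m.+2 ord_max).
have cu := @BMW_cubic m.+2 ord_max; rewrite -/(BMW_lastG m) in cu.
have S1 : S 1 by apply: span_genW; apply: Or31.
have SG : S (BMW_lastG m) by apply: span_genW; apply: Or32.
have SE : S (BMW_lastE m) by apply: span_genW; apply: Or33.
case=> ->; rewrite ?mul1r.
- by move=> ?; apply: span_genW.
- case=> ->; rewrite ?mulr1 //.
  + rewrite (BMW_GG z0 q0 gK giK cu).
    by rewrite -scaleNr; apply: submodD; [apply: submodD => //|]; apply: submodZ.
  + by rewrite (BMW_GE z0 q0 gK giK cu); apply: submodZ.
- case=> ->; rewrite ?mulr1 //.
  + by rewrite (BMW_EG z0 q0 gK giK cu); apply: submodZ.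
  + by rewrite (BMW_EE r0 z0 q0 gK giK cu); apply: submodZ.
Qed.

Notation sand m := (span (sandwich (@BMW_incl K r q m.+1) (@BMW_letter m))).

Lemma BMW_sand m a y b : BMW_letter y -> sand m (inc a * y * inc b).
Proof. by move=> Xy; apply: span_genW; exists a, y, b. Qed.

Lemma BMW_sand_letters m y : span (@BMW_letter m) y -> sand m y.
Proof.
move=> Sy; apply: (span_ind (P := fun y => sand m y) _ _ _ Sy);
  [exact: submod_lin|exact: submod0|move=> {Sy}y Xy].
by have := BMW_sand 1 1 Xy; rewrite (am1 minc) mul1r mulr1.
Qed.

(** The relations of two neighbouring strands rewrite every word [y x y'] so that the letter of the
    upper level occurs at most once. *)
Lemma BMW_sandwich_step m (y y' : BMW r q m.+3) (x : BMW r q m.+2) :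
  BMW_letter y -> BMW_letter x -> BMW_letter y' -> sand m.+1 (y * inc x * y').
Proof.
move=> Xy Xx Xy'.
have gK n : BMW_lastG n * BMW_lastGi n = 1 by exact: (@BMW_GK n.+2 ord_max).
have giK n : BMW_lastGi n * BMW_lastG n = 1 by exact: (@BMW_GiK n.+2 ord_max).
have cu n := @BMW_cubic n.+2 ord_max.
set b := BMW_lastG m.+1; set bi := BMW_lastGi m.+1.
set a := inc (BMW_lastG m); set ai := inc (BMW_lastGi m).
have aK : a * ai = 1 by rewrite -(amM minc) gK (am1 minc).
have aiK : ai * a = 1 by rewrite -(amM minc) giK (am1 minc).
have ca : (a - r^-1 *: (1 : BMW r q m.+3)) * (a - q *: (1 : BMW r q m.+3))
    * (a + q^-1 *: (1 : BMW r q m.+3)) = 0.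
  by rewrite /a /BMW_lastG BMW_incl_G; apply: BMW_cubic.
have braid : a * b * a = b * a * b.
  by rewrite /a /BMW_lastG BMW_incl_G; apply: BMW_relP; apply: BMW_rel_braid.
have BaB : BMW_Eof q b bi * a * BMW_Eof q b bi = r *: BMW_Eof q b bi.
  by rewrite /a /BMW_lastG BMW_incl_G; apply: BMW_relP; apply: BMW_rel_EGE.
have BaiB : BMW_Eof q b bi * ai * BMW_Eof q b bi = r^-1 *: BMW_Eof q b bi.
  by rewrite /ai /BMW_lastGi BMW_incl_Gi; apply: BMW_relP; apply: BMW_rel_EGiE.
have EA : inc (BMW_lastE m) = BMW_Eof q a ai by apply: BMW_incl_Eof.
have EB : BMW_lastE m.+1 = BMW_Eof q b bi by [].
have X1 : BMW_letter (1 : BMW r q m.+3) by apply: Or31.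
have Xb : BMW_letter b by apply: Or32.
have XB : BMW_letter (BMW_lastE m.+1) by apply: Or33.
have SM u y0 v : BMW_letter y0 -> sand m.+1 (inc u * y0 * inc v) by apply: BMW_sand.
have S1 u y0 : BMW_letter y0 -> sand m.+1 (inc u * y0).
  by move=> /(SM u y0 1); rewrite (am1 minc) mulr1.
have S2 u y0 : BMW_letter y0 -> sand m.+1 (y0 * inc u).
  by move=> /(SM 1 y0 u); rewrite (am1 minc) mul1r.
case: Xx => ->.
- rewrite (am1 minc) mulr1; apply: BMW_sand_letters; exact: BMW_last_letters.
- rewrite -/a; case: Xy => ->; first by rewrite mul1r; apply: S1.
  + case: Xy' => ->; first by rewrite mulr1; apply: S2.
    * by rewrite -braid; apply: SM.
    * by rewrite EB (BMW_baB r0 z0 q0 aK aiK (gK _) (giK _) ca (cu _)) // -EA; apply: S1.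
  + case: Xy' => ->; first by rewrite mulr1; apply: S2.
    * by rewrite EB (BMW_Bab r0 z0 q0 aK aiK (gK _) (giK _) (cu _)) // -EA; apply: S2.
    * by rewrite EB BaB; apply: submodZ; have := S1 1 _ XB; rewrite (am1 minc) mul1r.
case: Xy => ->; first by rewrite mul1r; apply: S1.
- case: Xy' => ->; first by rewrite mulr1; apply: S2.
  + rewrite EA (BMW_bAb r0 z0 q0 aK aiK (gK _) (giK _) ca (cu _)) //; exact: SM.
  + rewrite EA EB (BMW_bAB r0 z0 q0 aK aiK (gK _) (giK _) (cu _)) //; exact: S1.
- case: Xy' => ->; first by rewrite mulr1; apply: S2.
  + rewrite EA EB (BMW_BAb r0 z0 q0 aK aiK (gK _) (giK _) ca (cu _)) //; exact: S2.
  + rewrite EA EB (BMW_BAB r0 z0 q0 (gK _) (giK _) (cu _)) // -EB.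
    by have := S1 1 _ XB; rewrite (am1 minc) mul1r.
Qed.

(** The inverse generator is a combination of [1], [G] and [E], so it is absorbed as well. *)
Lemma BMW_absorb_full m : (forall y u, BMW_letter y -> sand m u -> sand m (y * u)) ->
  forall x, sand m x.
Proof.
move=> absorb; have S1 : sand m 1 by apply: BMW_sand_letters; apply: span_genW; apply: Or31.
have XG : BMW_letter (BMW_lastG m) by apply: Or32.
have XE : BMW_letter (BMW_lastE m) by apply: Or33.
have Sinc a u : sand m u -> sand m (inc a * u).
  by move=> /(sandwichM minc a 1); rewrite (am1 minc) mulr1.
apply: (BMW_ind (P := fun x => sand m x)) => //; first exact: submod_lin.
- move=> i u Su; have [->|[j [-> _]]] := BMW_gen_case i; last exact: Sinc.
  exact: absorb XG Su.
- move=> i u Su; have [->|[j [_ ->]]] := BMW_gen_case i; last exact: Sinc.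
  rewrite -/(BMW_lastGi m) (BMW_Gi_def z0 (BMW_lastG m) (BMW_lastGi m)).
  rewrite mulrDl mulrBl -!pz_scalerAl mul1r -scaleNr.
  apply: submodD; last by apply: submodZ; exact: absorb XE Su.
  by apply: submodD; [exact: absorb XG Su|exact: submodZ].
Qed.

(** This spanning property is what makes the Markov trace unique. *)
Lemma BMW_sandwich m (x : BMW r q m.+2) : sand m x.
Proof.
elim: m x => [|m IH]; apply: BMW_absorb_full => y u Xy Su.
- apply: (tower_absorb (i := @BMW_incl K r q 0) (X1 := fun y => y = 1) minc _ _ _ Xy Su).
  + move=> v; have [k ->] := BMW_small v isT; apply: submodZ.
    by apply: span_genW; exists 1, 1, 1; rewrite (am1 minc) !mulr1.
  + by move=> y0 a; apply: BMW_last_comm.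
  + move=> y0 z' y' Xy0 -> Xy'; rewrite (am1 minc) mulr1; apply: BMW_sand_letters.
    exact: BMW_last_letters.
- apply: (tower_absorb minc IH _ _ Xy Su).
  + by move=> y0 a; apply: BMW_last_comm.
  + by move=> y0 x y'; apply: BMW_sandwich_step.
Qed.

(** On a sandwich the Markov property reduces the trace to the level below. *)
Lemma BMW_markov_unique (Tr Tr' : forall m, trace_form (BMW r q m)) :
  BMW_markov Tr -> BMW_markov Tr' -> forall m a, Tr m a = Tr' m a.
Proof.
move=> h h'; have small n (a : BMW r q n) : (n <= 1)%N -> Tr n a = Tr' n a.
  by move=> n1; have [k ->] := BMW_small a n1; rewrite !trZ (BMW_Tr1 h) (BMW_Tr1 h').
move=> [|m] a; first exact: small.
elim: m a => [|m IH] a; first exact: small.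
apply: (span_ind (P := fun a => Tr m.+2 a = Tr' m.+2 a) _ _ _ (BMW_sandwich a)).
- by move=> k u v hu hv; rewrite !trD !trZ hu hv.
- by rewrite !tr0.
move=> _ [x [y [x' [[->|->|->] ->]]]].
- by rewrite mulr1 -(amM minc) (BMW_Tr_incl h) (BMW_Tr_incl h') IH.
- rewrite (BMW_Tr_markovG h) (BMW_Tr_markovG h') IH.
  by rewrite (BMW_TrG h) (BMW_TrG h').
- rewrite (BMW_Tr_markovE h) (BMW_Tr_markovE h') IH.
  by rewrite (BMW_TrE h) (BMW_TrE h').
Qed.

End BMWTower.

(** * The homomorphism from the BMW algebra to the tensor square *)

Section Sandwich.
Variables (K : fieldType) (A B : pzAlgType K) (f : A -> B) (L : B -> K).
Hypotheses (mf : alg_morphism f) (lL : scalar L).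
Implicit Types (k : K) (w : B).
Lemma sandwich_scalarl k w v : scalar (fun u => k * L (f u * w * f v)).
Proof. by move=> l x y; rewrite mf.1 !mulrDl !scale_mull lL mulrDr mulrCA. Qed.
Lemma sandwich_scalarr k w u : scalar (fun v => k * L (f u * w * f v)).
Proof. by move=> l x y; rewrite mf.1 !mulrDr !scale_mulr lL mulrDr mulrCA. Qed.
End Sandwich.

Section MulScalar.
Variables (K : fieldType) (A : pzAlgType K) (L : A -> K).
Hypothesis lL : scalar L.
Lemma mul_scalarl (k : K) (v : A) : scalar (fun u : A => k * L (u * v)).
Proof. by move=> l x y; rewrite mulrDl scale_mull lL mulrDr mulrCA. Qed.
Lemma mul_scalarr (k : K) (u : A) : scalar (fun v : A => k * L (u * v)).
Proof. by move=> l x y; rewrite mulrDr scale_mulr lL mulrDr mulrCA. Qed.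
End MulScalar.

Section TensorMap.
Variables (K : fieldType).

Section Map.
Variables (A A' : pzAlgType K) (f : A -> A').
Hypothesis mf : alg_morphism f.

Definition tens_map : tensor A A -> tensor A' A' := tens_lift (fun a b => tens (f a) (f b)).

Let bil : (forall b, linear (fun a => tens (f a) (f b))) /\
          (forall a, linear (fun b => tens (f a) (f b))).
Proof.
split=> u k v w; rewrite mf.1; [exact: tens_linl|exact: tens_linr].
Qed.

Lemma tens_mapE a b : tens_map (tens a b) = tens (f a) (f b).
Proof. by case: bil => h1 h2; apply: (tens_liftE h1 h2). Qed.

Lemma tens_map_morphism : alg_morphism tens_map.
Proof.
case: bil => h1 h2.
have lin : linear tens_map by apply: tens_lift_linear.
split=> //; split; first by rewrite [LHS]tens_mapE (am1 mf).
move=> u v; apply: (tens_ext (f := fun u => tens_map (u * v)) (g := fun u => tens_map u * tens_map v)).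
- by move=> k x y; rewrite -lin; congr tens_map; apply: tens_mul_linl.
- by move=> k x y; rewrite lin; apply: tens_mul_linl.
move=> a b; apply: (tens_ext (f := fun v => tens_map (tens a b * v))
  (g := fun v => tens_map (tens a b) * tens_map v)).
- by move=> k x y; rewrite -lin; congr tens_map; apply: tens_mul_linr.
- by move=> k x y; rewrite lin; apply: tens_mul_linr.
move=> c d; rewrite [_ * _]tens_mulE !tens_mapE [RHS]tens_mulE.
by rewrite !(amM mf).
Qed.
End Map.

Section Form.
Variables (A : pzAlgType K) (t : A -> K).
Hypothesis lt : scalar t.

Definition tens_form : tensor A A -> K :=
  tens_lift (W := K^o) (fun a b => t a * t b).

Let bil : (forall b, linear ((fun a => t a * t b) : A -> K^o)) /\
          (forall a, linear ((fun b => t a * t b) : A -> K^o)).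
Proof.
split=> u k v w /=; rewrite lt; first by rewrite mulrDl -mulrA.
by rewrite mulrDr mulrCA.
Qed.

Lemma tens_formE a b : tens_form (tens a b) = t a * t b.
Proof. by case: bil => h1 h2; apply: (tens_liftE h1 h2). Qed.

Lemma tens_form_linear : scalar tens_form.
Proof. by case: bil => h1 h2; apply: (tens_lift_linear h1 h2). Qed.

Lemma tens_form_ext (f : tensor A A -> K) : scalar f ->
  (forall a b, f (tens a b) = t a * t b) -> f =1 tens_form.
Proof.
move=> lf e; apply: (tens_ext (W := K^o) lf tens_form_linear) => a b.
by rewrite e tens_formE.
Qed.
Lemma tens_form2_ext (f g : tensor A A -> tensor A A -> K) :
  (forall v, scalar (f^~ v)) -> (forall u, scalar (f u)) ->
  (forall v, scalar (g^~ v)) -> (forall u, scalar (g u)) ->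
  (forall a b a' b', f (tens a b) (tens a' b') = g (tens a b) (tens a' b')) ->
  forall u v, f u v = g u v.
Proof.
move=> fl fr gl gr e u v; apply: (tens_ext (W := K^o) (fl v) (gl v)) => a b.
by apply: (tens_ext (W := K^o) (fr _) (gr _)) => a' b'.
Qed.
End Form.
End TensorMap.

Section Representation.
Variables (K : fieldType) (q : K).
Hypotheses (q0 : q != 0) (z0 : q * q - 1 != 0) (d0 : q * q + 1 != 0).
Local Notation d := (q + q^-1).
Local Notation c := ((d ^+ 2)^-1).
Local Notation z := (q - q^-1).
Local Notation r := (q ^+ 3).

(** The Hecke generator with eigenvalues [1] and [- q ^- 2], and its inverse. *)
Definition hecke (A : pzAlgType K) (e : A) : A := 1 - (1 + q ^- 2) *: e.
Definition heckeV (A : pzAlgType K) (e : A) : A := 1 - (1 + q ^+ 2) *: e.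

(** The eigenvalues of [tensG e] are [q] times the products of two eigenvalues of [hecke e]:
    [q], [- q^-1] and [q ^- 3]. *)
Definition tensG (A : pzAlgType K) (e : A) : tensor A A := q *: tens (hecke e) (hecke e).
Definition tensGi (A : pzAlgType K) (e : A) : tensor A A :=
  q^-1 *: tens (heckeV e) (heckeV e).

Section Algebra.
Variable A : pzAlgType K.
Implicit Types e a b : A.

Lemma hecke_mul_e e : e * e = e -> hecke e * e = (- q ^- 2) *: e.
Proof.
move=> ee; rewrite /hecke !expandE ee.
by coefficients K [:: e]; ring.
Qed.

Lemma heckeK e : e * e = e -> hecke e * heckeV e = 1.
Proof.
move=> ee; rewrite /hecke /heckeV !expandE ee.
by coefficients K [:: e; 1]; field; rewrite ?q0.
Qed.

Lemma heckeVK e : e * e = e -> heckeV e * hecke e = 1.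
Proof.
move=> ee; rewrite /hecke /heckeV !expandE ee.
by coefficients K [:: e; 1]; field; rewrite ?q0.
Qed.

Lemma hecke_braid a b : a * a = a -> a * b * a = c *: a -> b * b = b -> b * a * b = c *: b ->
  hecke a * hecke b * hecke a = hecke b * hecke a * hecke b.
Proof.
move=> aa aba bb bab; rewrite /hecke !expandE aa aba bb bab.
by coefficients K [:: a; b; a * b; b * a; 1]; field; rewrite ?q0 ?d0.
Qed.

Lemma e_hecke_e a b : a * a = a -> a * b * a = c *: a ->
  a * hecke b * a = (q / d) *: a.
Proof.
move=> aa aba; rewrite /hecke !expandE aa aba.
by coefficients K [:: a]; field; rewrite ?q0 ?d0.
Qed.

Lemma e_heckeV_e a b : a * a = a -> a * b * a = c *: a ->
  a * heckeV b * a = (q^-1 / d) *: a.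
Proof.
move=> aa aba; rewrite /heckeV !expandE aa aba.
by coefficients K [:: a]; field; rewrite ?q0 ?d0.
Qed.

Lemma tensM (a b a' b' : A) : tens a b * tens a' b' = tens (a * a') (b * b').
Proof. exact: tens_mulE. Qed.
Lemma tensNl (a b : A) : tens (- a) b = - tens a b.
Proof. by rewrite -scaleN1r tensZl scaleN1r. Qed.
Lemma tensNr (a b : A) : tens a (- b) = - tens a b.
Proof. by rewrite -scaleN1r tensZr scaleN1r. Qed.

Definition tensE := (@tensDl K A A, @tensDr K A A, @tensZl K A A, @tensZr K A A,
  tensNl, tensNr, @tensM).

Lemma tensGE e : BMW_Eof q (tensG e) (tensGi e) = (d ^+ 2) *: tens e e.
Proof.
rewrite /BMW_Eof /tensG /tensGi /hecke /heckeV !tensE -[1 in LHS]/(tens 1 1).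
by coefficients K [:: tens e 1; tens 1 e; tens e e; tens 1 1]; field; rewrite ?q0 ?z0.
Qed.

Variables (n : nat) (e : 'I_n -> A).
Hypothesis eP : forall u v, TL_rel q e u v -> u = v.

(** The braid relations hold in each tensor factor. The compressions of the generators by [E]
    come from the squares of the scalars in [e_hecke_e] and [e_heckeV_e]. *)
Lemma tensG_rel u v :
  BMW_rel r q (fun i => tensG (e i)) (fun i => tensGi (e i)) u v -> u = v.
Proof.
have idem i : e i * e i = e i by rewrite -expr2; apply/eP/TL_rel_idem.
have eee (i j : 'I_n) : j = i.+1 :> nat \/ i = j.+1 :> nat -> e i * e j * e i = c *: e i.
  by move=> h; apply/eP/TL_rel_eee.
have GGi i : tensG (e i) * tensGi (e i) = 1.
  rewrite /tensG /tensGi scale_mull scale_mulr tensM (heckeK (idem i)).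
  by rewrite scalerA mulfV // scale1r.
have GiG i : tensGi (e i) * tensG (e i) = 1.
  rewrite /tensG /tensGi scale_mull scale_mulr tensM (heckeVK (idem i)).
  by rewrite scalerA mulVf // scale1r.
have z1 : z != 0.
  by apply: contraNneq z0 => zz; rewrite -(mulr0 q) -zz mulrBr mulfV.
case=> [i|i|i j h|i j h|i|i j h|i j h].
- exact: GGi.
- exact: GiG.
- have ij := eee i j (or_introl h); have ji := eee j i (or_intror h).
  have hb := hecke_braid (idem i) ij (idem j) ji.
  by rewrite /tensG !(scale_mull, scale_mulr) !tensM hb.
- rewrite /tensG !expandE !scalerA !tensM.
  have cc : e i * e j = e j * e i by apply/eP/TL_rel_comm.
  suff -> : hecke (e i) * hecke (e j) = hecke (e j) * hecke (e i) by [].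
  rewrite /hecke !expandE cc.
  by coefficients K [:: e i; e j; e j * e i; 1]; ring.
- apply: (BMW_cubic_of_GE z1 q0 (GGi i)); rewrite tensGE scale_mulr /tensG scale_mull tensM.
  rewrite (hecke_mul_e (idem i)) tensZl tensZr.
  by coefficients K [:: tens (e i) (e i)]; field; rewrite ?q0.
- have ij := e_hecke_e (idem i) (eee i j (or_intror h)).
  rewrite !tensGE /tensG !(scale_mull, scale_mulr) !tensM ij tensZl tensZr.
  by coefficients K [:: tens (e i) (e i)]; field; rewrite ?q0 ?d0.
- have ij := e_heckeV_e (idem i) (eee i j (or_intror h)).
  rewrite !tensGE /tensGi !(scale_mull, scale_mulr) !tensM ij tensZl tensZr.
  by coefficients K [:: tens (e i) (e i)]; field; rewrite ?q0 ?d0.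
Qed.
End Algebra.

Lemma BMW_lift_rel (A : pzAlgType K) n (f : ('I_n + 'I_n)%type -> A) :
  (forall u v, BMW_rel r q (fun i => f (inl i)) (fun i => f (inr i)) u v -> u = v) ->
  forall u v, BMW_rel r q (fun i => @free_gen K ('I_n + 'I_n)%type (inl i))
    (fun i => @free_gen K ('I_n + 'I_n)%type (inr i)) u v -> free_lift f u = free_lift f v.
Proof.
move=> fP; have fE x y :
    free_lift f (BMW_Eof q x y) = BMW_Eof q (free_lift f x) (free_lift f y).
  by rewrite /BMW_Eof !(free_liftD, free_liftN, free_liftZ, free_lift1).
move=> u v [i|i|i j h|i j h|i|i j h|i j h];
  rewrite ?free_liftZ !free_liftM ?fE ?free_lift1 ?free_lift0;
  rewrite ?(free_liftD, free_liftN, free_liftZ, free_lift1) !free_liftE;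
  apply: fP.
- exact: BMW_rel_GGi.
- exact: BMW_rel_GiG.
- exact: BMW_rel_braid.
- exact: BMW_rel_comm.
- exact: BMW_rel_cubic.
- exact: BMW_rel_EGE.
- exact: BMW_rel_EGiE.
Qed.

Definition TL2 m : pzAlgType K := tensor (TL q m) (TL q m).

Definition bmw_rep_gen m (s : ('I_m.-1 + 'I_m.-1)%type) : TL2 m :=
  match s with inl i => tensG (TL_e q i) | inr i => tensGi (TL_e q i) end.

Definition bmw_rep m : BMW r q m -> TL2 m := pres_lift (@bmw_rep_gen m).

Lemma bmw_rep_rel m u v :
  BMW_rel r q (fun i => @free_gen K ('I_m.-1 + 'I_m.-1)%type (inl i))
    (fun i => @free_gen K ('I_m.-1 + 'I_m.-1)%type (inr i)) u v ->
  free_lift (@bmw_rep_gen m) u = free_lift (@bmw_rep_gen m) v.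
Proof. by apply: BMW_lift_rel; apply: tensG_rel; apply: TL_relP. Qed.

Lemma bmw_rep_morphism m : alg_morphism (@bmw_rep m).
Proof. by apply: pres_lift_morphism; apply: bmw_rep_rel. Qed.

Lemma bmw_rep_G m (i : 'I_m.-1) : bmw_rep (BMW_G r q i) = tensG (TL_e q i).
Proof. by apply: (pres_lift_gen (f := @bmw_rep_gen m)); apply: bmw_rep_rel. Qed.

Lemma bmw_rep_Gi m (i : 'I_m.-1) : bmw_rep (BMW_Gi r q i) = tensGi (TL_e q i).
Proof. by apply: (pres_lift_gen (f := @bmw_rep_gen m)); apply: bmw_rep_rel. Qed.

Lemma bmw_rep_E m (i : 'I_m.-1) : bmw_rep (BMW_E r q i) = (d ^+ 2) *: tens (TL_e q i) (TL_e q i).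
Proof.
rewrite /BMW_E -tensGE -bmw_rep_G -bmw_rep_Gi /BMW_Eof.
by rewrite (amB (bmw_rep_morphism m)) (am1 (bmw_rep_morphism m)) (amZ (bmw_rep_morphism m)) (amB (bmw_rep_morphism m)).
Qed.

Local Notation inc2 := (tens_map (@TL_incl K q _)).
Local Notation minc := (TL_incl_morphism q _).
Let minc2 m : alg_morphism (tens_map (@TL_incl K q m)) := tens_map_morphism minc.

Lemma inc_hecke m (e : TL q m) : TL_incl (hecke e) = hecke (TL_incl e).
Proof. by rewrite /hecke (amB minc) (amZ minc) (am1 minc). Qed.

Lemma inc_heckeV m (e : TL q m) : TL_incl (heckeV e) = heckeV (TL_incl e).
Proof. by rewrite /heckeV (amB minc) (amZ minc) (am1 minc). Qed.

Lemma bmw_rep_incl m (a : BMW r q m) : bmw_rep (BMW_incl a) = inc2 (bmw_rep a).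
Proof.
have mB := BMW_incl_morphism r q m; have mr := bmw_rep_morphism.
apply: (BMW_ind (P := fun a => bmw_rep (BMW_incl a) = inc2 (bmw_rep a))).
- by move=> k u v hu hv; rewrite mB.1 !(mr _).1 (minc2 m).1 hu hv.
- by rewrite (am1 mB) !(am1 (mr _)) (am1 (minc2 m)).
- move=> i u hu; rewrite (amM mB) !(amM (mr _)) (amM (minc2 m)) hu; congr (_ * _).
  by rewrite BMW_incl_G !bmw_rep_G (amZ (minc2 m)) (tens_mapE minc) inc_hecke TL_incl_e.
- move=> i u hu; rewrite (amM mB) !(amM (mr _)) (amM (minc2 m)) hu; congr (_ * _).
  by rewrite BMW_incl_Gi !bmw_rep_Gi (amZ (minc2 m)) (tens_mapE minc) inc_heckeV TL_incl_e.
Qed.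

End Representation.

(** * The Markov trace of the BMW algebra as a tensor square *)

Section RepresentationTrace.
Variables (K : fieldType) (q : K).
Hypotheses (q0 : q != 0) (z0 : q * q - 1 != 0) (d0 : q * q + 1 != 0).
Local Notation d := (q + q^-1).
Local Notation c := ((d ^+ 2)^-1).
Local Notation r := (q ^+ 3).

Local Notation inc2 := (tens_map (@TL_incl K q _)).
Local Notation minc := (TL_incl_morphism q _).
Let minc2 m : alg_morphism (tens_map (@TL_incl K q m)) := tens_map_morphism minc.
Notation TL2 := (TL2 q).

Section Trace.
Variable tr : forall m, trace_form (TL q m).
Hypothesis tr_markov : TL_markov tr.
Local Notation tr2 := (tens_form (tr _)).
Let ltr2 m : scalar (tens_form (tr m)) := tens_form_linear (trace_linear (tr m)).

Let tr2E m a b : tens_form (tr m) (tens a b) = tr m a * tr m b :=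
  tens_formE (trace_linear (tr m)) a b.

Let tr2_cyclic m (u v : TL2 m) : tr2 (u * v) = tr2 (v * u).
Proof.
rewrite -[LHS]mul1r -[RHS]mul1r; move: u v.
apply: (tens_form2_ext (f := fun u v => 1 * tr2 (u * v)) (g := fun u v => 1 * tr2 (v * u))).
- by move=> v; exact: (mul_scalarl (@ltr2 _) _ v).
- by move=> u; exact: (mul_scalarr (@ltr2 _) _ u).
- by move=> v; exact: (mul_scalarr (@ltr2 _) _ v).
- by move=> u; exact: (mul_scalarl (@ltr2 _) _ u).
move=> a b a' b'; rewrite !tensM !tr2E.
by rewrite !(trace_cyclic (tr m) a') !(trace_cyclic (tr m) b').
Qed.

Definition bmw_rep_tr m (a : BMW r q m) : K := tr2 (bmw_rep a).

Lemma bmw_rep_tr_linear m : scalar (@bmw_rep_tr m).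
Proof. by move=> k u v; rewrite /bmw_rep_tr (bmw_rep_morphism q0 z0 d0 m).1 ltr2. Qed.

Lemma bmw_rep_tr_cyclic m (a b : BMW r q m) : bmw_rep_tr (a * b) = bmw_rep_tr (b * a).
Proof. by rewrite /bmw_rep_tr !(amM (bmw_rep_morphism q0 z0 d0 m)) tr2_cyclic. Qed.

Definition bmw_rep_trace m := TraceForm (@bmw_rep_tr_linear m) (@bmw_rep_tr_cyclic m).

Let tr2_incl m (u : TL2 m) : tr2 (inc2 u) = tr2 u.
Proof.
apply: (tens_form_ext (trace_linear (tr m)) (f := fun u => tr2 (inc2 u))).
- by move=> k x y; rewrite (minc2 m).1 ltr2.
- by move=> a b; rewrite (tens_mapE minc) tr2E !(TL_tr_incl tr_markov).
Qed.

(* Used for the last generator and for its Hecke generator. *)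
Let tr2_markov m (h : TL q m.+2) (k : K) (u v : TL2 m.+1) :
  (forall a b, tr m.+2 (TL_incl a * h * TL_incl b) = k * tr m.+1 (a * b)) ->
  tr2 (inc2 u * tens h h * inc2 v) = k ^+ 2 * tr2 (u * v).
Proof.
move=> hk; rewrite -[LHS]mul1r; move: u v.
apply: (tens_form2_ext (f := fun u v => 1 * tr2 (inc2 u * tens h h * inc2 v))
  (g := fun u v => k ^+ 2 * tr2 (u * v))).
- by move=> v; exact: (sandwich_scalarl (minc2 _) (@ltr2 _) _ _ v).
- by move=> u; exact: (sandwich_scalarr (minc2 _) (@ltr2 _) _ _ u).
- by move=> v; exact: (mul_scalarl (@ltr2 _) _ v).
- by move=> u; exact: (mul_scalarr (@ltr2 _) _ u).
move=> a b a' b'; rewrite !(tens_mapE minc) !tensM !tr2E !hk mul1r.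
by rewrite mulrACA.
Qed.

Let tr_lin m k (e : TL q m) : tr m (1 - k *: e) = 1 - k * tr m e.
Proof. by rewrite trB trZ (TL_tr1 tr_markov). Qed.

Let tr_last_lin m k (a b : TL q m.+1) :
  tr m.+2 (TL_incl a * (1 - k *: TL_last q m) * TL_incl b) = (1 - k * c) * tr m.+1 (a * b).
Proof.
rewrite mulrBr mulrBl mulr1 scale_mulr scale_mull trB trZ (TL_tr_last tr_markov) mulrBl mul1r.
by rewrite -(amM minc) (TL_tr_incl tr_markov) mulrA.
Qed.

Let xE : BMW_x r q = d ^+ 2.
Proof. by rewrite /BMW_x; field; rewrite ?q0 ?z0. Qed.

Let tr2Z m k (u : TL2 m) : tr2 (k *: u) = k * tr2 u.
Proof.
have t0 : tr2 (0 : TL2 m) = 0.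
  by have := ltr2 (-1) (0 : TL2 m) 0; rewrite scaleN1r mulN1r !addNr.
by rewrite -[k *: u]addr0 ltr2 t0 addr0.
Qed.

Let tr_G m (i : 'I_m.-1) : bmw_rep_tr (BMW_G r q i) = r / BMW_x r q.
Proof.
rewrite /bmw_rep_tr (bmw_rep_G q0 z0 d0) tr2Z tr2E tr_lin (TL_tr_e tr_markov) xE.
by field; rewrite ?q0 ?d0.
Qed.

Let tr_Gi m (i : 'I_m.-1) : bmw_rep_tr (BMW_Gi r q i) = r^-1 / BMW_x r q.
Proof.
rewrite /bmw_rep_tr (bmw_rep_Gi q0 z0 d0) tr2Z tr2E tr_lin (TL_tr_e tr_markov) xE.
by field; rewrite ?q0 ?d0.
Qed.

Let tr_E m (i : 'I_m.-1) : bmw_rep_tr (BMW_E r q i) = (BMW_x r q)^-1.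
Proof.
rewrite /bmw_rep_tr (bmw_rep_E q0 z0 d0) tr2Z tr2E (TL_tr_e tr_markov) xE.
by field; rewrite ?q0 ?d0.
Qed.

(** The image of a generator is a multiple of a pure tensor, so its Markov property is that of
    [tr] in each factor; the scalars match because [BMW_x] is [d ^+ 2] when [r = q ^+ 3]. *)
Lemma bmw_rep_markov : BMW_markov bmw_rep_trace.
Proof.
have mr := bmw_rep_morphism q0 z0 d0.
have E m a : bmw_rep_trace m a = bmw_rep_tr a by [].
split=> [m a|m|m i|m i|m i|m a b chi|m a b chi]; rewrite !E ?tr_E ?tr_G ?tr_Gi //.
- by rewrite /bmw_rep_tr (bmw_rep_incl q0 z0 d0) tr2_incl.
- by rewrite /bmw_rep_tr (am1 (mr m)) tr2E !(TL_tr1 tr_markov) mulr1.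
- rewrite /bmw_rep_tr !(amM (mr _)) !(bmw_rep_incl q0 z0 d0) (bmw_rep_G q0 z0 d0) scale_mulr scale_mull tr2Z.
  rewrite (tr2_markov _ _ (tr_last_lin _)) xE mulrA; congr (_ * _).
  by field; rewrite ?q0 ?d0.
- rewrite /bmw_rep_tr !(amM (mr _)) !(bmw_rep_incl q0 z0 d0) (bmw_rep_E q0 z0 d0) scale_mulr scale_mull tr2Z.
  rewrite (tr2_markov _ _ (TL_tr_last tr_markov (m := m))) xE mulrA; congr (_ * _).
  by field; rewrite ?q0 ?d0.
Qed.

End Trace.

End RepresentationTrace.

(** * Alternating forms on sandwiches *)

(** A form [F] in the two left or in the two right factors of the bracket of two sandwiches, modulo
    the image. On the right side the factors multiply in the opposite order, so the product [mu]
    is left abstract. [F_shift] comes from elements of [U0] that pass through the middle, and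
    [F_mul] from multiplying a vanishing bracket by the bracket of [p] and [q]. *)
Section Wedge.
Variables (K : fieldType) (T W : lmodType K).
Hypothesis two0 : (2 : K) != 0.
Variables (mu : T -> T -> T) (one : T).
Local Notation "x ** y" := (mu x y) (at level 40, left associativity).
Hypotheses (muA : forall x y z, x ** (y ** z) = x ** y ** z)
  (mu1l : forall x, one ** x = x) (mu1r : forall x, x ** one = x)
  (mu_linl : forall k x y z, (k *: x + y) ** z = k *: (x ** z) + y ** z)
  (mu_linr : forall k x y z, z ** (k *: x + y) = k *: (z ** x) + z ** y).

Variables (U0 U1 : T -> Prop) (a : T).
Hypotheses (U0_1 : U0 one) (U0M : forall s t, U0 s -> U0 t -> U0 (s ** t))
  (U0Z : forall k s, U0 s -> U0 (k *: s)) (U01 : forall s, U0 s -> U1 s)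
  (U1a : U1 a) (U1M : forall x y, U1 x -> U1 y -> U1 (x ** y))
  (U1L : lin_closed U1) (aa : a ** a = a).
Hypothesis U1_split : forall P : T -> Prop, lin_closed P -> (forall s, U0 s -> P s) ->
  (forall s t, U0 s -> U0 t -> P (s ** a ** t)) -> forall x, U1 x -> P x.

Variable F : T -> T -> W.
Hypotheses (F_lin : forall k x y z, F (k *: x + y) z = k *: F x z + F y z)
  (F_anti : forall x y, U1 x -> U1 y -> F x y = - F y x)
  (F_shift : forall x y s, U1 x -> U1 y -> U0 s -> F (x ** s) y = F x (y ** s))
  (F_mul : forall p q x y, U1 p -> U1 q -> U1 x -> U1 y -> F x y = 0 ->
     F (p ** x) (q ** y) + F (q ** x) (p ** y) = 0).

Let F0 y : F 0 y = 0.
Proof. by have := F_lin (-1) 0 0 y; rewrite !scaleN1r !addNr. Qed.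

Let F_alt x : U1 x -> F x x = 0.
Proof.
move=> Ux; have e := F_anti Ux Ux; apply/eqP.
have : 2 *: F x x = 0 by rewrite scaler_nat mulr2n {1}e addNr.
by move=> /eqP; rewrite scaler_eq0 (negPf two0).
Qed.

Let F_antiL x y : U1 x -> U1 y -> F x y = 0 -> F y x = 0.
Proof. by move=> Ux Uy e; rewrite F_anti // e oppr0. Qed.

Definition wedge_null s := forall x y, U1 x -> U1 y -> F (x ** s) y = 0.

(** Shifting [s] and [t] to the second argument and back exchanges their order. *)
Lemma wedge_comm x y s t : U1 x -> U1 y -> U0 s -> U0 t ->
  F (x ** (s ** t)) y = F (x ** (t ** s)) y.
Proof.
move=> Ux Uy Us Ut; have U1s := U01 Us; have U1t := U01 Ut.
rewrite muA F_shift //; last exact: U1M.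
by rewrite F_shift //; [rewrite -muA -F_shift //; exact: U0M|exact: U1M].
Qed.

Lemma wedge_null_lin : lin_closed wedge_null.
Proof. by move=> k s t ns nt x y Ux Uy; rewrite mu_linr F_lin ns // nt // scaler0 addr0. Qed.

(** Modulo commutators [c *: s], [s ** t] and [c *: t] agree, so [s] and [t] act alike; then
    [c *: t] acts as [t ** s], hence as [t ** t = t], and [c] is not [1]. *)
Lemma wedge_null_neighbour (c : K) s t : U0 s -> U0 t -> c != 0 -> c != 1 ->
  s ** s = s -> t ** t = t -> s ** t ** s = c *: s -> t ** s ** t = c *: t -> wedge_null t.
Proof.
move=> Us Ut c0 c1 ss tt sts tst.
have muZ k x z : z ** (k *: x) = k *: (z ** x).
  have m0 : z ** 0 = 0 by have := mu_linr (-1) 0 0 z; rewrite !scaleN1r !addNr.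
  by rewrite -[k *: x]addr0 mu_linr m0 addr0.
have FZ k x y : F (k *: x) y = k *: F x y by rewrite -[k *: x]addr0 F_lin F0 addr0.
have U0st := U0M Us Ut; have U0ts := U0M Ut Us.
have key x y : U1 x -> U1 y -> F (x ** s) y = F (x ** t) y.
  move=> Ux Uy; apply: (scalerI c0); rewrite -!FZ -!muZ -sts -tst.
  rewrite (wedge_comm Ux Uy U0st Us) [s ** (s ** t)]muA ss.
  rewrite (wedge_comm Ux Uy U0ts Ut) [t ** (t ** s)]muA tt.
  exact: wedge_comm.
move=> x y Ux Uy; apply/eqP.
have : (c - 1) *: F (x ** t) y = 0.
  rewrite scalerBl scale1r -FZ -muZ -tst (wedge_comm Ux Uy U0ts Ut) [t ** (t ** s)]muA tt.
  rewrite muA key //; last by apply: U1M => //; exact: U01.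
  by rewrite -muA tt subrr.
by move/eqP; rewrite scaler_eq0 subr_eq0 (negPf c1).
Qed.

(** As [U0] is scalar up to null elements, [U1] is spanned by [one] and [a] modulo the radical, and
    an alternating form on a plane is determined by one value. *)
Lemma wedge_vanish :
  (forall s, U0 s -> exists2 k : K, wedge_null (s - k *: one) & U0 (s - k *: one)) ->
  F a one = 0 -> forall x y, U1 x -> U1 y -> F x y = 0.
Proof.
move=> U0_null Fa1.
pose rad x := forall y, U1 y -> F x y = 0.
have U11 := U01 U0_1.
(* multiplying [F a one = 0] by a null [j] kills [F (j ** a)] *)
have ja j : wedge_null j -> U0 j -> rad (j ** a).
  move=> nj Uj y Uy; have U1j := U01 Uj; have := F_mul U1j Uy U1a U11 Fa1.
  have U1ya : U1 (y ** a) by apply: U1M.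
  have Fj : F j (y ** a) = 0 by rewrite -[j]mu1l; apply: nj.
  by rewrite !mu1r (F_antiL U1j U1ya Fj) addr0.
have rad_lin : lin_closed rad.
  by move=> k u v ru rv y Uy; rewrite F_lin ru // rv // scaler0 addr0.
have reduce x : U1 x -> exists k l : K, rad (x - (k *: one + l *: a)).
  apply: (@U1_split (fun x => exists k l : K, rad (x - (k *: one + l *: a)))).
  - move=> k u v [k1 [l1 h1]] [k2 [l2 h2]]; exists (k * k1 + k2), (k * l1 + l2).
    have -> : k *: u + v - ((k * k1 + k2) *: one + (k * l1 + l2) *: a)
       = k *: (u - (k1 *: one + l1 *: a)) + (v - (k2 *: one + l2 *: a)).
      by coefficients K [:: u; v; one; a]; ring.
    exact: rad_lin.
  - move=> s Us; have [k nk _] := U0_null s Us; exists k, 0; rewrite scale0r addr0.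
    by move=> y Uy; rewrite -[s - _]mu1l; apply: nk.
  - move=> s t Us Ut; have [k nk U0k] := U0_null s Us; have [l nl _] := U0_null t Ut.
    exists 0, (k * l); rewrite scale0r add0r.
    have -> : s ** a ** t - (k * l) *: a = s ** a ** (t - l *: one) + l *: ((s - k *: one) ** a).
      have e1 : s ** a ** (t - l *: one) = - l *: (s ** a) + s ** a ** t.
        by rewrite addrC -scaleNr mu_linr mu1r.
      have e2 : (s - k *: one) ** a = - k *: a + s ** a.
        by rewrite addrC -scaleNr mu_linl mu1l.
      rewrite e1 e2.
      by coefficients K [:: s ** a ** t; s ** a; a]; ring.
    rewrite addrC; apply: rad_lin; first exact: ja.
    by move=> y Uy; apply: nl => //; apply: U1M => //; exact: U01.
have Fspan k l k' l' : F (k *: one + l *: a) (k' *: one + l' *: a) = 0.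
  have U1v n n' : U1 (n *: one + n' *: a) by apply: U1L => //; exact: lin_closedZ.
  have F1a : F one a = 0 by apply: F_antiL.
  have F1 n n' : F (n *: one + n' *: a) one = 0.
    by rewrite -[n' *: a]addr0 !F_lin F0 F_alt // Fa1 !scaler0 !addr0.
  have Fa n n' : F (n *: one + n' *: a) a = 0.
    by rewrite -[n' *: a]addr0 !F_lin F0 F_alt // F1a !scaler0 !addr0.
  apply: F_antiL => //; rewrite -[l' *: a]addr0 !F_lin F0.
  by rewrite !(F_antiL (U1v _ _)) // !scaler0 !addr0.
move=> x y Ux Uy; have [k [l rx]] := reduce x Ux; have [k' [l' ry]] := reduce y Uy.
have U1v n n' : U1 (n *: one + n' *: a) by apply: U1L => //; exact: lin_closedZ.
set vx := k *: one + l *: a in rx; set vy := k' *: one + l' *: a in ry.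
have FD u v z : F (u + v) z = F u z + F v z by have := F_lin 1 u v z; rewrite !scale1r.
have e : F x y = F vx y by have := FD (x - vx) vx y; rewrite subrK (rx y Uy) add0r.
have e' : F y vx = F vy vx by have := FD (y - vy) vy vx; rewrite subrK (ry vx (U1v k l)) add0r.
by rewrite e (F_anti (U1v k l) Uy) e' Fspan oppr0.
Qed.

(** Without a neighbour in [U0], the nullity of [p] has to come from the values of the form: right
    multiples of [p] are orthogonal to [one], [p], [a] and [p ** a], and this is enough because
    [p] can be shifted to the other argument. *)
Lemma wedge_vanish2 (c : K) p : U0 p -> p ** p = p -> p ** a ** p = c *: p ->
  (forall s, U0 s -> exists k l : K, s = k *: one + l *: p) ->
  F a one = 0 -> F a p = 0 -> forall x y, U1 x -> U1 y -> F x y = 0.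
Proof.
move=> Up pp pap U0p Fa1 Fap; have U1p := U01 Up; have U11 := U01 U0_1.
have FZ k x y : F (k *: x) y = k *: F x y by rewrite -[k *: x]addr0 F_lin F0 addr0.
have shift x y : U1 x -> U1 y -> F (x ** p) y = F x (y ** p) by move=> *; apply: F_shift.
have muZl k x z : (k *: x) ** z = k *: (x ** z).
  have m0 : 0 ** z = 0 by have := mu_linl (-1) 0 0 z; rewrite !scaleN1r !addNr.
  by rewrite -[k *: x]addr0 mu_linl m0 addr0.
have muZr k x z : z ** (k *: x) = k *: (z ** x).
  have m0 : z ** 0 = 0 by have := mu_linr (-1) 0 0 z; rewrite !scaleN1r !addNr.
  by rewrite -[k *: x]addr0 mu_linr m0 addr0.
have rad_lin y : lin_closed (fun x => F x y = 0).
  by move=> k u v ru rv; rewrite F_lin ru rv scaler0 addr0.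
have radr_lin x : U1 x -> lin_closed (fun y => U1 y /\ F x y = 0).
  move=> Ux k u v [Uu ru] [Uv rv]; have Uw := U1L k Uu Uv; split=> //.
  by rewrite F_anti // F_lin (F_antiL Ux Uu ru) (F_antiL Ux Uv rv) scaler0 addr0 oppr0.
have Fpa : F p a = 0 by apply: F_antiL.
have F1a : F one a = 0 by apply: F_antiL.
have Fp1 : F p one = 0.
  apply/eqP; have e : F p one = - F p one by rewrite -{1}[p]mu1l shift // mu1l F_anti.
  have : 2 *: F p one = 0 by rewrite scaler_nat mulr2n {1}e addNr.
  by move=> /eqP; rewrite scaler_eq0 (negPf two0).
have U1pa : U1 (p ** a) by apply: U1M.
have U1ap : U1 (a ** p) by apply: U1M.
(* right multiples of [p] are tested against [one], [p], [a] and [p ** a] only *)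
have test x : U1 x -> F (x ** p) one = 0 -> F (x ** p) p = 0 -> F (x ** p) a = 0 ->
    F (x ** p) (p ** a) = 0 -> forall y, U1 y -> F (x ** p) y = 0.
  move=> Ux h1 hp ha hpa y Uy; have Uxp : U1 (x ** p) by apply: U1M.
  pose G y := U1 y /\ F (x ** p) y = 0; have lG : lin_closed G by apply: radr_lin.
  suff [] : G y by [].
  have GZ k z : G z -> G (k *: z) by apply: lin_closedZ.
  have G1 k l : G (k *: one + l *: p) by apply: lG; [|apply: GZ].
  have Ga k l : G ((k *: one + l *: p) ** a).
    rewrite mu_linl muZl mu1l; apply: lG; first by [].
    exact: GZ.
  have Gp z : G z -> G (z ** p).
    by case=> Uz Fz; split; [apply: U1M|rewrite -shift // -muA pp].
  apply: (@U1_split G) Uy => // [s Us|s t Us Ut].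
    by have [k [l ->]] := U0p s Us.
  have [k [l ->]] := U0p s Us; have [k' [l' ->]] := U0p t Ut.
  by rewrite mu_linr muZr mu1r; apply: lG; [apply: Ga|apply/GZ/Gp/Ga].
have U1cp : U1 (c *: p) by apply: lin_closedZ.
have Fppa : F p (p ** a) = 0.
  by rewrite -{1}[p]mu1l shift // pap; apply: F_antiL; rewrite ?FZ ?Fp1 ?scaler0.
have np1 : forall y, U1 y -> F p y = 0.
  have := test one U11; rewrite mu1l; apply => //; exact: F_alt.
have nap : forall y, U1 y -> F (a ** p) y = 0.
  apply: test => //.
  - by rewrite shift // mu1l.
  - by rewrite shift // pp.
  - apply/eqP; have e : F (a ** p) a = - F (a ** p) a by rewrite {1}shift // F_anti.
    have : 2 *: F (a ** p) a = 0 by rewrite scaler_nat mulr2n {1}e addNr.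
    by move=> /eqP; rewrite scaler_eq0 (negPf two0).
  - by rewrite shift // pap; apply: F_antiL; rewrite ?FZ ?Fpa ?scaler0.
have np : wedge_null p.
  move=> x y Ux Uy; suff [] : U1 x /\ F (x ** p) y = 0 by [].
  pose G x := U1 x /\ F (x ** p) y = 0.
  have lG : lin_closed G.
    move=> k u v [Uu hu] [Uv hv]; split; first exact: U1L.
    by rewrite mu_linl F_lin hu hv scaler0 addr0.
  have G1 : G one by split; rewrite ?mu1l //; apply: np1.
  have Gp : G p by split; rewrite ?pp //; apply: np1.
  have Ga : G a by split=> //; apply: nap.
  have Gpa : G (p ** a).
    by split; rewrite // pap FZ np1 // scaler0.
  have Gxp z : G z -> G (z ** p).
    by case=> Uz Fz; split; [apply: U1M|rewrite -muA pp].
  have GZ k z : G z -> G (k *: z) by apply: lin_closedZ.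
  apply: (@U1_split G) Ux => // [s Us|s t Us Ut].
    by have [k [l ->]] := U0p s Us; apply: lG => //; apply: GZ.
  have [k [l ->]] := U0p s Us; have [k' [l' ->]] := U0p t Ut.
  have Gsa : G ((k *: one + l *: p) ** a).
    by rewrite mu_linl muZl mu1l; apply: lG => //; apply: GZ.
  by rewrite mu_linr muZr mu1r; apply: lG => //; apply: GZ; apply: Gxp.
apply: wedge_vanish => // s Us; have [k [l ->]] := U0p s Us; exists k.
- have -> : k *: one + l *: p - k *: one = l *: p by rewrite addrC addKr.
  by apply: (lin_closedZ wedge_null_lin).
- have -> : k *: one + l *: p - k *: one = l *: p by rewrite addrC addKr.
  by apply: U0Z.
Qed.

End Wedge.

(** * Symmetric tensors of sandwiches *)

(** [sy] is the bracket of symmetric tensors and [B] the image. The level [U0] commutes with the last generator [d], and [U1] is the level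
    below, whose own last generator is [a]. *)
Section Step.
Variables (K : fieldType) (T S : pzAlgType K) (sy : T -> T -> S).
Hypothesis two0 : (2 : K) != 0.
Hypotheses (sy_lin : forall y, linear (sy^~ y)) (syC : forall x y, sy x y = sy y x)
  (syM : forall x y z w, sy x y * sy z w = sy (x * z) (y * w) + sy (x * w) (y * z)).
Variable B : submodule S.
Hypothesis BM : forall u v, B u -> B v -> B (u * v).

Local Notation s x := (sy x 1).

Let sy0 y : sy 0 y = 0.
Proof. by have := sy_lin y (-1) 0 0; rewrite !scaleN1r !addNr. Qed.
Let syZ k x y : sy (k *: x) y = k *: sy x y.
Proof. by rewrite -[k *: x]addr0 sy_lin sy0 addr0. Qed.
Let syZr k x y : sy y (k *: x) = k *: sy y x.
Proof. by rewrite syC syZ syC. Qed.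

Let Bcancel (k : K) u : k != 0 -> B (k *: u) -> B u.
Proof.
move=> k0 /(submodZ k^-1); rewrite scalerA mulVf // scale1r; exact.
Qed.

Let BB u v : B (u + v) -> B v -> B u.
Proof. by move=> h /(submodZ (-1)) /(submodD h); rewrite scaleN1r addrK. Qed.

(** Expanding [s a * s d * s a] gives [sy a d] together with multiples of [s a], [sy (a * d) a]
    and [sy (d * a) a]; the last two are halves of [sy a a * s d] and [s d * sy a a]. *)
Lemma sy_pair a d : B (s a) -> B (s d) -> B (sy a a) -> a * a = a ->
  forall c : K, a * d * a = c *: a -> B (sy a d).
Proof.
move=> Ba Bd Baa aa c ada.
have h1 : B (sy (a * d) a).
  apply: (Bcancel two0); have := BM Baa Bd; rewrite syM !mulr1 [sy a (a * d)]syC.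
  by rewrite -mulr2n -scaler_nat.
have h2 : B (sy (d * a) a).
  apply: (Bcancel two0); have := BM Bd Baa; rewrite syM !mul1r.
  by rewrite -mulr2n -scaler_nat.
have := BM (BM Ba Bd) Ba; rewrite syM mulrDl !syM !(mul1r, mulr1) ada aa syZ.
rewrite [sy a (d * a)]syC => h.
have h3 : B (c *: s a + sy (a * d) a) by apply: submodD => //; apply: submodZ.
have {h} h : B (sy a d + sy (d * a) a) by apply: BB h3; rewrite addrC.
exact: BB h h2.
Qed.

Variables (U0 U1 : T -> Prop) (a d : T) (c : K).
Hypotheses (U0_1 : U0 1) (U0M : forall x y, U0 x -> U0 y -> U0 (x * y))
  (U0Z : forall k x, U0 x -> U0 (k *: x)) (U01 : forall x, U0 x -> U1 x)
  (U1M : forall x y, U1 x -> U1 y -> U1 (x * y)) (U1L : lin_closed U1).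
Hypotheses (U0d : forall x, U0 x -> x * d = d * x).
Hypotheses (BU1 : forall x y, U1 x -> U1 y -> B (sy x y)) (Bdd : B (sy d d)).

Let F (x y z w : T) : lquot B := lpi B (sy (x * d * z) (y * d * w)).

Let piL k u v : lpi B (k *: u + v) = k *: lpi B u + lpi B v.
Proof. by rewrite lpiD lpiZ. Qed.

Let F_sym x y z w : F x y z w = F y x w z.
Proof. by rewrite /F syC. Qed.

Let F_lin k x x' y z w : F (k *: x + x') y z w = k *: F x y z w + F x' y z w.
Proof. by rewrite /F !mulrDl !scale_mull sy_lin piL. Qed.

Let F_linr k x y z z' w : F x y (k *: z + z') w = k *: F x y z w + F x y z' w.
Proof. by rewrite /F mulrDr scale_mulr sy_lin piL. Qed.

(* [sy x y * sy d d * sy z w] is twice the sum over the two ways of pairing [x], [y] with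
   [z], [w]. *)
Let F_antir x y z w : U1 x -> U1 y -> U1 z -> U1 w -> F x y z w = - F x y w z.
Proof.
move=> Ux Uy Uz Uw; apply/eqP; rewrite -addr_eq0 -lpiD; apply/eqP/lpi_eq0.
rewrite -syM; apply: BM; last exact: BU1.
apply: (Bcancel two0); have := BM (BU1 Ux Uy) Bdd.
by rewrite syM -mulr2n -scaler_nat.
Qed.

Let F_antil x y z w : U1 x -> U1 y -> U1 z -> U1 w -> F x y z w = - F y x z w.
Proof. by move=> *; rewrite F_sym F_antir. Qed.

Let F_through t x y z w : U0 t -> F (x * t) y z w = F x y (t * z) w.
Proof. by move=> Ut; rewrite /F -[x * t * d]mulrA (U0d Ut) !mulrA. Qed.

Let F_through2 t x y z w : U0 t -> F x (y * t) z w = F x y z (t * w).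
Proof. by move=> Ut; rewrite F_sym F_through // F_sym. Qed.

(* Through [d] to the right slots, across by alternation, and back through [d]. *)
Let F_shiftl t x y z w : U0 t -> U1 x -> U1 y -> U1 z -> U1 w ->
  F (x * t) y z w = F x (y * t) z w.
Proof.
move=> Ut Ux Uy Uz Uw; have U1t := U01 Ut.
have Utz := U1M U1t Uz; have Uyt := U1M Uy U1t.
by rewrite F_through // (F_antir Ux Uy Utz Uw) -F_through2 // (F_antir Ux Uyt Uw Uz) opprK.
Qed.

Let F_shiftr t x y z w : U0 t -> U1 x -> U1 y -> U1 z -> U1 w ->
  F x y (t * z) w = F x y z (t * w).
Proof. by move=> Ut Ux Uy Uz Uw; rewrite -F_through // F_shiftl // F_through2. Qed.

Let F_mull p q x y z w : U1 p -> U1 q -> F x y z w = 0 ->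
  F (p * x) (q * y) z w + F (q * x) (p * y) z w = 0.
Proof.
move=> Up Uq /lpi_eq0 h; rewrite -lpiD; apply/lpi_eq0.
by have := BM (BU1 Up Uq) h; rewrite syM !mulrA [sy (p * y * d * w) _]syC.
Qed.

Let F_mulr p q x y z w : U1 p -> U1 q -> F x y z w = 0 ->
  F x y (z * p) (w * q) + F x y (z * q) (w * p) = 0.
Proof.
move=> Up Uq /lpi_eq0 h; rewrite -lpiD; apply/lpi_eq0.
by have := BM h (BU1 Up Uq); rewrite syM !mulrA.
Qed.

Lemma bracket_base : (forall x, U1 x -> exists k : K, x = k *: (1 : T)) ->
  forall x y z w, U1 x -> U1 y -> U1 z -> U1 w -> B (sy (x * d * z) (y * d * w)).
Proof.
move=> U1K x y z w Ux Uy Uz Uw.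
have [k ->] := U1K _ Ux; have [l ->] := U1K _ Uy.
have [k' ->] := U1K _ Uz; have [l' ->] := U1K _ Uw.
rewrite !scale_mull !mul1r !scale_mulr !mulr1 !syZ !syZr.
by do 4!apply: submodZ.
Qed.

Hypotheses (U1a : U1 a) (aa : a * a = a) (ada : a * d * a = c *: a)
  (Bd : B (s d)) (c0 : c != 0).
Hypothesis U1_split : forall P : T -> Prop, lin_closed P -> (forall x, U0 x -> P x) ->
  (forall x y, U0 x -> U0 y -> P (x * a * y)) -> forall x, U1 x -> P x.

Let U11 : U1 1. Proof. exact: U01. Qed.

Let Bad : B (sy a d).
Proof. by apply: sy_pair ada => //; apply: BU1. Qed.

Let Fa1a1 : F a 1 a 1 = 0.
Proof. by apply/lpi_eq0; rewrite ada mul1r mulr1 syZ; apply: submodZ; exact: Bad. Qed.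

Let bracket_of_F : (forall x y z w, U1 x -> U1 y -> U1 z -> U1 w -> F x y z w = 0) ->
  forall x y z w, U1 x -> U1 y -> U1 z -> U1 w -> B (sy (x * d * z) (y * d * w)).
Proof. by move=> h x y z w Ux Uy Uz Uw; apply/lpi_eq0; apply: h. Qed.

Let mulopA (x y z : T) : z * y * x = z * (y * x). Proof. by rewrite mulrA. Qed.
Let mul_linl k (x y z : T) : (k *: x + y) * z = k *: (x * z) + y * z.
Proof. by rewrite mulrDl scale_mull. Qed.
Let mul_linr k (x y z : T) : z * (k *: x + y) = k *: (z * x) + z * y.
Proof. by rewrite mulrDr scale_mulr. Qed.

Let U1_split_op P : lin_closed P -> (forall x, U0 x -> P x) ->
  (forall x y, U0 x -> U0 y -> P (y * (a * x))) -> forall x, U1 x -> P x.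
Proof.
by move=> lP P0 Pa; apply: U1_split => // x y Ux Uy; rewrite -mulrA; apply: Pa.
Qed.

(* The results on alternating forms, for the two left slots and, with the opposite product, for the
   two right slots. *)
Let left_vanish := fun z w Uz Uw => @wedge_vanish K T (lquot B) two0 (fun x y => x * y) 1
  (@mul1r T) (@mulr1 T) mul_linl mul_linr U0 U1 a U0_1 U01 U1a U1M U1L U1_split
  (fun x y => F x y z w) (fun k x x' y => F_lin k x x' y z w)
  (fun x y Ux Uy => F_antil Ux Uy Uz Uw)
  (fun p q x y Up Uq Ux Uy => @F_mull p q x y z w Up Uq).

Let right_vanish := fun x y Ux Uy => @wedge_vanish K T (lquot B) two0 (fun x y => y * x) 1
  (@mulr1 T) (@mul1r T) mul_linr mul_linl U0 U1 a U0_1 U01 U1a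
  (fun x y Ux Uy => U1M Uy Ux) U1L U1_split_op
  (F x y) (fun k z z' w => F_linr k x y z z' w)
  (fun z w Uz Uw => F_antir Ux Uy Uz Uw)
  (fun p q z w Up Uq Uz Uw => @F_mulr p q x y z w Up Uq).

Let left_vanish2 := fun z w Uz Uw => @wedge_vanish2 K T (lquot B) two0 (fun x y => x * y) 1
  (@mulrA T) (@mul1r T) (@mulr1 T) mul_linl mul_linr U0 U1 a U0_1 U0Z U01 U1a U1M U1L U1_split
  (fun x y => F x y z w) (fun k x x' y => F_lin k x x' y z w)
  (fun x y Ux Uy => F_antil Ux Uy Uz Uw)
  (fun x y t Ux Uy Ut => F_shiftl Ut Ux Uy Uz Uw)
  (fun p q x y Up Uq Ux Uy => @F_mull p q x y z w Up Uq).

Let right_vanish2 := fun x y Ux Uy => @wedge_vanish2 K T (lquot B) two0 (fun x y => y * x) 1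
  mulopA (@mulr1 T) (@mul1r T) mul_linr mul_linl U0 U1 a U0_1 U0Z U01 U1a
  (fun x y Ux Uy => U1M Uy Ux) U1L U1_split_op
  (F x y) (fun k z z' w => F_linr k x y z z' w)
  (fun z w Uz Uw => F_antir Ux Uy Uz Uw)
  (fun z w t Uz Uw Ut => F_shiftr Ut Ux Uy Uz Uw)
  (fun p q z w Up Uq Uz Uw => @F_mulr p q x y z w Up Uq).

Definition left_null t := forall y z w v, U1 y -> U1 z -> U1 w -> U1 v -> F (y * t) z w v = 0.
Definition right_null t := forall y z w v, U1 y -> U1 z -> U1 w -> U1 v -> F y z (t * w) v = 0.

(** [wedge_vanish] in the right slots and then in the left slots reduces [F] to [F a 1 a 1], which is
    [c] times the class of [sy a d]. *)
Lemma bracket_step :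
  (forall x, U0 x -> exists2 k : K, U0 (x - k *: (1 : T)) &
    left_null (x - k *: (1 : T)) /\ right_null (x - k *: (1 : T))) ->
  forall x y z w, U1 x -> U1 y -> U1 z -> U1 w -> B (sy (x * d * z) (y * d * w)).
Proof.
move=> U0null; apply: bracket_of_F.
have right1 x y : U1 x -> U1 y -> F x y a 1 = 0 ->
    forall z w, U1 z -> U1 w -> F x y z w = 0.
  move=> Ux Uy h z w Uz Uw; apply: (right_vanish Ux Uy _ h Uz Uw).
  by move=> t /U0null [k U0k [_ nk]]; exists k => // u v Uu Uv; apply: nk.
move=> x y z w Ux Uy Uz Uw; apply: (left_vanish Uz Uw _ _ Ux Uy).
  by move=> t /U0null [k U0k [nk _]]; exists k => // u v Uu Uv; apply: nk.
exact: right1 Fa1a1 _ _ Uz Uw.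
Qed.

Lemma null_neighbour s t : U0 s -> U0 t -> c != 1 -> s * s = s -> t * t = t ->
  s * t * s = c *: s -> t * s * t = c *: t -> left_null t /\ right_null t.
Proof.
move=> Us Ut c1 ss tt sts tst; split=> y z w v Uy Uz Uw Uv.
- exact: (@wedge_null_neighbour K T (lquot B) (fun x y => x * y) (@mulrA T) mul_linr U0 U1
    U0M U01 U1M (fun x y => F x y w v) (fun k x x' y => F_lin k x x' y w v)
    (fun x y t Ux Uy Ut => F_shiftl Ut Ux Uy Uw Uv) c s t Us Ut c0 c1 ss tt sts tst y z).
- apply: (@wedge_null_neighbour K T (lquot B) (fun x y => y * x) mulopA mul_linl U0 U1
    (fun x y Ux Uy => U0M Uy Ux) U01 (fun x y Ux Uy => U1M Uy Ux)
    (F y z) (fun k x x' w => F_linr k y z x x' w)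
    (fun x w t Ux Uw Ut => F_shiftr Ut Uy Uz Ux Uw) c s t Us Ut c0 c1 ss tt _ _ w v) => //.
  + by rewrite mulrA.
  + by rewrite mulrA.
Qed.

Lemma null_mulr s t : U0 s -> U0 t -> left_null s /\ right_null s ->
  left_null (s * t) /\ right_null (s * t).
Proof.
move=> Us Ut [ls rs]; have U1s := U01 Us; have U1t := U01 Ut.
split=> y z w v Uy Uz Uw Uv.
- by rewrite mulrA F_shiftl //; [apply: ls => //; exact: U1M|exact: U1M].
- by rewrite -mulrA; apply: rs => //; exact: U1M.
Qed.

Lemma null0 : left_null 0 /\ right_null 0.
Proof.
by split=> y z w v Uy Uz Uw Uv; rewrite /F ?mulr0 ?mul0r ?mulr0 sy0 lpi0.
Qed.

Lemma null_lin : lin_closed (fun t => left_null t /\ right_null t).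
Proof.
move=> k s t [ls rs] [lt rt]; split=> y z w v Uy Uz Uw Uv.
- by rewrite mul_linr F_lin ls // lt // scaler0 addr0.
- by rewrite mul_linl F_linr rs // rt // scaler0 addr0.
Qed.

(** Here [F a 1 a p], [F a p a p] and [F a p a 1] remain; all three are [c] times the class [X] of
    [sy (p * d) a]. Expanding [sy p a * s d * sy p a] gives [X] and two terms which are [- c] times
    [X] by the alternation, up to elements of [B]; so [X] vanishes unless [2 * c = 1]. *)
Lemma bracket_step2 p : U0 p -> p * p = p -> p * a * p = c *: p -> a * p * a = c *: a ->
  (forall x, U0 x -> exists k l : K, x = k *: (1 : T) + l *: p) -> 1 - 2 * c != 0 ->
  forall x y z w, U1 x -> U1 y -> U1 z -> U1 w -> B (sy (x * d * z) (y * d * w)).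
Proof.
move=> Up pp pap apa U0p c2; apply: bracket_of_F; have U1p := U01 Up.
have U1pa : U1 (p * a) by apply: U1M.
have U1ap : U1 (a * p) by apply: U1M.
have pd := U0d Up.
set f := F a p a 1.
have fE : f = c *: lpi B (sy (p * d) a).
  by rewrite /f /F ada mulr1 syZ lpiZ syC.
have F1 : F a 1 a p = f by rewrite /f -{2}[p]mul1r F_through2 // mulr1.
have F2 : F a p a p = f by rewrite -{2}[p]mulr1 -F_through2 // pp.
have Z1 k x y z w : F (k *: x) y z w = k *: F x y z w.
  by rewrite /F !scale_mull syZ lpiZ.
have Z4 k x y z w : F x y z (k *: w) = k *: F x y z w.
  by rewrite /F scale_mulr syZr lpiZ.
set X := lpi B (sy (p * d) a) in fE.
have t1 : lpi B (sy (p * d * a) (a * p)) = - f.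
  apply: (scalerI c0); rewrite -lpiZ -syZr -scale_mull -ada scalerN.
  rewrite -[a * d * a * p]mulrA -/(F p a a (a * p)) F_antil //.
  by rewrite -[p in F a p]mul1r F_through2 // mulrA pap Z4 F1.
have t2 : lpi B (sy (p * a) (a * d * p)) = - f.
  apply: (scalerI c0); rewrite -lpiZ -syZ -scale_mulr -ada scalerN !mulrA.
  rewrite -/(F (p * a) a a p) -[p in F _ _ _ p]mulr1 -F_through2 //.
  by rewrite -F_shiftl // pap Z1 F_antil // scalerN.
have Z : X + lpi B (sy (p * d * a) (a * p)) + lpi B (sy (p * a) (a * d * p)) = 0.
  rewrite -!lpiD; apply/lpi_eq0.
  have h := BM (BM (BU1 U1p U1a) Bd) (BU1 U1p U1a); move: h.
  rewrite syM !mulr1 mulrDl !syM ada pp aa -[p * d * p]mulrA -pd mulrA pp syZr => h.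
  have hpa : B (c *: sy p a) by apply: submodZ; apply: BU1.
  by apply: (BB _ hpa); rewrite -addrA [_ + c *: _]addrC.
have f0 : f = 0.
  move: Z; rewrite t1 t2 -addrA -opprD -mulr2n -scaler_nat fE scalerA.
  rewrite -[X in X - _]scale1r -scalerBl => /eqP.
  by rewrite scaler_eq0 (negPf c2) => /eqP ->; rewrite scaler0.
have right1 x y : U1 x -> U1 y -> F x y a 1 = 0 -> F x y a p = 0 ->
    forall z w, U1 z -> U1 w -> F x y z w = 0.
  move=> Ux Uy h1 hp z w Uz Uw.
  exact: (right_vanish2 Ux Uy Up pp (etrans (mulrA _ _ _) pap) U0p h1 hp Uz Uw).
move=> x y z w Ux Uy Uz Uw; apply: (left_vanish2 Uz Uw Up pp pap U0p _ _ Ux Uy).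
- by apply: right1 => //; rewrite ?F1.
- by apply: right1 => //; rewrite ?F2.
Qed.

End Step.

(** * Surjectivity onto the symmetric square *)

Section Bracket.
Variables (K : fieldType) (A : pzAlgType K).

Definition bracket (a b : A) : tensor A A := tens a b + tens b a.

Lemma bracket_lin b : linear (bracket^~ b).
Proof.
move=> k u v; rewrite /bracket tens_linl tens_linr.
by rewrite scalerDr addrACA.
Qed.

Lemma bracketC a b : bracket a b = bracket b a.
Proof. exact: addrC. Qed.

Lemma bracketM x y z w :
  bracket x y * bracket z w = bracket (x * z) (y * w) + bracket (x * w) (y * z).
Proof.
rewrite /bracket mulrDl !mulrDr !tensM.
move: (tens _ _) (tens _ _) (tens _ _) (tens _ _) => a b c e.
by rewrite [b + a]addrC addrACA.
Qed.

End Bracket.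

Section Image.
Variables (K : fieldType) (q : K).
Local Notation d := (q + q^-1).
Local Notation c := ((d ^+ 2)^-1).
Local Notation r := (q ^+ 3).
Hypotheses (q0 : q != 0) (z0 : q * q - 1 != 0) (d0 : q * q + 1 != 0).
Local Notation inc := (@TL_incl K q _).
Local Notation minc := (TL_incl_morphism q _).
Local Notation mrep m := (bmw_rep_morphism q0 z0 d0 m).

Let x0 : d != 0.
Proof. by apply: contraNneq d0 => e; rewrite -(mulr0 q) -e mulrDr mulfV. Qed.

Let c0 : c != 0.
Proof. by rewrite invr_eq0 expf_neq0. Qed.

Definition bmw_rep_image_pred m : pred (TL2 q m) :=
  fun v => `[< exists b : BMW r q m, bmw_rep b = v >].

Lemma bmw_rep_image_closed m : GRing.submod_closed (@bmw_rep_image_pred m).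
Proof.
split; first by apply/asboolP; exists 0; rewrite (am0 (mrep m)).
move=> k u v /asboolP [a <-] /asboolP [b <-]; apply/asboolP; exists (k *: a + b).
by rewrite (mrep m).1.
Qed.

Definition bmw_rep_image m : submodule (TL2 q m) := Submodule (@bmw_rep_image_closed m).
Local Notation B := (bmw_rep_image _).

Lemma bmw_rep_imageP m v : bmw_rep_image m v <-> exists b : BMW r q m, bmw_rep b = v.
Proof. by split=> [/asboolP|h] //; apply/asboolP. Qed.

Lemma bmw_rep_imageM m u v : bmw_rep_image m u -> bmw_rep_image m v -> bmw_rep_image m (u * v).
Proof.
move=> /bmw_rep_imageP [a <-] /bmw_rep_imageP [b <-]; apply/bmw_rep_imageP; exists (a * b).
by rewrite (amM (mrep m)).
Qed.

Lemma bmw_rep_image1 m : bmw_rep_image m 1.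
Proof. by apply/bmw_rep_imageP; exists 1; rewrite (am1 (mrep m)). Qed.

Lemma bmw_rep_image_ee m (i : 'I_m.-1) : bmw_rep_image m (tens (TL_e q i) (TL_e q i)).
Proof.
apply/bmw_rep_imageP; exists (c *: BMW_E r q i); rewrite (amZ (mrep m)) (bmw_rep_E q0 z0 d0) scalerA.
by rewrite mulVf ?scale1r ?expf_neq0.
Qed.

Lemma bmw_rep_image_bracket_ee m (i : 'I_m.-1) : bmw_rep_image m (bracket (TL_e q i) (TL_e q i)).
Proof. by apply: submodD; apply: bmw_rep_image_ee. Qed.

(** The bracket is the linear part of the expansion of [tensG] in tensors of [e] and [1]. *)
Lemma bmw_rep_image_e m (i : 'I_m.-1) : bmw_rep_image m (bracket (TL_e q i) 1).
Proof.
set e := TL_e q i; pose g := 1 + q ^- 2.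
have g0 : g != 0.
  have -> : g = q^-1 * d by rewrite /g mulrDr mulVf // -expr2 exprVn.
  by rewrite mulf_neq0 ?invr_eq0.
have -> : bracket e 1 = g^-1 *: (1 + g ^+ 2 *: tens e e - q^-1 *: tensG q e).
  rewrite /tensG /hecke !tensE -[1 in RHS]/(tens 1 1) /bracket -/g.
  by coefficients K [:: tens e 1; tens 1 e; tens e e; tens 1 1]; field; rewrite ?g0 ?q0.
apply: submodZ; rewrite -scaleNr; apply: submodD; last first.
  by apply: submodZ; apply/bmw_rep_imageP; exists (BMW_G r q i); rewrite (bmw_rep_G q0 z0 d0).
by apply: submodD; [exact: bmw_rep_image1|apply: submodZ; exact: bmw_rep_image_ee].
Qed.

Lemma bmw_rep_image_incl m (x y : TL q m) : bmw_rep_image m (bracket x y) ->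
  bmw_rep_image m.+1 (bracket (inc x) (inc y)).
Proof.
move=> /bmw_rep_imageP [b e]; apply/bmw_rep_imageP; exists (BMW_incl b).
rewrite (bmw_rep_incl q0 z0 d0) e /bracket (amD (tens_map_morphism minc)).
by rewrite !(tens_mapE minc).
Qed.

Lemma bracketZ m k (x y : TL q m) : bracket (k *: x) y = k *: bracket x y.
Proof. by rewrite /bracket tensZl tensZr -scalerDr. Qed.

Lemma bracketD m (x y z : TL q m) : bracket (x + y) z = bracket x z + bracket y z.
Proof. by have := bracket_lin z 1 x y; rewrite !scale1r. Qed.

(** The ideal of the last generator and the scalars span the algebra. The brackets with [1] are
    reached by induction on words, since the product of the brackets of [e_i] and of [u] with [1]
    is the bracket of [e_i u] with [1] plus that of [e_i] with [u], and [e_i] is in the ideal. *)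
Lemma bracket_of_ideal m :
  (forall x y, TL_ideal q m x -> TL_ideal q m y -> bmw_rep_image m.+2 (bracket x y)) ->
  forall x y, bmw_rep_image m.+2 (bracket x y).
Proof.
move=> BI; have Ie i := @TL_ideal_e K q m i c0.
have I_mod x : exists2 k : K, TL_ideal q m (x - k *: (1 : TL q m.+2)) & bmw_rep_image m.+2 (bracket x 1).
  apply: (TL_ind (P := fun x => exists2 k : K, TL_ideal q m (x - k *: (1 : TL q m.+2))
    & bmw_rep_image m.+2 (bracket x 1))).
  - move=> k u v [k1 I1 B1] [k2 I2 B2]; exists (k * k1 + k2).
      have -> : k *: u + v - (k * k1 + k2) *: (1 : TL q m.+2)
          = k *: (u - k1 *: (1 : TL q m.+2)) + (v - k2 *: (1 : TL q m.+2)).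
        by coefficients K [:: u; v; 1]; ring.
      exact: submod_lin.
    by rewrite bracket_lin; apply: submod_lin.
  - exists 1; first by rewrite scale1r subrr; apply: submod0.
    by apply: submodD; apply: bmw_rep_image1.
  move=> i u [k Iu Bu].
  have Ieu : TL_ideal q m (TL_e q i * (u - k *: (1 : TL q m.+2))) by apply: TL_idealM.
  exists 0.
    rewrite scale0r subr0 -[u](subrK (k *: (1 : TL q m.+2))) mulrDr scale_mulr mulr1.
    by apply: submodD => //; apply: submodZ.
  have Beu : bmw_rep_image m.+2 (bracket (TL_e q i) u).
    rewrite bracketC -[u](subrK (k *: (1 : TL q m.+2))) bracketD bracketZ [bracket 1 _]bracketC.
    by apply: submodD; [apply: BI|apply: submodZ; apply: bmw_rep_image_e].
  have := bmw_rep_imageM (bmw_rep_image_e i) Bu; rewrite bracketM !mulr1 mul1r => h.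
  by have := submodD h (submodZ (-1) Beu); rewrite scaleN1r addrK.
move=> x y; have [k Ix Bx] := I_mod x; have [l Iy By] := I_mod y.
rewrite -[x](subrK (k *: (1 : TL q m.+2))) bracketD bracketZ [bracket 1 y]bracketC.
apply: submodD; last exact: submodZ.
rewrite bracketC -[y](subrK (l *: (1 : TL q m.+2))) bracketD bracketZ [bracket 1 _]bracketC.
apply: submodD; first exact: BI.
apply: submodZ; rewrite bracketD -scaleNr bracketZ; apply: submodD => //.
by apply: submodZ; apply: submodD; apply: bmw_rep_image1.
Qed.

Lemma bracket_small m (x y : TL q m) : (m <= 1)%N -> bmw_rep_image m (bracket x y).
Proof.
move=> m1; have [k ->] := TL_small x m1; have [l ->] := TL_small y m1.
rewrite bracketZ bracketC bracketZ; do 2!apply: submodZ.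
by apply: submodD; apply: bmw_rep_image1.
Qed.

Definition level1 m (x : TL q m.+2) : Prop := exists y : TL q m.+1, x = inc y.
Definition level0 m (x : TL q m.+2) : Prop := exists y : TL q m, x = inc (inc y).

Section Levels.
Variable m : nat.
Local Notation U1 := (@level1 m).
Local Notation U0 := (@level0 m).
Lemma level0_1 : U0 1. Proof. by exists 1; rewrite !(am1 minc). Qed.
Lemma level0M x y : U0 x -> U0 y -> U0 (x * y).
Proof. by move=> [u ->] [v ->]; exists (u * v); rewrite !(amM minc). Qed.
Lemma level0Z k x : U0 x -> U0 (k *: x).
Proof. by move=> [u ->]; exists (k *: u); rewrite !(amZ minc). Qed.
Lemma level0L : lin_closed U0.
Proof.
move=> k x y [u ->] [v ->]; exists (k *: u + v).
by rewrite !(amD minc) !(amZ minc).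
Qed.
Lemma level01 x : U0 x -> U1 x.
Proof. by move=> [u ->]; exists (inc u). Qed.
Lemma level1M x y : U1 x -> U1 y -> U1 (x * y).
Proof. by move=> [u ->] [v ->]; exists (u * v); rewrite !(amM minc). Qed.
Lemma level1L : lin_closed U1.
Proof.
move=> k x y [u ->] [v ->]; exists (k *: u + v).
by rewrite (amD minc) (amZ minc).
Qed.
Lemma level0_comm x : U0 x -> x * TL_last q m = TL_last q m * x.
Proof. by move=> [u ->]; rewrite TL_last_comm. Qed.
End Levels.

Lemma level1_split m (P : TL q m.+3 -> Prop) : lin_closed P ->
  (forall x, level0 x -> P x) ->
  (forall x y, level0 x -> level0 y -> P (x * inc (TL_last q m) * y)) ->
  forall x, level1 x -> P x.
Proof.
move=> lP P0 Pa _ [y ->]; apply: (TL_split (P := fun y => P (inc y))).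
- by move=> k u v Pu Pv; rewrite (amD minc) (amZ minc); apply: lP.
- by move=> u; apply: P0; exists u.
- by move=> u v; rewrite !(amM minc); apply: Pa; [exists u|exists v].
Qed.

End Image.

Section ImageInduction.
Variables (K : fieldType) (q : K).
Local Notation d := (q + q^-1).
Local Notation c := ((d ^+ 2)^-1).
Hypotheses (two0 : (2 : K) != 0) (q0 : q != 0) (z0 : q * q - 1 != 0) (d0 : q * q + 1 != 0).
Hypotheses (c1 : c != 1) (c2 : 1 - 2 * c != 0).
Local Notation inc := (@TL_incl K q _).
Local Notation minc := (TL_incl_morphism q _).

Let x0 : d != 0.
Proof. by apply: contraNneq d0 => e; rewrite -(mulr0 q) -e mulrDr mulfV. Qed.

Let c0 : c != 0.
Proof. by rewrite invr_eq0 expf_neq0. Qed.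

Local Notation img := (bmw_rep_image q0 z0 d0).

Section Step.
Variable m : nat.
Hypothesis IH : forall x y : TL q m.+1, img m.+1 (bracket x y).
Local Notation T := (TL q m.+2).
Local Notation e := (TL_last q m).
Local Notation B := (img m.+2).

Lemma bracket_level1 (x y : T) : level1 x -> level1 y -> B (bracket x y).
Proof. by move=> [u ->] [v ->]; apply: bmw_rep_image_incl; apply: IH. Qed.

Hypothesis BF : forall x y z w, level1 x -> level1 y -> level1 z -> level1 w ->
  B (bracket (x * e * z) (y * e * w)).

Lemma bracket_of_sandwich (x y : T) : B (bracket x y).
Proof.
move: x y; apply: bracket_of_ideal => x y Ix Iy.
apply: (span_ind (P := fun x => B (bracket x y)) _ _ _ Ix).
- by move=> k u v hu hv; rewrite bracket_lin; apply: submod_lin.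
- by rewrite -(scale0r (0 : T)) bracketZ scale0r; apply: submod0.
move=> _ [a [_ [b [-> ->]]]].
apply: (span_ind (P := fun y => B (bracket (inc a * e * inc b) y)) _ _ _ Iy).
- by move=> k u v hu hv; rewrite bracketC bracket_lin ![bracket _ (_ * inc b)]bracketC; apply: submod_lin.
- by rewrite -(scale0r (0 : T)) bracketC bracketZ scale0r; apply: submod0.
move=> _ [a' [_ [b' [-> ->]]]].
by apply: BF; [exists a|exists a'|exists b|exists b'].
Qed.
End Step.


Let BLin m := @bracket_lin K (TL q m).
Let BC m := (@bracketC K (TL q m)).
Let BM m := (@bracketM K (TL q m)).
Let BB m := (@bmw_rep_imageM K q q0 z0 d0 m).
Let Bdd m : img m.+2 (bracket (TL_last q m) (TL_last q m)) :=
  @bmw_rep_image_bracket_ee K q q0 z0 d0 m.+2 ord_max.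

Section Instances.
Variable m : nat.
Hypothesis IH : forall x y : TL q m.+2, img m.+2 (bracket x y).
Local Notation T := (TL q m.+3).
Local Notation a := (inc (TL_last q m) : T).
Local Notation e := (TL_last q m.+1).

Let Ua : level1 a. Proof. by exists (TL_last q m). Qed.
Let aa : a * a = a. Proof. by rewrite -(amM minc) TL_last_idem. Qed.
Let Be : img m.+3 (bracket e 1) := @bmw_rep_image_e K q q0 z0 d0 m.+3 ord_max.

(* The general steps for [U0], [U1] the two levels below, [a], [d] the last two generators and [B] the
   image. *)
Definition image_step :=
  @bracket_step K T (TL2 q m.+3) (@bracket K T) two0 (@BLin _) (@BC _) (@BM _) (img m.+3)
    (@BB _) (@level0 K q m.+1) (@level1 K q m.+1) a e c (level0_1 q m.+1) (@level01 K q m.+1)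
    (@level1M K q m.+1) (@level1L K q m.+1) (bracket_level1 IH) (Bdd m.+1) Ua aa
    (TL_last_eee' q m) Be (@level1_split K q m).

Definition image_step2 :=
  @bracket_step2 K T (TL2 q m.+3) (@bracket K T) two0 (@BLin _) (@BC _) (@BM _) (img m.+3)
    (@BB _) (@level0 K q m.+1) (@level1 K q m.+1) a e c (level0_1 q m.+1) (@level0Z K q m.+1)
    (@level01 K q m.+1)
    (@level1M K q m.+1) (@level1L K q m.+1) (@level0_comm K q m.+1) (bracket_level1 IH)
    (Bdd m.+1) Ua aa (TL_last_eee' q m) Be c0 (@level1_split K q m).

Definition image_neighbour :=
  @null_neighbour K T (TL2 q m.+3) (@bracket K T) two0 (@BLin _) (@BC _) (@BM _) (img m.+3)
    (@BB _) (@level0 K q m.+1) (@level1 K q m.+1) e c (@level0M K q m.+1) (@level01 K q m.+1)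
    (@level1M K q m.+1) (@level0_comm K q m.+1) (bracket_level1 IH) (Bdd m.+1) c0.

Definition image_null_mulr :=
  @null_mulr K T (TL2 q m.+3) (@bracket K T) two0 (@BC _) (@BM _) (img m.+3)
    (@BB _) (@level0 K q m.+1) (@level1 K q m.+1) e (@level01 K q m.+1)
    (@level1M K q m.+1) (@level0_comm K q m.+1) (bracket_level1 IH) (Bdd m.+1).

Definition image_null_lin := @null_lin K T (TL2 q m.+3) (@bracket K T) (@BLin _) (img m.+3) (@level1 K q m.+1) e.

End Instances.

(** Induction on the number of strands. Up to three strands the commuting level is scalar, on four
    it has one generator, and from five strands on each of its generators has a neighbour. *)
Theorem bmw_rep_image_bracket m (x y : TL q m) : img m (bracket x y).
Proof.
case: m x y => [|m] x y; first exact: bracket_small.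
elim: m x y => [|m IH] x y; first exact: bracket_small.
apply: bracket_of_sandwich => {x y} x y z w Ux Uy Uz Uw.
case: m IH x y z w Ux Uy Uz Uw => [|m] IH x y z w Ux Uy Uz Uw.
  apply: (@bracket_base K (TL q 2) (TL2 q 2) (@bracket K (TL q 2)) (@BLin 2) (@BC 2) (img 2)
    (@level1 K q 0) (TL_last q 0) (Bdd 0) _ x y z w Ux Uy Uz Uw).
  move=> _ [u ->]; have [k ->] := TL_small u isT; exists k.
  by rewrite (amZ minc) (am1 minc).
case: m IH x y z w Ux Uy Uz Uw => [|[|m]] IH x y z w Ux Uy Uz Uw.
- apply: (image_step IH _ Ux Uy Uz Uw).
  move=> _ [u ->]; have [k ->] := TL_small u isT; exists k; rewrite !(amZ minc) !(am1 minc) subrr.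
    by rewrite -(scale0r (1 : TL q 3)); apply: level0Z; apply: level0_1.
  exact: (@null0 K _ (TL2 q 3) (@bracket K _) (@BLin 3) (img 3)).
- apply: (image_step2 IH (p := inc (inc (TL_last q 0))) _ _ _ _ _ c2 Ux Uy Uz Uw).
  + by exists (TL_last q 0).
  + by rewrite -!(amM minc) TL_last_idem.
  + by rewrite -!(amM minc) TL_last_eee' !(amZ minc).
  + by rewrite -!(amM minc) TL_last_eee (amZ minc).
  + move=> _ [u ->]; suff [k [l ->]] : exists k l : K, u = k *: (1 : TL q 2) + l *: TL_last q 0.
      by exists k, l; rewrite !(amD minc) !(amZ minc) !(am1 minc).
    apply: (TL_last_ind (P := fun u => exists k l : K, u = k *: (1 : TL q 2) + l *: TL_last q 0)).
    * move=> k v v' [k1 [l1 ->]] [k2 [l2 ->]]; exists (k * k1 + k2), (k * l1 + l2).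
      by coefficients K [:: TL_last q 0; 1]; ring.
    * by exists 1, 0; rewrite scale1r scale0r addr0.
    * by case.
    * move=> v [k [l ->]]; exists 0, (k + l).
      rewrite mulrDr !scale_mulr mulr1 TL_last_idem.
      by coefficients K [:: TL_last q 0; 1]; ring.
apply: (image_step IH _ Ux Uy Uz Uw) => _ [u ->].
pose null t := left_null (@bracket K _) (img m.+4.+1) (@level1 K q m.+3) (TL_last q m.+3) t /\
  right_null (@bracket K _) (img m.+4.+1) (@level1 K q m.+3) (TL_last q m.+3) t.
have nl : lin_closed null by apply: image_null_lin.
have n0 : null 0 by exact: (@null0 K _ (TL2 q m.+4.+1) (@bracket K _) (@BLin m.+4.+1) (img m.+4.+1)).
have ee (k l : 'I_(m.+3).-1) : k = l.+1 :> nat \/ l = k.+1 :> nat ->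
    TL_e q k * TL_e q l * TL_e q k = c *: TL_e q k.
  by move=> kl; apply: TL_relP; apply: TL_rel_eee; case: kl; [right|left].
(* every generator of [TL q m.+3] has a neighbour *)
have null_e (i : 'I_(m.+3).-1) : null (inc (inc (TL_e q i))).
  have [j ij] : exists j : 'I_(m.+3).-1, i = j.+1 :> nat \/ j = i.+1 :> nat.
    case: i => [[|i] lt]; first by exists (Ordinal (isT : 1 < m.+2)%N); right.
    by exists (Ordinal (ltnW lt)); left.
  apply: (image_neighbour IH (s := inc (inc (TL_e q j)))) => //.
  + by exists (TL_e q j).
  + by exists (TL_e q i).
  + by rewrite -!(amM minc) TL_idem.
  + by rewrite -!(amM minc) TL_idem.
  + by rewrite -!(amM minc) ee ?(amZ minc) //; case: ij; [right|left].
  + by rewrite -!(amM minc) ee ?(amZ minc).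
suff [k nk] : exists k : K, null (inc (inc u) - k *: (1 : TL q m.+4.+1)).
  exists k => //; rewrite -scaleNr addrC; apply: level0L; first exact: level0_1.
  by exists u.
apply: (TL_ind (P := fun u => exists k : K, null (inc (inc u) - k *: (1 : TL q m.+4.+1)))).
- move=> k v v' [k1 n1] [k2 n2]; exists (k * k1 + k2).
  have -> : inc (inc (k *: v + v')) - (k * k1 + k2) *: (1 : TL q m.+4.+1)
     = k *: (inc (inc v) - k1 *: (1 : TL q m.+4.+1)) + (inc (inc v') - k2 *: (1 : TL q m.+4.+1)).
    rewrite !(amD minc) !(amZ minc).
    by coefficients K [:: inc (inc v); inc (inc v'); 1]; ring.
  exact: nl.
- by exists 1; rewrite !(am1 minc) scale1r subrr.
- move=> i v _; exists 0; rewrite scale0r subr0 !(amM minc).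
  by apply: (image_null_mulr IH); [exists (TL_e q i)|exists v|exact: null_e].
Qed.

End ImageInduction.

(** * The isomorphism *)

Lemma the_orP (T : Type) (x0 : T) (P : T -> Prop) : (exists x, P x) -> P (the_or x0 P).
Proof.
by move=> ex; rewrite /the_or; case: pselect => [h|//]; exact: (projT2 (cid h)).
Qed.

(** The radical of a product of two forms on an algebra without a given basis: the argument runs
    through the expressions of a tensor as a finite sum of pure tensors. *)
Section TensorRadical.
Variables (K : fieldType) (T A : pzAlgType K) (t : trace_form T) (p : T -> A).
Hypothesis mp : alg_morphism p.
Hypothesis radP : forall a, (forall b, t (a * b) = 0) -> p a = 0.

Let tens0r (a : A) : tens a (0 : A) = 0.
Proof. by rewrite -(scale0r (0 : A)) tensZr scale0r. Qed.

(** Induction on the number of terms: either the first [y] is in the radical and its term drops, or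
    the hypothesis expresses its [p x] by the others, and substituting removes the term. *)
Lemma tens_nondegenerate_seq (l : seq (T * T)) :
  (forall b, \sum_(u <- l) t (u.2 * b) *: p u.1 = 0) ->
  \sum_(u <- l) tens (p u.1) (p u.2) = 0.
Proof.
have [n] := ubnP (size l); elim: n l => // n IH [|[x y] l] /=; first by rewrite !big_nil.
rewrite ltnS => ln h.
have [y0|/existsNP [b /eqP tb]] := pselect (forall b, t (y * b) = 0).
  rewrite big_cons /= (radP y0) tens0r add0r; apply: IH => // b.
  by have := h b; rewrite big_cons /= y0 scale0r add0r.
pose k (z : T) := t (z * b) / t (y * b).
have px : p x = - \sum_(u <- l) k u.2 *: p u.1.
  have := h b; rewrite big_cons /= => /eqP; rewrite addr_eq0 => /eqP e.
  have -> : p x = (t (y * b))^-1 *: (t (y * b) *: p x) by rewrite scalerA mulVf ?scale1r.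
  rewrite e scalerN scaler_sumr; congr (- _); apply: eq_bigr => u _.
  by rewrite scalerA /k mulrC.
have := IH [seq (u.1, u.2 - k u.2 *: y) | u <- l]; rewrite size_map => /(_ ln).
rewrite big_map /= => e.
rewrite big_cons /= px -[RHS]e.
- rewrite -scaleN1r tensZl scaleN1r.
  rewrite (Defs.linear_sum l (fun u => k u.2) (fun u => p u.1) (tens_linl (p y))) -sumrN -big_split; apply: eq_bigr => u _ /=.
  by rewrite (amB mp) (amZ mp) tensDr tensNr tensZr addrC.
- move=> b'; rewrite big_map /=; have := h b'; rewrite big_cons /= px scalerN scaler_sumr -sumrN -big_split /= => e'.
  rewrite -[RHS]e'; apply: eq_bigr => u _ /=.
  by rewrite mulrBl trB scale_mull trZ scalerBl scalerA addrC [k _ * _]mulrC.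
Qed.

Lemma tens_nondegenerate (w : tensor T T) :
  (forall x y, tens_form t (w * tens x y) = 0) -> tens_map p w = 0.
Proof.
have lt := trace_linear t; have lf := tens_form_linear lt; have lm := (tens_map_morphism mp).1.
move=> h; pose l := [seq ((lrepr w)@_u *: u.1, u.2) | u <- msupp (lrepr w)].
have wE : w = \sum_(u <- l) tens u.1 u.2.
  by rewrite {1}[w]tens_sumE big_map; apply: eq_bigr => u _; rewrite tensZl.
have sumE (V : lmodType K) (f : tensor T T -> V) : linear f ->
    f w = \sum_(u <- l) f (tens u.1 u.2).
  move=> linf; have := Defs.linear_sum l (fun _ => 1) (fun u => tens u.1 u.2) linf.
  under eq_bigr do rewrite scale1r; rewrite -wE => ->.
  by apply: eq_bigr => u _; rewrite scale1r.
rewrite (sumE _ _ lm); under eq_bigr do rewrite (tens_mapE mp).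
apply: tens_nondegenerate_seq => b.
have -> : \sum_(u <- l) t (u.2 * b) *: p u.1 = p (\sum_(u <- l) t (u.2 * b) *: u.1).
  by rewrite (Defs.linear_sum l (fun u => t (u.2 * b)) (fun u => u.1) mp.1).
apply: radP => a; rewrite mulr_suml.
have lmul : linear ((fun w => tens_form t (w * tens a b)) : tensor T T -> K^o).
  by move=> k u v; rewrite mulrDl scale_mull lf.
have := h a b; rewrite (sumE _ _ lmul) => e.
rewrite -[LHS](_ : \sum_(u <- l) t (u.2 * b) * t (u.1 * a) = _).
  rewrite -[RHS]e; apply: eq_bigr => u _.
  by rewrite tensM (tens_formE lt) mulrC.
elim: l {wE sumE e} => [|u l IH]; first by rewrite !big_nil tr0.
by rewrite !big_cons trD IH scale_mull trZ.
Qed.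
End TensorRadical.

Lemma scalar_sandwich_sym (K : fieldType) (S : pzAlgType K) (L : S -> K) (k : K)
    (a b b' u v : S) : scalar L ->
  L (a * u * b) = L (a * u * b') -> L (a * v * b) = L (a * v * b') ->
  L (a * (k *: u + v) * b) = L (a * (k *: u + v) * b').
Proof. by move=> lL hu hv; rewrite mulrDr !mulrDl scale_mulr !scale_mull !lL hu hv. Qed.

Lemma scalar0 (K : fieldType) (S : lmodType K) (L : S -> K) : scalar L -> L 0 = 0.
Proof. by move=> lL; have := lL (-1) 0 0; rewrite scaleN1r mulN1r !addNr. Qed.

Lemma scalarZ (K : fieldType) (S : lmodType K) (L : S -> K) (k : K) (u : S) :
  scalar L -> L (k *: u) = k * L u.
Proof.
by move=> lL; rewrite -[k *: u]addr0 lL scalar0 ?addr0.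
Qed.

Lemma scalar_word_sym (K : fieldType) (S : pzAlgType K) (L : S -> K) (k : K)
    (g h u w w' b b' : S) : scalar L -> g = k *: h -> w * h = w' ->
  L (w' * u * b) = L (w' * u * b') -> L (w * (g * u) * b) = L (w * (g * u) * b').
Proof.
move=> lL -> <- e; rewrite !scale_mull !scale_mulr !scale_mull !(scalarZ _ _ lL).
by rewrite !mulrA e.
Qed.

Lemma scalar_symmetrize (K : fieldType) (S : pzAlgType K) (L : S -> K) (w u v : S) :
  (2 : K) != 0 -> scalar L -> L (w * u) = L (w * v) -> L (w * (u + v)) = 0 -> L (w * u) = 0.
Proof.
move=> two0 lL e; rewrite mulrDr -[w * u]scale1r lL mul1r scale1r -e -mulr2n -mulr_natl.
by move/eqP; rewrite mulf_eq0 (negPf two0) => /eqP.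
Qed.

Section Quotient.
Variables (K : fieldType) (q : K).
Local Notation d := (q + q^-1).
Local Notation c := ((d ^+ 2)^-1).
Local Notation r := (q ^+ 3).
Hypotheses (two0 : (2 : K) != 0) (q0 : q != 0) (z0 : q * q - 1 != 0) (d0 : q * q + 1 != 0).
Hypotheses (c1 : c != 1) (c2 : 1 - 2 * c != 0).
Local Notation mrep m := (bmw_rep_morphism q0 z0 d0 m).

Lemma TL_trace_markov : TL_markov (TL_trace q).
Proof.
have x0 : d != 0 by apply: contraNneq d0 => e; rewrite -(mulr0 q) -e mulrDr mulfV.
by apply: the_orP; exists (spin_trace q0 x0); apply: spin_markov.
Qed.

Local Notation tr := (TL_trace q).
Local Notation tr2 := (tens_form (tr _)).

Lemma BMW_traceE m (a : BMW r q m) : BMW_trace r q m a = tr2 (bmw_rep a).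
Proof.
have mk := bmw_rep_markov q0 z0 d0 TL_trace_markov.
have z1 : q - q^-1 != 0.
  by apply: contraNneq z0 => zz; rewrite -(mulr0 q) -zz mulrBr mulfV.
apply: (BMW_markov_unique (expf_neq0 3 q0) z1 q0 _ mk); apply: the_orP.
by exists (bmw_rep_trace q0 z0 d0 tr).
Qed.

Variables (m : nat) (A : pzAlgType K) (p : TL q m -> A) (s : A -> TL q m).
Hypotheses (mp : alg_morphism p) (sK : forall x, p (s x) = x).
Hypothesis kerP : forall a, p a = 0 <-> forall b, tr m (a * b) = 0.

Let tb (x : A) : K := tr m (s x).

Let tbE a : tb (p a) = tr m a.
Proof.
apply/eqP; rewrite -subr_eq0 -trB.
have /kerP /(_ 1) : p (s (p a) - a) = 0 by rewrite (amB mp) sK subrr.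
by rewrite mulr1 => ->.
Qed.

Let tb_linear : scalar tb.
Proof. by move=> k x y; rewrite -[x]sK -[y]sK -mp.1 !tbE trD trZ. Qed.

Let tens_p := tens_map p.
Let mtp : alg_morphism tens_p := tens_map_morphism mp.

Let tr2E w : tr2 w = tens_form tb (tens_p w).
Proof.
symmetry; apply: (tens_form_ext (trace_linear (tr m)) (f := fun w => tens_form tb (tens_p w))).
- by move=> k x y; rewrite mtp.1 (tens_form_linear tb_linear).
- by move=> a b; rewrite /tens_p (tens_mapE mp) (tens_formE tb_linear) !tbE.
Qed.

Definition quot_rep (b : BMW r q m) : tensor A A := tens_p (bmw_rep b).

Lemma quot_rep_morphism : alg_morphism quot_rep.
Proof.
split; first by move=> k u v; rewrite /quot_rep (mrep m).1 mtp.1.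
split; first by rewrite /quot_rep (am1 (mrep m)) (am1 mtp).
by move=> u v; rewrite /quot_rep (amM (mrep m)) (amM mtp).
Qed.

(* Words go to multiples of squares, so images are symmetric tensors. The square [tens v v] in
   front carries the letters already read. *)
Let bmw_rep_symmetric (b : BMW r q m) (v x y : TL q m) :
  tr2 (tens v v * bmw_rep b * tens x y) = tr2 (tens v v * bmw_rep b * tens y x).
Proof.
have lt := tens_form_linear (trace_linear (tr m)).
have step g k (u : BMW r q m) (h : TL q m) : bmw_rep g = k *: tens h h ->
    (forall v x y, tr2 (tens v v * bmw_rep u * tens x y) = tr2 (tens v v * bmw_rep u * tens y x)) ->
    forall v x y, tr2 (tens v v * bmw_rep (g * u) * tens x y) = tr2 (tens v v * bmw_rep (g * u) * tens y x).
  move=> e hu v' x' y'; rewrite (amM (mrep m)).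
  exact: (scalar_word_sym lt e (tensM v' v' h h) (hu _ _ _)).
move: v x y; apply: (BMW_ind (P := fun b => forall v x y,
  tr2 (tens v v * bmw_rep b * tens x y) = tr2 (tens v v * bmw_rep b * tens y x))).
- move=> k u v hu hv w x y; rewrite (mrep m).1.
  exact: (scalar_sandwich_sym k lt (hu w x y) (hv w x y)).
- move=> v x y; rewrite (am1 (mrep m)) mulr1 !tensM !(tens_formE (trace_linear (tr m))).
  by rewrite mulrC.
- by move=> i u; apply: step; apply: (bmw_rep_G q0 z0 d0).
- by move=> i u; apply: step; apply: (bmw_rep_Gi q0 z0 d0).
Qed.

(** The trace form is tested against the image, which contains all brackets; as the image of [b] is
    symmetric, its trace against a pure tensor is half of that against a bracket. *)
Lemma quot_rep_radical b : radical (BMW_trace r q m) b <-> quot_rep b = 0.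
Proof.
split=> [/asboolP h|h]; last first.
  apply/asboolP => b'; rewrite BMW_traceE tr2E (amM (mrep m)) (amM mtp) -/(quot_rep b) h mul0r.
  exact: scalar0 (tens_form_linear tb_linear).
apply: (tens_nondegenerate (t := tr m) mp) => [a|x y]; first by move/kerP.
have h2 : tr2 (bmw_rep b * bracket x y) = 0.
  have /bmw_rep_imageP [b' e] := bmw_rep_image_bracket two0 q0 z0 d0 c1 c2 x y.
  by have := h b'; rewrite BMW_traceE (amM (mrep m)) e.
have sym := bmw_rep_symmetric b 1 x y.
rewrite [tens 1 1 * _]mul1r in sym.
have lt := tens_form_linear (trace_linear (tr m)).
exact: (scalar_symmetrize two0 lt sym h2).
Qed.

Lemma quot_rep_sym b : quot_rep b \in subalg_gen (fun w => exists a : A, w = tens a a).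
Proof.
set S := fun w => _; have lS := @subalg_gen_linear K (tensor A A) S.
have S1 : 1 \in subalg_gen S by exact: rpred1.
have ZS k h : k *: tens h h \in subalg_gen S.
  by apply: rpredZ; apply: subalg_genW; exists h.
have step g k h u : bmw_rep g = k *: tens h h -> quot_rep u \in subalg_gen S ->
    quot_rep (g * u) \in subalg_gen S.
  move=> e hu; rewrite (amM quot_rep_morphism); apply: rpredM => //.
  by rewrite /quot_rep e (amZ mtp) /tens_p (tens_mapE mp).
apply: (BMW_ind (P := fun b => quot_rep b \in subalg_gen S)).
- by move=> k u v hu hv; rewrite quot_rep_morphism.1; apply: lS.
- by rewrite (am1 quot_rep_morphism).
- by move=> i u; apply: step; apply: (bmw_rep_G q0 z0 d0).
- by move=> i u; apply: step; apply: (bmw_rep_Gi q0 z0 d0).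
Qed.

(** A square [tens x x] is half of a bracket. *)
Lemma quot_rep_surj w : w \in subalg_gen (fun w => exists a : A, w = tens a a) ->
  exists b, quot_rep b = w.
Proof.
have mr := quot_rep_morphism.
move=> /asboolP /(_ [pred w | `[< exists b, quot_rep b = w >]]) h; apply/asboolP; apply: h.
- split.
  + by apply/asboolP; exists 1; rewrite (am1 mr).
  + move=> k u v /asboolP [b <-] /asboolP [b' <-]; apply/asboolP; exists (k *: b + b').
    by rewrite mr.1.
  + move=> u v /asboolP [b <-] /asboolP [b' <-]; apply/asboolP; exists (b * b').
    by rewrite (amM mr).
move=> _ [x ->]; apply/asboolP.
have /bmw_rep_imageP [b e] := bmw_rep_image_bracket two0 q0 z0 d0 c1 c2 (s x) (s x).
exists (2^-1 *: b); rewrite (amZ mr) /quot_rep e /bracket (amD mtp) /tens_p (tens_mapE mp) sK.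
by rewrite -mulr2n -scaler_nat scalerA mulVf ?scale1r.
Qed.

(** The algebra [A] is any model of the quotient of the Temperley-Lieb algebra by the radical of its
    Markov trace; the section [s] replaces a choice of representatives. *)
Theorem BMW_bar_iso : alg_iso (BMW_bar r q m) (sym_square A).
Proof.
have mr := quot_rep_morphism; set I := radical (BMW_trace r q m).
pose f (x : BMW_bar r q m) : sym_square A := SubAlg (quot_rep_sym (arepr x)).
have fE (b : BMW r q m) : val (f (api I b)) = quot_rep b.
  apply/eqP; rewrite -subr_eq0 -(amB mr); apply/eqP/quot_rep_radical.
  by apply/api_eq; exact: areprK.
pose g (y : sym_square A) : BMW_bar r q m := api I (projT1 (cid (quot_rep_surj (valP y)))).
exists f; split; last exists g.
- split; last split.
  + move=> k x y; rewrite -[x]areprK -[y]areprK -apiZ -apiD; apply: val_inj.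
    by rewrite fE mr.1 -!fE.
  + by apply: val_inj; rewrite -api1 fE (am1 mr).
  + move=> x y; rewrite -[x]areprK -[y]areprK -apiM; apply: val_inj.
    by rewrite fE (amM mr) -!fE.
- move=> x; rewrite /g; case: (cid _) => b /= e.
  rewrite -[x]areprK; apply/api_eq/quot_rep_radical.
  by rewrite (amB mr) e subrr.
- by move=> y; apply: val_inj; rewrite fE /g; case: (cid _).
Qed.

End Quotient.

(** In characteristic zero, the four conditions fail when [q ^+ 2] has the order [1], [2], [3] and
    [4] in turn: [(q + q^-1) ^+ 2] is [1] on the primitive third roots and [2] on the primitive
    fourth roots. *)
Lemma quantum_nonvanishing (K : fieldType) (q : K) : q != 0 ->
  (forall k, (0 < k <= 4)%N -> (q ^+ 2) ^+ k != 1) ->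
  [/\ q * q - 1 != 0, q * q + 1 != 0, ((q + q^-1) ^+ 2)^-1 != 1 &
     1 - 2 * ((q + q^-1) ^+ 2)^-1 != 0].
Proof.
move=> q0 h; have dE : q ^+ 2 * (q + q^-1) ^+ 2 = (q ^+ 2 + 1) ^+ 2 by field; rewrite q0.
have d0 : q * q + 1 != 0.
  apply: contraNneq (h 2 isT) => e; apply/eqP.
  have -> : q ^+ 2 = -1 by apply/eqP; rewrite -addr_eq0 expr2 e.
  by rewrite sqrrN expr1n.
have x0 : (q + q^-1) ^+ 2 != 0.
  by apply: contraNneq d0 => e; move: dE; rewrite e mulr0 => /esym/eqP; rewrite sqrf_eq0 expr2.
split=> //.
- by rewrite subr_eq0 -expr2 -[_ ^+ 2]expr1; apply: h.
- apply: contraNneq (h 3 isT) => /eqP; rewrite invr_eq1 => /eqP e.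
  move: dE; rewrite e mulr1 => /eqP; rewrite -subr_eq0 => /eqP dE; rewrite -subr_eq0; apply/eqP.
  have -> : (q ^+ 2) ^+ 3 - 1 = (1 - q ^+ 2) * (q ^+ 2 - (q ^+ 2 + 1) ^+ 2) by ring.
  by rewrite dE mulr0.
- apply: contraNneq (h 4 isT) => /eqP; rewrite subr_eq0 => /eqP e.
  have {}e : (q + q^-1) ^+ 2 = 2 by rewrite -[RHS](mulfVK x0) -e mul1r.
  move: dE; rewrite e => /eqP; rewrite -subr_eq0 => /eqP dE; rewrite -subr_eq0; apply/eqP.
  have -> : (q ^+ 2) ^+ 4 - 1 = (1 - q ^+ 4) * (q ^+ 2 * 2 - (q ^+ 2 + 1) ^+ 2) by ring.
  by rewrite dE mulr0.
Qed.

Theorem theorem6p2 (R : realType) (q r : R[i]) (m : nat) :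
  q != 0 -> r = q ^+ 3 ->
  ((forall n : nat, (0 < n)%N -> q ^+ n != 1) ->
     alg_iso (BMW_bar r q m) (sym_square (TL q m)))
  /\
  (forall l : nat, (6 <= l)%N -> l.-primitive_root (q ^+ 2) ->
     alg_iso (BMW_bar r q m) (sym_square (TL_bar q m))).
Proof.
move=> q0 ->; have two0 : (2 : R[i]) != 0 by rewrite Num.Theory.pnatr_eq0.
split=> [gen|l l6 prim].
- have [k /andP[k0 _]|z0 d0 c1 c2] := quantum_nonvanishing q0.
    by rewrite -exprM; apply: gen; rewrite muln_gt0.
  apply: (BMW_bar_iso two0 q0 z0 d0 c1 c2 (p := id) (s := id)) => // a.
  split=> [-> b|h]; first by rewrite mul0r tr0.
  exact: (TL_tr_nondegenerate (TL_trace_markov q0 d0) q0 gen h).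
- have [k /andP[k0 k4]|z0 d0 c1 c2] := quantum_nonvanishing q0.
    rewrite -(prim_order_dvd prim); apply/negP => /(dvdn_leq k0) lk.
    by have := leq_trans (leq_trans l6 lk) k4.
  apply: (BMW_bar_iso two0 q0 z0 d0 c1 c2 (p := api _) (s := @arepr _ _ _)).
  + exact: api_morphism.
  + exact: areprK.
  + move=> a; rewrite -[X in _ = X <-> _](api0 (radical (TL_trace q m))) api_eq subr0.
    by split=> [/asboolP|h] //; apply/asboolP.
Qed.
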